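(* Assume that conditions $(A)$, $(L)$, $(H)$, $(R)$ and $(H_1)$ (all spelled out in the context) hold for the $T$-periodic stochastic feedback system $$dX_t=\left(AX_t+h(t,X_t)\right)dt+\sum_{k=1}^{d}\sigma_kX_t\, dW_t^k \quad\text{in } \mathbb{R}_+^d .$$ Then there exists a unique nonnegative fixed point $u\in(\mathcal{M},\rho)$ of the gain operator $\mathcal{K}^h$ such that for any $t\in\mathbb{R}$, $$\lim_{n\to\infty}\varphi(t,-nT,\cdot)x=\mathcal{K}(u)(t,\cdot),\quad x\in\mathbb{R}_+^d,\quad \mathbb{P}\text{-a.s.}$$ Furthermore, for almost all $\omega\in\Omega$, $$\varphi(t,s,\omega)\mathcal{K}(u)(s,\omega)=\mathcal{K}(u)(t,\omega),\qquad \mathcal{K}(u)(r+T,\omega)=\mathcal{K}(u)(r,\theta_T\omega),\qquad\text{for any }(t,s)\in\triangle,\ r\in\mathbb{R},$$ i.e., $\mathcal{K}(u)$ is a random periodic solution (of period $T$) of the forward stochastic flow $\varphi$ generated by the system in $\mathbb{R}_+^d$, and for any $t\in\mathbb{R}$ all pull-back trajectories originating from the nonnegative orthant converge to this positive random periodic solution almost surely.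
   Context: Notation. $\mathbb{R}_+=[0,\infty)$; $\mathbb{R}_+^d$ carries the componentwise order ($x\ge y$ iff $x-y\in\mathbb{R}_+^d$). $\triangle=\{(t,s)\in\mathbb{R}^2: s\le t\}$. $|x|=\max_i|x_i|$ for $x\in\mathbb{R}^d$. $W_t=(W_t^1,\dots,W_t^d)$ is a two-sided Wiener process in $\mathbb{R}^d$ on the canonical Wiener space $(\Omega,\mathcal{F},\mathbb{P})$, $\Omega=\{\omega\in C(\mathbb{R},\mathbb{R}^d):\omega(0)=0\}$, $W_t(\omega)=\omega(t)$; $\mathcal{F}_s^t$ is the least complete $\sigma$-field for which all $W_u-W_v$, $s\le v\le u\le t$, are measurable, and $\mathcal{F}^t=\bigvee_{s\le t}\mathcal{F}_s^t$. $\theta_t\omega(\cdot)=\omega(t+\cdot)-\omega(t)$, $t\in\mathbb{R}$. Convention: a universal set of full $\mathbb{P}$-measure is again denoted $\Omega$, so ''for all $\omega\in\Omega$'' is understood up to such a set. System data. $A=(a_{ij})$ is a real $d\times d$ matrix; $\sigma_k=\mathrm{diag}(\sigma_k^1,\dots,\sigma_k^d)$, $k=1,\dots,d$, are real diagonal matrices; $T>0$; $h:\mathbb{R}\times\mathbb{R}_+^d\to\mathbb{R}_+^d$ satisfies $h(t+T,x)=h(t,x)$ for all $t,x$. $\Phi(t,\omega)=(\Phi_{ij}(t,\omega))_{d\times d}$, $t\ge0$, is the fundamental matrix of the linear Itô equation $dX_t=AX_tdt+\sum_{k=1}^d\sigma_kX_tdW^k_t$ with $\Phi(0)=I$; it is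 a linear random dynamical system over $\theta$: $\Phi(t+s,\omega)=\Phi(t,\theta_s\omega)\Phi(s,\omega)$. Flow. $\varphi(t,s,\omega)x$, $(t,s)\in\triangle$, $x\in\mathbb{R}_+^d$, denotes the unique solution in $\mathbb{R}_+^d$ at time $t$ of the system with value $x$ at time $s$; it is a forward stochastic flow on $\mathbb{R}_+^d$ and satisfies $\varphi(t,s,\omega)x=\Phi(t-s,\theta_s\omega)x+\int_s^t\Phi(t-r,\theta_r\omega)h(r,\varphi(r,s,\omega)x)\,dr$. The maps $n\mapsto\varphi(t,-nT,\omega)x$ are the pull-back trajectories. Random periodic solution of period $T$ for $\varphi$: an $\mathcal{F}$-measurable map $Y:\mathbb{R}\times\Omega\to\mathbb{R}_+^d$ such that for almost all $\omega$, $\varphi(t,s,\omega)Y(s,\omega)=Y(t,\omega)$ and $Y(r+T,\omega)=Y(r,\theta_T\omega)$ for all $(t,s)\in\triangle$, $r\in\mathbb{R}$. Conditions. $(A)$: $A$ is cooperative, i.e. $a_{ij}\ge0$ for all $i\ne j$. $(L)$: the top Lyapunov exponent of the linear random dynamical system $(\theta,\Phi)$ is a negative real number, i.e. there exist a constant $\lambda>0$ and a stochastic process $R(t,\omega)>0$ ($t\ge0$) such that for every $\gamma>0$, $\sup_{t\in\mathbb{R}}\{e^{-\gamma|t|}\sup_{s\in\mathbb{R}_+}R(s,\theta_t\omega)\}<\infty$, and for all $t\ge0$, $\omega\in\Omega$: $\|\Phi(t,\omega)\|:=\max_{i,j}|\Phi_{ij}(t,\omega)|\le R(t,\omega)e^{-\lambda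 t}$. $(H)$: $h\in C_b^1(\mathbb{R}\times\mathbb{R}_+^d,\mathbb{R}_+^d\setminus\{0\})$, i.e. $h$ and its derivatives are bounded, and either $h$ is order-preserving ($x_1\le x_2\Rightarrow h(t,x_1)\le h(t,x_2)$ for all $t$) or anti-order-preserving ($x_1\le x_2\Rightarrow h(t,x_1)\ge h(t,x_2)$ for all $t$) in $\mathbb{R}_+^d$. $(R)$: with $R$ from $(L)$, $R(t-s,\theta_s\omega)$ is $\mathcal{F}_s^t$-measurable for $(t,s)\in\triangle$, and $\sup_{t\in\mathbb{R}_+}\mathbb{E}(R(t,\omega))<\infty$. $(H_1)$: with $L:=\max\{\sup_{t\in\mathbb{R},x\in\mathbb{R}_+^d}|\partial h_i(t,x)/\partial x_j|:i,j=1,\dots,d\}$, one has $\sup_{t\in\mathbb{R}_+}\mathbb{E}(R(t,\omega))<\frac{\lambda}{Ld^2}$. Operators and space. For a bounded process $v:\mathbb{R}\times\Omega\to\mathbb{R}_+^d$, $\mathcal{K}(v)(t,\omega)=\int_{-\infty}^t\Phi(t-s,\theta_s\omega)v(s,\omega)\,ds$, and the gain operator is $\mathcal{K}^h(v)(t,\omega)=h(t,\mathcal{K}(v)(t,\omega))$. Let $\boldsymbol{N}=(N_1,\dots,N_d)$, $N_i=\sup_{t\in\mathbb{R},x\in\mathbb{R}_+^d}|h_i(t,x)|$, and $[\boldsymbol{0},\boldsymbol{N}]=\{y:0\le y_i\le N_i\ \forall i\}$. $\mathcal{M}$ is the space of all processes $f:\mathbb{R}\times\Omega\to[\boldsymbol{0},\boldsymbol{N}]$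 that are progressively measurable with respect to $\{\mathcal{F}^t\}_{t\in\mathbb{R}}$ and satisfy $f(t+T,\omega)=f(t,\theta_T\omega)$ for all $t\in\mathbb{R}$, $\omega\in\Omega$, with metric $\rho(f_1,f_2)=\sup_{t\in\mathbb{R}}\mathbb{E}|f_1(t,\omega)-f_2(t,\omega)|$. That $u$ is a fixed point of $\mathcal{K}^h$ means that for any $t\in\mathbb{R}$, $\mathcal{K}^h(u)(t,\cdot)=u(t,\cdot)$ $\mathbb{P}$-a.s. *)

(* Defs.v *)
From HB Require Import structures.
From mathcomp Require Import all_boot all_order all_algebra.
From mathcomp Require Import all_classical all_reals all_analysis.

Set Implicit Arguments.
Unset Strict Implicit.
Unset Printing Implicit Defensive.

Import Order.TTheory GRing.Theory Num.Theory.
Import numFieldNormedType.Exports.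

Local Open Scope classical_set_scope.
Local Open Scope ring_scope.

(* Vectors of R^d are column matrices.  On ['cV[R]_d] and ['M[R]_d] the library
   norm [`| _ |] is the maximum of the absolute values of the entries. *)

(** * The orthant *)

Definition orthant (R : realType) (d : nat) : set 'cV[R]_d :=
  [set x | forall i, 0 <= x i 0].
Arguments orthant {R d}.

Definition lev (R : realType) (d : nat) (x y : 'cV[R]_d) : Prop :=
  orthant (y - x).

Definition vintegral (R : realType) (d : nat) (D : set R) (f : R -> 'cV[R]_d) :
    'cV[R]_d :=
  \col_i (\int[lebesgue_measure]_(r in D) f r i 0).

(** * Canonical Wiener space *)

Record wpath (R : realType) (d : nat) := WPath {
  wpath_fun :> R -> 'cV[R]_d;
  wpath_continuous : continuous wpath_fun;
  wpath0 : wpath_fun 0 = 0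
}.

HB.instance Definition _ (R : realType) (d : nat) := gen_eqMixin (wpath R d).
HB.instance Definition _ (R : realType) (d : nat) :=
  gen_choiceMixin (wpath R d).

Definition wpath_null (R : realType) (d : nat) : wpath R d :=
  @WPath R d (fun=> 0) (fun _ => cvg_cst _) erefl.

HB.instance Definition _ (R : realType) (d : nat) :=
  isPointed.Build (wpath R d) (@wpath_null R d).

Section shift.
Context {R : realType} {d : nat}.

Fact wshift_continuous (t : R) (w : wpath R d) :
  continuous (fun u => w (t + u) - w t).
Proof.
move=> u; apply: cvgB; last exact: cvg_cst.
apply: (@continuous_comp _ _ _ (fun u : R => t + u) w).
  by apply: cvgD; [exact: cvg_cst | exact: cvg_id].
exact: wpath_continuous.
Qed.

Fact wshift0 (t : R) (w : wpath R d) : w (t + 0) - w t = 0.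
Proof. by rewrite addr0 subrr. Qed.

Definition wshift (t : R) (w : wpath R d) : wpath R d :=
  @WPath R d _ (@wshift_continuous t w) (wshift0 t w).

End shift.

Definition wcylinders (R : realType) (d : nat) : set (set (wpath R d)) :=
  [set A | exists (t : R) (i : 'I_d) (B : set R),
     measurable B /\ A = [set w : wpath R d | B (w t i 0)]].

(* The Borel sigma-algebra of the topology of locally uniform convergence is
   generated by the coordinate maps. *)
Definition wborel (R : realType) (d : nat) : Type :=
  g_sigma_algebraType (@wcylinders R d).
HB.instance Definition _ (R : realType) (d : nat) :=
  Measurable.on (wborel R d).

(* Two-sided Wiener measure: the increments over consecutive intervals are
   independent, with independent centred Gaussian components whose variance is
   the length of the interval.  The second parameter of [normal_prob] is the
   standard deviation. *)
Definition wiener_measure (R : realType) (d : nat)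
    (P0 : probability (wborel R d) R) : Prop :=
  forall (n : nat) (tau : nat -> R) (B : nat -> 'I_d -> set R),
    (forall m, (m < n)%N -> tau m < tau m.+1) ->
    (forall m k, measurable (B m k)) ->
    P0 [set w : wpath R d | forall m : nat, (m < n)%N -> forall k : 'I_d,
          B m k (w (tau m.+1) k 0 - w (tau m) k 0)] =
    (\prod_(m < n) \prod_(k < d)
       normal_prob 0 (Num.sqrt (tau m.+1 - tau m)) (B m k))%E.

(** * The completed probability space and its filtration *)

Section wiener_space.
Context {R : realType} {d : nat}.
Variable P0 : probability (wborel R d) R.

(* (Omega, F, P) is the completion of (Omega, Borel, P0): the Caratheodory
   extension of [P0] is its completion. *)
Definition wspace : Type := caratheodory_type (P0^*)%mu.
HB.instance Definition _ := Measurable.on wspace.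

Definition wprob : set wspace -> \bar R :=
  @completed_measure_extension _ _ _ P0.
HB.instance Definition _ := Measure.on wprob.

Fact wprob_setT : wprob setT = 1%E.
Proof.
rewrite /wprob /completed_measure_extension measurable_mu_extE//.
exact: probability_setT.
Qed.

HB.instance Definition _ := @Measure_isProbability.Build _ _ R wprob wprob_setT.

(* [Fgen s t] generates F_s^t: increments of W on [s, t] and the null sets. *)
Definition Fgen (s t : R) : set (set (wpath R d)) :=
  [set A | exists (v u : R) (i : 'I_d) (B : set R),
     [/\ s <= v, v <= u, u <= t, measurable B &
         A = [set w : wpath R d | B (w u i 0 - w v i 0)]]]
  `|` wprob.-negligible.

Definition Fpast_gen (t : R) : set (set (wpath R d)) :=
  \bigcup_(s in [set s | s <= t]) <<s Fgen s t >>.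

Definition F_measurable (X : wpath R d -> R) : Prop :=
  measurable_fun setT (X : wspace -> R).

Definition Fst_measurable (s t : R) (X : wpath R d -> R) : Prop :=
  measurable_fun setT (X : g_sigma_algebraType (Fgen s t) -> R).

(** * Itô integral and Itô equations *)

Definition cvg_in_probability (X : nat -> wpath R d -> \bar R) : Prop :=
  forall eps : R, 0 < eps ->
    (fun n => wprob [set w | (eps%:E <= X n w)%E]) @ \oo --> 0%E.

(* The value is [simple_val i] on the half-open interval from [simple_time i]
   (excluded) to [simple_time i.+1] (included). *)
Record simple_process (s t : R) := SimpleProcess {
  simple_size : nat;
  simple_time : nat -> R;
  simple_val : nat -> wpath R d -> R;
  simple_time0 : simple_time 0%N = s;
  simple_timen : simple_time simple_size = t;
  simple_time_le : forall i, (i < simple_size)%N ->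
    simple_time i <= simple_time i.+1;
  simple_val_bounded : exists C : R, forall i w, `|simple_val i w| <= C;
  simple_val_adapted : forall i, (i < simple_size)%N ->
    Fst_measurable s (simple_time i) (simple_val i)
}.

Definition simple_eval s t (H : simple_process s t) (r : R) (w : wpath R d) : R :=
  \sum_(i < simple_size H)
    simple_val H i w * \1_(`]simple_time H i, simple_time H i.+1]) r.

Definition simple_integral s t (H : simple_process s t) (k : 'I_d)
    (w : wpath R d) : R :=
  \sum_(i < simple_size H)
    simple_val H i w * (w (simple_time H i.+1) k 0 - w (simple_time H i) k 0).

(* [J] is the Itô integral of [Y] against the [k]-th component of W on [s, t]:
   the limit in probability of the integrals of simple adapted processes whose
   squared L^2([s, t]) distance to [Y] tends to 0 in probability. *)
Definition is_ito_integral (s t : R) (k : 'I_d) (Y : R -> wpath R d -> R)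
    (J : wpath R d -> R) : Prop :=
  exists H : nat -> simple_process s t,
    cvg_in_probability (fun n w =>
      (\int[lebesgue_measure]_(r in `[s, t])
         (((simple_eval (H n) r w - Y r w) ^+ 2)%R)%:E)%E) /\
    cvg_in_probability (fun n w => `|simple_integral (H n) k w - J w|%:E).

Variable Om : set (wpath R d).

(* Strong solution on [s, +oo[ of
     dX = f(t, X) dt + sum_k sigma_k X dW^k,  X_s = x. *)
Definition sde_solution (sigma : 'I_d -> 'M[R]_d) (f : R -> 'cV[R]_d -> 'cV[R]_d)
    (s : R) (x : 'cV[R]_d) (X : R -> wpath R d -> 'cV[R]_d) : Prop :=
  [/\ (forall t i, s <= t -> Fst_measurable s t (fun w => X t w i 0)),
      (forall w, Om w -> {within `[s, +oo[, continuous (fun t => X t w)}) &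
      forall t i, s <= t -> exists J : 'I_d -> wpath R d -> R,
        (forall k,
           is_ito_integral s t k (fun r w => (sigma k *m X r w) i 0) (J k)) /\
        {ae wprob, forall w,
           X t w i 0 = x i 0
             + \int[lebesgue_measure]_(r in `[s, t]) f r (X r w) i 0
             + \sum_(k < d) J k w}].

(* [Om] is the universal set of full measure that replaces the whole path
   space; being again the base of the shift flow, it is shift-invariant. *)
Definition universal_set : Prop :=
  wprob.-negligible (~` Om) /\ forall t w, Om w -> Om (wshift t w).

(* Fundamental matrix of dX = A X dt + sum_k sigma_k X dW^k: its columns are
   solutions that stay linearly independent. *)
Definition fundamental_matrix (A : 'M[R]_d) (sigma : 'I_d -> 'M[R]_d)
    (Phi : R -> wpath R d -> 'M[R]_d) : Prop :=
  [/\ (forall j, sde_solution sigma (fun _ x => A *m x) 0 (delta_mx j 0)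
         (fun t w => col j (Phi t w))),
      (forall w, Om w -> Phi 0 w = 1%:M) &
      forall t w, 0 <= t -> Om w -> Phi t w \in unitmx].

Definition linear_cocycle (Phi : R -> wpath R d -> 'M[R]_d) : Prop :=
  forall t s w, 0 <= t -> 0 <= s -> Om w ->
    Phi (t + s) w = Phi t (wshift s w) *m Phi s w.

(* The values of [phi t s w] matter only for s <= t and on the orthant. *)
Definition generated_flow (A : 'M[R]_d) (sigma : 'I_d -> 'M[R]_d)
    (h : R -> 'cV[R]_d -> 'cV[R]_d) (Phi : R -> wpath R d -> 'M[R]_d)
    (phi : R -> R -> wpath R d -> 'cV[R]_d -> 'cV[R]_d) : Prop :=
  [/\ (forall t s w x, s <= t -> Om w -> orthant x -> orthant (phi t s w x)),
      (forall s x, orthant x ->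
         sde_solution sigma (fun t y => A *m y + h t y) s x
           (fun t w => phi t s w x)),
      (forall s w x, Om w -> orthant x -> phi s s w x = x),
      (forall t r s w x, s <= r -> r <= t -> Om w -> orthant x ->
         phi t s w x = phi t r w (phi r s w x)) &
      forall t s w x, s <= t -> Om w -> orthant x ->
        phi t s w x = Phi (t - s) (wshift s w) *m x
          + vintegral `[s, t]
              (fun r => Phi (t - r) (wshift r w) *m h r (phi r s w x))].

(** * Conditions on the coefficients *)

Definition cond_A (A : 'M[R]_d) : Prop := forall i j, i != j -> 0 <= A i j.

Definition cond_L (Phi : R -> wpath R d -> 'M[R]_d) (lam : R)
    (Rp : R -> wpath R d -> R) : Prop :=
  [/\ 0 < lam,
      (forall t, 0 <= t -> F_measurable (Rp t)),
      (forall t w, 0 <= t -> Om w -> 0 < Rp t w),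
      (forall gam w, 0 < gam -> Om w ->
         (ereal_sup [set (expR (- (gam * `|t|)))%:E *
            ereal_sup [set (Rp s (wshift t w))%:E | s in `[0%R, +oo[]
          | t in [set: R]] < +oo)%E) &
      forall t w, 0 <= t -> Om w -> `|Phi t w| <= Rp t w * expR (- (lam * t))].

Definition sup_mean (Rp : R -> wpath R d -> R) : \bar R :=
  ereal_sup [set ('E_wprob[Rp t])%E | t in `[0, +oo[].

Definition cond_R (Rp : R -> wpath R d -> R) : Prop :=
  (forall t s, s <= t ->
     Fst_measurable s t (fun w => Rp (t - s) (wshift s w))) /\
  (sup_mean Rp < +oo)%E.

Section nonlinearity.
Variable h : R -> 'cV[R]_d -> 'cV[R]_d.

(* d h_i / d x_j on the orthant, one-sided where x_j = 0. *)
Definition dquot (i j : 'I_d) (t : R) (x : 'cV[R]_d) (tau : R) : R :=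
  (h t (x + tau *: delta_mx j 0) i 0 - h t x i 0) / tau.

Definition dfilter (j : 'I_d) (x : 'cV[R]_d) : set_system R :=
  within [set tau | orthant (x + tau *: delta_mx j 0)] (0^')%classic.

Definition hpartial (i j : 'I_d) (t : R) (x : 'cV[R]_d) : R :=
  lim (dquot i j t x @ dfilter j x).

Definition continuous_bounded (g : R -> 'cV[R]_d -> R) : Prop :=
  {within [set p : R * 'cV[R]_d | orthant p.2],
     continuous (fun p : R * 'cV[R]_d => g p.1 p.2)} /\
  exists C : R, forall t x, orthant x -> `|g t x| <= C.

(* C^1 on R x (closed orthant): all first-order partial derivatives exist and
   are continuous up to the boundary. *)
Definition Cb1_map : Prop :=
  [/\ (forall t x, orthant x -> orthant (h t x) /\ h t x <> 0),
      (forall i, continuous_bounded (fun t x => h t x i 0)),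
      (forall i, (forall t x, orthant x ->
           derivable (fun u : R => h u x i 0) t 1) /\
         continuous_bounded (fun t x => derive1 (fun u : R => h u x i 0) t)) &
      forall i j, (forall t x, orthant x ->
           cvg (dquot i j t x @ dfilter j x)) /\
         continuous_bounded (hpartial i j)].

Definition order_preserving : Prop :=
  forall t x1 x2, orthant x1 -> orthant x2 -> lev x1 x2 ->
    lev (h t x1) (h t x2).

Definition anti_order_preserving : Prop :=
  forall t x1 x2, orthant x1 -> orthant x2 -> lev x1 x2 ->
    lev (h t x2) (h t x1).

Definition cond_H : Prop :=
  Cb1_map /\ (order_preserving \/ anti_order_preserving).

Definition hlip : R :=
  \big[Num.max/0]_(i < d) \big[Num.max/0]_(j < d)
    sup [set `|hpartial i j p.1 p.2| | p in [set p | orthant p.2]].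

Definition hbound : 'cV[R]_d :=
  \col_i sup [set `|h p.1 p.2 i 0| | p in [set p | orthant p.2]].

(* The quotient is taken in the extended reals, so that it is +oo when the
   partial derivatives of [h] in x all vanish. *)
Definition cond_H1 (lam : R) (Rp : R -> wpath R d -> R) : Prop :=
  (sup_mean Rp < lam%:E / (hlip * d%:R ^+ 2)%:E)%E.

(** * Gain operator, its domain, and random periodic solutions *)

Definition Kop (Phi : R -> wpath R d -> 'M[R]_d)
    (v : R -> wpath R d -> 'cV[R]_d) (t : R) (w : wpath R d) : 'cV[R]_d :=
  vintegral `]-oo, t] (fun s => Phi (t - s) (wshift s w) *m v s w).

Definition gain (Phi : R -> wpath R d -> 'M[R]_d)
    (v : R -> wpath R d -> 'cV[R]_d) (t : R) (w : wpath R d) : 'cV[R]_d :=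
  h t (Kop Phi v t w).

Definition progressively_measurable (f : R -> wpath R d -> 'cV[R]_d) : Prop :=
  forall t i, @measurable_fun _ _
    (measurableTypeR R * g_sigma_algebraType (Fpast_gen t))%type R
    ([set r : R | r <= t] `*` Om) (fun p => f p.1 p.2 i 0).

(* Together with [Mdist] below, this is the metric space M; two of its elements
   are identified when their distance is 0, i.e. when they are modifications of
   each other. *)
Definition Mspace (T : R) (f : R -> wpath R d -> 'cV[R]_d) : Prop :=
  [/\ (forall t w, Om w -> orthant (f t w) /\ lev (f t w) hbound),
      progressively_measurable f &
      forall t w, Om w -> f (t + T) w = f t (wshift T w)].

End nonlinearity.

Definition Mdist (f1 f2 : R -> wpath R d -> 'cV[R]_d) : \bar R :=
  ereal_sup [set ('E_wprob[(fun w => `|f1 t w - f2 t w|)%R])%E | t in [set: R]].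

Definition fixed_point (K : (R -> wpath R d -> 'cV[R]_d) ->
    R -> wpath R d -> 'cV[R]_d) (u : R -> wpath R d -> 'cV[R]_d) : Prop :=
  forall t, {ae wprob, forall w, K u t w = u t w}.

Definition random_periodic_solution (T : R)
    (phi : R -> R -> wpath R d -> 'cV[R]_d -> 'cV[R]_d)
    (Y : R -> wpath R d -> 'cV[R]_d) : Prop :=
  [/\ (forall i, @measurable_fun _ _ (measurableTypeR R * wspace)%type R
         (setT `*` Om) (fun p => Y p.1 p.2 i 0)),
      (forall t w, Om w -> orthant (Y t w)) &
      {ae wprob, forall w,
         (forall t s, s <= t -> phi t s w (Y s w) = Y t w) /\
         (forall r, Y (r + T) w = Y r (wshift T w))}].

End wiener_space.

Arguments wprob {R d} P0 _.

(* Main.v *)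
(* By variation of constants and the Lipschitz bound of [h], the distance of two
   solutions started at time [s] is dominated by the Picard iterates of a linear
   Volterra inequality whose kernel is [|Phi (t - r) (wshift r w)|].  The kernel
   depends on the increments after [r] only, hence is independent of the
   preceding iterate at time [r]; taking means turns the inequality into a
   deterministic one, which condition (H1) makes contracting.  The mean decay is
   exponential, so by summation over the starting times [-nT] the solutions
   almost surely lose their memory exponentially fast, and the pull-back
   trajectories converge to a limit [X] that does not depend on the starting
   point.  Passing to the limit in the variation of constants formula gives
   [X = K (h X)], so [h X] is a fixed point of the gain operator; periodicity of
   [X] is inherited from that of the flow.  For another fixed point [v], Fubini
   shows that almost surely [K v] is a solution on the whole line; it is
   tempered, so it cannot differ from [X]. *)

(* The Picard iterates contain no solution: they see the path only through the kernel. Hence one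
   null set serves all starting points and also the competitor [Kop Phi v], and the random initial
   values that arise when a start is moved back by one period need no independence. The order of the
   iterate is taken equal to the index [n] of the starting time [- n T], so that both errors, the
   memory of the start and the truncation of the iteration, are geometric in [n]. The factor [d ^ 2]
   of (H1) has two sources: the entrywise maximum norm of a matrix product costs one [d], the sum
   over the partial derivatives of [h] the other. The main obstacle is measurability. Kernel and
   flow are adapted at fixed times and continuous in the final time only, whereas Tonelli needs
   joint measurability. It is recovered by discretising the final time and by writing the kernel
   from [r] to [t] as [Psi t s *m invmx (Psi r s)] with a fixed origin [s]. *)
Require Import Defs.
From HB Require Import structures.
From mathcomp Require Import all_boot all_order all_algebra.
From mathcomp Require Import all_classical all_reals all_analysis.
From mathcomp Require Import measurable_realfun ring lra.

Import Order.TTheory GRing.Theory Num.Theory.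
Import numFieldNormedType.Exports.

Local Open Scope classical_set_scope.
Local Open Scope ring_scope.

Set Implicit Arguments.
Unset Strict Implicit.
Unset Printing Implicit Defensive.

(** * Increments and shifts of Wiener paths *)

Section pi_system.
Context {dT : measure_display} {R : realType} {T : measurableType dT}.

Lemma pi_system_measure_eq (G : set (set T)) (m1 m2 : {measure set T -> \bar R}) :
  G `<=` measurable -> setI_closed G ->
  m1 setT = m2 setT -> (m1 setT < +oo)%E ->
  (forall A, G A -> m1 A = m2 A) -> forall A, <<s G >> A -> m1 A = m2 A.
Proof.
move=> Gm GI m12T m1oo m12 A GA.
have GE : [set X | G X /\ X `<=` setT] = G.
  by apply/seteqP; split=> [X []|X ?].
apply: (@g_sigma_algebra_measure_unique_trace _ _ _ G setT measurableT) => //;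
  by rewrite ?GE//= => B [].
Qed.

End pi_system.

Section paths.
Context {R : realType} {d : nat}.
Implicit Types w : wpath R d.

Lemma wpath_ext w w' : (forall t, w t = w' t) -> w = w'.
Proof.
case: w w' => [f cf f0] [g cg g0] /= fg.
have E : f = g by apply/funext.
by move: cf f0; rewrite E => cf f0; congr WPath; apply: Prop_irrelevance.
Qed.

Lemma wshiftD s t w : wshift s (wshift t w) = wshift (t + s) w.
Proof. by apply: wpath_ext => u /=; rewrite addrA opprB addrA subrK. Qed.

Lemma wshift_id w : wshift 0 w = w.
Proof. by apply: wpath_ext => u /=; rewrite add0r wpath0 subr0. Qed.

Definition incr_events (I : set R) : set (set (wpath R d)) :=
  [set A | exists v u (i : 'I_d) (B : set R),
     [/\ I v, I u, measurable B & A = [set w : wpath R d | B (w u i 0 - w v i 0)]]].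

(** These are the events whose probability [wiener_measure] prescribes, along the consecutive points
    of [tau]. *)
Definition grid_event (tau : seq R) (B : nat -> 'I_d -> set R) : set (wpath R d) :=
  [set w : wpath R d | forall m : nat, (m < (size tau).-1)%N -> forall k : 'I_d,
     B m k (w (nth 0 tau m.+1) k 0 - w (nth 0 tau m) k 0)].

Definition grid_events (tau : seq R) : set (set (wpath R d)) :=
  [set A | exists2 B : nat -> 'I_d -> set R,
     (forall m k, measurable (B m k)) & A = grid_event tau B].

Lemma grid_events_setI tau : setI_closed (grid_events tau).
Proof.
move=> _ _ [B1 mB1 ->] [B2 mB2 ->].
exists (fun m k => B1 m k `&` B2 m k) => [m k|]; first exact: measurableI.
apply/seteqP; split=> [w [h1 h2] m ms k|w h].
  by split; [exact: h1|exact: h2].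
by split=> m ms k; have [] := h m ms k.
Qed.

(** Only consecutive increments generate the sigma-algebra; the others are differences of increments
    from the first grid point, which telescope. *)
Lemma grid_incr_measurable tau u v k : u \in tau -> v \in tau ->
  measurable_fun setT
    ((fun w : wpath R d => w u k 0 - w v k 0) : g_sigma_algebraType (grid_events tau) -> R).
Proof.
move=> ut vt.
suff base x : x \in tau -> measurable_fun setT
    ((fun w : wpath R d => w x k 0 - w (nth 0 tau 0) k 0) :
       g_sigma_algebraType (grid_events tau) -> R).
  have := measurable_funB (base _ ut) (base _ vt).
  by apply: eq_measurable_fun => w _ /=; rewrite opprB addrA subrK.
move=> /(nthP 0)[j js <-] {ut vt u v x}; elim: j js => [js|j IH js].
  have -> : (fun w : g_sigma_algebraType (grid_events tau) =>
     (w : wpath R d) (nth 0 tau 0) k 0 - (w : wpath R d) (nth 0 tau 0) k 0) = cst 0.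
    by apply/funext => w; rewrite subrr.
  exact: measurable_cst.
have step : measurable_fun setT
    ((fun w : wpath R d => w (nth 0 tau j.+1) k 0 - w (nth 0 tau j) k 0) :
       g_sigma_algebraType (grid_events tau) -> R).
  move=> _ B mB; rewrite setTI; apply: sub_sigma_algebra.
  exists (fun m i => if (m == j) && (i == k) then B else setT).
    by move=> m i; case: ifP.
  apply/seteqP; split=> [w Bw m mt i|w h].
    by case: ifP => // /andP[/eqP -> /eqP ->].
  have /= := h j _ k; rewrite !eqxx/=; apply.
  by rewrite -ltnS (leq_trans js)// leqSpred.
have := measurable_funD step (IH (ltnW js)).
by apply: eq_measurable_fun => w _ /=; rewrite addrA subrK.
Qed.

Lemma sub_grid_events tau tau' : {subset tau <= tau'} ->
  <<s grid_events tau >> `<=` <<s grid_events tau' >>.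
Proof.
move=> tt'; apply: smallest_sub; first exact: smallest_sigma_algebra.
move=> _ [B mB ->].
have -> : grid_event tau B =
    \bigcap_(m in `I_(size tau).-1) \bigcap_(k in [set: 'I_d])
      [set w : wpath R d | B m k (w (nth 0 tau m.+1) k 0 - w (nth 0 tau m) k 0)].
  apply/seteqP; split=> w h m mt k //; first by move=> _; exact: h.
  exact: h.
pose T' := g_sigma_algebraType (grid_events tau').
rewrite -[X in X _]/(@measurable _ T').
apply: fin_bigcap_measurable => [|m mt]; first exact: finite_II.
apply: fin_bigcap_measurable => [|k _]; first exact: finite_finset.
have ms : (m.+1 < size tau)%N by move: mt => /=; case: (size tau).
rewrite -[X in measurable X]setTI.
have := @grid_incr_measurable tau' (nth 0 tau m.+1) (nth 0 tau m) k.
apply => //; apply: tt'; apply: mem_nth => //; exact: ltnW.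
Qed.

(* Grids inside a common finer grid generate smaller sigma-algebras, so the
   sigma-algebras of all grids form a pi-system generating the increments. *)
Lemma incr_measure_eq (I : set R) (p : R) (m1 m2 : {measure set (wborel R d) -> \bar R}) :
  I p -> (forall tau, <<s grid_events tau >> `<=` @measurable _ (wborel R d)) ->
  m1 setT = m2 setT -> (m1 setT < +oo)%E ->
  (forall tau B, sorted <%R tau -> p \in tau -> (forall x, x \in tau -> I x) ->
     (forall m k, measurable (B m k)) -> m1 (grid_event tau B) = m2 (grid_event tau B)) ->
  forall A, <<s incr_events I >> A -> m1 A = m2 A.
Proof.
move=> Ip gm m12T m1oo m12.
(* Every grid is made to contain [p]. When [p] is the junction of two time intervals, this is what
   allows grids on either side to be glued in [grid_indep]. *)
pose U := [set A | exists tau, [/\ sorted <%R tau, p \in tau,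
   (forall x, x \in tau -> I x) & <<s grid_events tau >> A]].
have UI : setI_closed U.
  move=> A B [t1 [s1 p1 I1 A1]] [t2 [s2 p2 I2 A2]].
  exists (sort <=%R (undup (t1 ++ t2))); split.
  - by rewrite sort_lt_sorted undup_uniq.
  - by rewrite mem_sort mem_undup mem_cat p1.
  - by move=> x; rewrite mem_sort mem_undup mem_cat => /orP[/I1|/I2].
  - apply: (@measurableI _ (g_sigma_algebraType
      (grid_events (sort <=%R (undup (t1 ++ t2)))))).
      by apply: sub_grid_events A1 => x xt; rewrite mem_sort mem_undup mem_cat xt.
    by apply: sub_grid_events A2 => x xt; rewrite mem_sort mem_undup mem_cat xt orbT.
have Um : U `<=` @measurable _ (wborel R d) by move=> A [tau [_ _ _]] /gm.
have UE A : U A -> m1 A = m2 A.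
  move=> [tau [st pt It tauA]].
  apply: (@pi_system_measure_eq _ R (wborel R d) (grid_events tau)) tauA => //.
  - by move=> B Bt; apply: (gm tau); exact: sub_sigma_algebra.
  - exact: grid_events_setI.
  - by move=> _ [B mB ->]; exact: m12.
move=> A IA.
apply: (@pi_system_measure_eq _ R (wborel R d) U m1 m2 Um UI m12T m1oo UE).
move: A IA; apply: smallest_sub; first exact: smallest_sigma_algebra.
move=> _ [v [u [i [B [Iv Iu mB ->]]]]].
apply: sub_sigma_algebra.
exists (sort <=%R (undup [:: p; u; v])); split.
- by rewrite sort_lt_sorted undup_uniq.
- by rewrite mem_sort mem_undup !inE eqxx.
- by move=> x; rewrite mem_sort mem_undup !inE => /or3P[] /eqP ->.
- have := @grid_incr_measurable (sort <=%R (undup [:: p; u; v])) u v i.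
  rewrite !mem_sort !mem_undup !inE !eqxx !orbT => /(_ isT isT measurableT B mB).
  by rewrite setTI.
Qed.

Lemma wborel_eval t k : measurable_fun setT ((fun w : wpath R d => w t k 0) : wborel R d -> R).
Proof.
move=> _ B mB; rewrite setTI; apply: sub_sigma_algebra.
by exists t, k, B.
Qed.

Lemma incr_events_wborel I : <<s incr_events I >> `<=` @measurable _ (wborel R d).
Proof.
apply: smallest_sub; first exact: smallest_sigma_algebra.
move=> _ [v [u [i [B [_ _ mB ->]]]]].
have := measurable_funB (wborel_eval u i) (wborel_eval v i).
by move=> /(_ measurableT B mB); rewrite setTI.
Qed.

Lemma grid_events_wborel tau :
  <<s grid_events tau >> `<=` @measurable _ (wborel R d).
Proof.
apply: smallest_sub; first exact: smallest_sigma_algebra.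
move=> _ [B mB ->].
have -> : grid_event tau B =
    \bigcap_(m in `I_(size tau).-1) \bigcap_(k in [set: 'I_d])
      [set w : wpath R d | B m k (w (nth 0 tau m.+1) k 0 - w (nth 0 tau m) k 0)].
  apply/seteqP; split=> w h m mt k //; first by move=> _; exact: h.
  exact: h.
apply: fin_bigcap_measurable => [|m mt]; first exact: finite_II.
apply: fin_bigcap_measurable => [|k _]; first exact: finite_finset.
have := measurable_funB (wborel_eval (nth 0 tau m.+1) k) (wborel_eval (nth 0 tau m) k).
by move=> /(_ measurableT _ (mB m k)); rewrite setTI.
Qed.

(** Paths vanish at time 0, so each coordinate is itself an increment. *)
Lemma wborel_incr : @measurable _ (wborel R d) `<=` <<s incr_events setT >>.
Proof.
apply: smallest_sub; first exact: smallest_sigma_algebra.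
move=> _ [t [i [B [mB ->]]]]; apply: sub_sigma_algebra.
exists 0, t, i, B; split=> //.
by apply/seteqP; split=> w /=; rewrite wpath0 mxE subr0.
Qed.

End paths.
Definition mfun_of d1 d2 (T1 : measurableType d1) (T2 : measurableType d2)
  (f : T1 -> T2) (mf : measurable_fun setT f) : {mfun T1 >-> T2} :=
  HB.pack f (isMeasurableFun.Build _ _ _ _ f mf).

(** * Shift invariance and independence of Wiener increments *)

Section wiener.
Context {R : realType} {d : nat}.
Variable P0 : probability (wborel R d) R.
Hypothesis hP0 : wiener_measure P0.

Lemma wshift_measurable t :
  measurable_fun setT (wshift t : wborel R d -> wborel R d).
Proof.
apply: (@measurability _ _ (wborel R d) (wborel R d) setT (wshift t)
  (@wcylinders R d)) => //.
move=> _ [_ [u [i [B [mB ->]]]] <-]; rewrite setTI.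
have := measurable_funB (@wborel_eval R d (t + u) i) (@wborel_eval R d t i).
move=> /(_ measurableT B mB); rewrite setTI; congr (measurable _).
by apply/seteqP; split=> w /=; rewrite !mxE.
Qed.

Lemma wiener_grid tau B : sorted <%R tau -> (forall m k, measurable (B m k)) ->
  P0 (grid_event tau B) = (\prod_(m < (size tau).-1) \prod_(k < d)
    normal_prob 0 (Num.sqrt (nth 0%R tau m.+1 - nth 0%R tau m)) (B m k))%E.
Proof.
move=> st mB; apply: (hP0 (tau := nth 0 tau)) => // m mt.
apply: (sortedP 0 st); by case: (size tau) mt.
Qed.

(** The preimage of a grid event is the event of the translated grid, whose steps, and hence
    Gaussian variances, are the same. *)
Lemma wiener_shift t A : @measurable _ (wborel R d) A ->
  P0 (wshift t @^-1` A) = P0 A.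
Proof.
move=> mA; pose X := mfun_of (wshift_measurable t).
rewrite -[LHS]/(distribution P0 X A).
apply: (@incr_measure_eq R d setT 0 (distribution P0 X) P0) => //.
- exact: grid_events_wborel.
- by apply: (@le_lt_trans _ _ 1%E); [exact: probability_le1|exact: ltry].
- move=> tau B st _ _ mB; rewrite -[LHS]/(P0 (wshift t @^-1` grid_event tau B)).
  have -> : wshift t @^-1` grid_event tau B = grid_event (map (+%R t) tau) B.
    apply/seteqP; split=> w /= h m; rewrite ?size_map => mt k.
      have /= := h m mt k; rewrite !mxE opprB addrA subrK.
      rewrite !(nth_map 0); last 2 first.
      + by apply: ltnW; rewrite -ltn_predRL.
      + by rewrite -ltn_predRL.
      by [].
    have /= := h m; rewrite size_map => /(_ mt k).
    rewrite !(nth_map 0); last 2 first.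
    + by apply: ltnW; rewrite -ltn_predRL.
    + by rewrite -ltn_predRL.
    by rewrite !mxE opprB addrA subrK.
  rewrite wiener_grid//; last first.
    by rewrite sorted_map; apply: sub_sorted st => x y /=; rewrite ltrD2l.
  rewrite size_map; apply: etrans (esym (wiener_grid st mB)); apply: eq_bigr => m _; apply: eq_bigr => k _.
  have mt := ltn_ord m.
  rewrite !(nth_map 0); last 2 first.
  + by apply: ltnW; rewrite -ltn_predRL.
  + by rewrite -ltn_predRL.
  by rewrite opprD addrACA subrr add0r.
- exact: wborel_incr.
Qed.

Lemma sorted_last_max (tau : seq R) r : sorted <%R tau -> r \in tau ->
  (forall x, x \in tau -> x <= r) -> exists s, tau = rcons s r.
Proof.
case/lastP: tau => // s x; rewrite -cats1 sorted_cat_cons => /andP[+ _] rs rx.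
have xr : x <= r by apply: rx; rewrite mem_cat inE eqxx orbT.
rewrite sorted_pairwise; last exact: lt_trans.
rewrite pairwise_rcons => /andP[/allP sx _].
exists s; rewrite cats1; move: rs; rewrite mem_cat inE => /orP[/sx|/eqP-> //].
by rewrite ltNge xr.
Qed.

Lemma sorted_head_min (tau : seq R) r : sorted <%R tau -> r \in tau ->
  (forall x, x \in tau -> r <= x) -> exists s, tau = r :: s.
Proof.
case: tau => // x s /= st rs rx.
have xr : r <= x by apply: rx; rewrite inE eqxx.
have /allP sx := order_path_min lt_trans st.
exists s; move: rs; rewrite inE => /orP[/eqP-> //|/sx].
by rewrite ltNge xr.
Qed.

(** The two grids share exactly the point [r], so they concatenate into one sorted grid, and the
    product formula of [wiener_measure] splits at the position of [r]. *)
Lemma grid_indep (r : R) (tau1 tau2 : seq R) B1 B2 :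
  sorted <%R tau1 -> r \in tau1 -> (forall x, x \in tau1 -> x <= r) ->
  sorted <%R tau2 -> r \in tau2 -> (forall x, x \in tau2 -> r <= x) ->
  (forall m k, measurable (B1 m k)) -> (forall m k, measurable (B2 m k)) ->
  P0 (grid_event tau1 B1 `&` grid_event tau2 B2) =
  (P0 (grid_event tau1 B1) * P0 (grid_event tau2 B2))%E.
Proof.
move=> st1 r1 l1 st2 r2 l2 mB1 mB2.
have [s1 E1] := sorted_last_max st1 r1 l1.
have [s2 E2] := sorted_head_min st2 r2 l2.
subst tau1 tau2; clear r1 l1 r2 l2.
pose n1 := size s1; pose n2 := size s2.
pose B m := if (m < n1)%N then B1 m else B2 (m - n1)%N.
have nth1 m : (m <= n1)%N -> nth 0 (s1 ++ r :: s2) m = nth 0 (rcons s1 r) m.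
  rewrite leq_eqVlt => /orP[/eqP ->|mn1].
    by rewrite nth_cat ltnn subnn nth_rcons ltnn eqxx.
  by rewrite nth_cat mn1 nth_rcons mn1.
have nth2 j : nth 0 (s1 ++ r :: s2) (n1 + j) = nth 0 (r :: s2) j.
  by rewrite nth_cat -ltn_subRL subnn ltn0 addKn.
have -> : grid_event (rcons s1 r) B1 `&` grid_event (r :: s2) B2 =
    grid_event (s1 ++ r :: s2) B.
  apply/seteqP; split=> [w [h1 h2] m|w h].
    rewrite size_cat/= addnS/= => mn k; rewrite /B; case: ltnP => mn1.
      rewrite !nth1 ?(ltnW mn1)//; apply: h1.
      by rewrite size_rcons.
    move: mn; rewrite -(subnKC mn1); move: (m - n1)%N => j.
    by rewrite ltn_add2l addKn -addnS !nth2 => js; exact: h2.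
  split=> m mn k; have := h m.
    rewrite size_cat/= addnS/=; rewrite size_rcons/= in mn.
    move=> /(_ (ltn_addr _ mn) k); rewrite /B mn.
    by rewrite !nth1 ?(ltnW mn).
  move=> _; have := h (n1 + m)%N; rewrite size_cat/= addnS/= ltn_add2l.
  by move=> /(_ mn k); rewrite /B ltnNge leq_addr/= addKn -addnS !nth2.
rewrite wiener_grid//; last 2 first.
- move: st1 st2; rewrite sorted_cat_cons => -> /=.
  by rewrite /= => ->.
- by move=> m k; rewrite /B; case: ifP.
rewrite (wiener_grid st1 mB1) (wiener_grid st2 mB2) size_cat size_rcons/= addnS/= -/n1 -/n2 big_split_ord/=.
apply: (f_equal2 mule); apply: eq_bigr => m _; apply: eq_bigr => k _.
  have mn := ltn_ord m.
  by rewrite /B mn !nth1 ?(ltnW mn).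
by rewrite /B ltnNge leq_addr/= addKn -addnS !nth2.
Qed.

Lemma incr_indep (I J : set R) (r : R) A B :
  I r -> J r -> (forall x, I x -> x <= r) -> (forall x, J x -> r <= x) ->
  <<s incr_events I >> A -> <<s incr_events J >> B ->
  P0 (A `&` B) = (P0 A * P0 B)%E.
Proof.
move=> Ir Jr Il Jl IA JB.
have mJB := incr_events_wborel JB.
have mulP (C D : set (wborel R d)) : measurable C ->
    mscale (NngNum (fine_ge0 (measure_ge0 P0 C))) P0 D = (P0 C * P0 D)%E.
  by move=> mC; rewrite /mscale/= fineK// fin_num_measure.
have fA C D : @measurable _ (wborel R d) C -> measurable D ->
    (P0 C * P0 D < +oo)%E.
  by move=> mC mD; rewrite -(fineK (fin_num_measure P0 _ mC))
    -(fineK (fin_num_measure P0 _ mD)) -EFinM ltry.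
(* Uniqueness of measures is applied twice: here a grid event of the past is fixed and the future
   event varies, then the future event [B] is fixed and the past one varies. Each time [P0]
   restricted to the fixed event is compared with [P0] scaled by its probability. *)
have step tau1 B1 : sorted <%R tau1 -> r \in tau1 ->
    (forall x, x \in tau1 -> I x) -> (forall m k, measurable (B1 m k)) ->
    P0 (grid_event tau1 B1 `&` B) = (P0 (grid_event tau1 B1) * P0 B)%E.
  move=> st1 r1 I1 mB1.
  have mG : @measurable _ (wborel R d) (grid_event tau1 B1).
    by apply: (@grid_events_wborel _ _ tau1); apply: sub_sigma_algebra; exists B1.
  rewrite setIC -[LHS]/(mrestr P0 mG B) -(mulP _ _ mG).
  apply: (@incr_measure_eq R d J r) JB => //.
  - exact: grid_events_wborel.
  - apply: etrans _ (esym (mulP _ _ mG)).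
    rewrite -[LHS]/(P0 (setT `&` grid_event tau1 B1)) setTI.
    by rewrite [P0 [set: _]]probability_setT mule1.
  - rewrite -[X in (X < _)%E]/(P0 (setT `&` grid_event tau1 B1)) setTI.
    by rewrite ltey_eq fin_num_measure.
  - move=> tau2 B2 st2 r2 J2 mB2; apply: etrans _ (esym (mulP _ _ mG)).
    rewrite -[LHS]/(P0 (grid_event tau2 B2 `&` grid_event tau1 B1)) setIC.
    by apply: (@grid_indep r) => // x; [move=> /I1/Il|move=> /J2/Jl].
rewrite -[LHS]/(mrestr P0 mJB A) muleC -(mulP _ _ mJB).
apply: (@incr_measure_eq R d I r) IA => //.
- exact: grid_events_wborel.
- apply: etrans _ (esym (mulP _ _ mJB)).
  by rewrite -[LHS]/(P0 (setT `&` B)) setTI [P0 [set: _]]probability_setT mule1.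
- rewrite -[X in (X < _)%E]/(P0 (setT `&` B)) setTI.
  by rewrite ltey_eq fin_num_measure.
- move=> tau1 B1 st1 r1 I1 mB1; apply: etrans _ (esym (mulP _ _ mJB)).
  rewrite -[LHS]/(P0 (grid_event tau1 B1 `&` B)) muleC; exact: step.
Qed.

End wiener.

(** * Expectations under equality in law and under independence *)

Section expectation_laws.
Local Open Scope ereal_scope.
Context {dT : measure_display} {R : realType} {T : measurableType dT}.
Variable P : probability T R.

Lemma ge0_integral_eq_law (X Y : T -> \bar R) :
  measurable_fun setT X -> measurable_fun setT Y ->
  (forall w, 0 <= X w) -> (forall w, 0 <= Y w) ->
  (forall A, measurable A -> P (X @^-1` A) = P (Y @^-1` A)) ->
  \int[P]_w X w = \int[P]_w Y w.
Proof.
move=> mX mY X0 Y0 XY.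
(* The change of variables wants an integrand that is nonnegative on the whole target space; the
   absolute value provides one without altering [Z]. *)
have E (Z : T -> \bar R) (mZ : measurable_fun setT Z) : (forall w, 0 <= Z w) ->
    \int[P]_w Z w = \int[distribution P (mfun_of mZ)]_y `|y|.
  move=> Z0; rewrite ge0_integral_distribution//.
  by apply: eq_integral => w _ /=; rewrite gee0_abs.
rewrite (E _ mX X0) (E _ mY Y0).
by apply: eq_measure_integral => A mA _; exact: XY.
Qed.

(** Independence identifies the joint law with the product of the marginal laws, by uniqueness of
    the product measure; Tonelli then factors the integral. *)
Lemma ge0_integral_indep (X Y : T -> \bar R) :
  measurable_fun setT X -> measurable_fun setT Y ->
  (forall w, 0 <= X w) -> (forall w, 0 <= Y w) ->
  (forall A B, measurable A -> measurable B ->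
     P (X @^-1` A `&` Y @^-1` B) = P (X @^-1` A) * P (Y @^-1` B)) ->
  \int[P]_w (X w * Y w) = \int[P]_w X w * \int[P]_w Y w.
Proof.
move=> mX mY X0 Y0 XY.
have mXY : measurable_fun setT (fun w => (X w, Y w)) by exact: measurable_fun_pair.
pose f := (fun p : \bar R * \bar R => `|p.1| * `|p.2|).
have mf : measurable_fun setT f.
  by apply: emeasurable_funM; apply: measurableT_comp.
have f0 p : 0 <= f p by rewrite mule_ge0.
have E (Z : T -> \bar R) (mZ : measurable_fun setT Z) : (forall w, 0 <= Z w) ->
    \int[P]_w Z w = \int[distribution P (mfun_of mZ)]_y `|y|.
  move=> Z0; rewrite ge0_integral_distribution//.
  by apply: eq_integral => w _ /=; rewrite gee0_abs.
transitivity (\int[distribution P (mfun_of mXY)]_p f p).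
  rewrite ge0_integral_distribution//.
  by apply: eq_integral => w _; rewrite /f/= !gee0_abs.
pose dX := distribution P (mfun_of mX); pose dY := distribution P (mfun_of mY).
transitivity (\int[dX \x dY]_p f p).
  apply: eq_measure_integral => A mA _; apply/esym.
  by apply: product_measure_unique => // B C mB mC; exact: XY.
rewrite fubini_tonelli1// /fubini_F/= (E _ mX X0) (E _ mY Y0) -/dX -/dY.
rewrite -ge0_integralZr//; last by apply: integral_ge0.
by apply: eq_integral => x _; rewrite /f/= ge0_integralZl//.
Qed.

End expectation_laws.

(** * Transfer of both properties to the completed space *)

Section completed.
Context {R : realType} {d : nat}.
Variable P0 : probability (wborel R d) R.
Hypothesis hP0 : wiener_measure P0.
Local Notation P := (wprob P0).
Local Notation Om_ := (wspace P0).

Lemma wprob_borel (A : set (wborel R d)) : measurable A -> P A = P0 A.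
Proof. by move=> mA; exact: measurable_mu_extE. Qed.

Lemma borel_wspace : @measurable _ (wborel R d) `<=` @measurable _ Om_.
Proof. by move=> A mA; apply: sub_caratheodory; exact: sub_sigma_algebra. Qed.

Lemma negligible_wspace : P.-negligible `<=` @measurable _ Om_.
Proof. exact: measure_is_complete_caratheodory. Qed.

Lemma negligible_wprob A : P.-negligible A -> P A = 0%E.
Proof. by move=> nA; apply: measure_negligible => //; exact: negligible_wspace. Qed.

(** [wprob] is an outer measure defined on every set, and a set of outer measure zero satisfies the
    Caratheodory criterion. *)
Lemma wprob0_negligible A : P A = 0%E -> P.-negligible A.
Proof.
move=> A0; exists A; split=> //.
apply: le_caratheodory_measurable => X.
have XA : ((P0^*)%mu (X `&` A) <= 0)%E.
  by rewrite -A0; apply: le_outer_measure; exact: subIsetr.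
have XnA : ((P0^*)%mu (X `&` ~` A) <= (P0^*)%mu X)%E.
  by apply: le_outer_measure; exact: subIsetl.
by apply: le_trans (leeD XA XnA) _; rewrite add0e.
Qed.

(** The sets may be arbitrary, since monotonicity and subadditivity of the outer measure suffice. *)
Lemma negligible_eq_wprob A B : P.-negligible (A `\` B) -> P.-negligible (B `\` A) ->
  P A = P B.
Proof.
suff H C D : P.-negligible (C `\` D) -> (P C <= P D)%E.
  by move=> /H AB /H BA; apply/eqP; rewrite eq_le AB BA.
move=> /negligible_wprob CD0.
have : (P C <= P (D `|` (C `\` D)))%E.
  by apply: le_outer_measure => w Cw; have [Dw|nDw] := pselect (D w); [left|right].
move=> /le_trans; apply; apply: (le_trans (outer_measureU2 _ _ _)).
by rewrite [X in (_ + X)%E]CD0 adde0.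
Qed.

(** The outer measure is an infimum over countable Borel covers, and shifting a cover of [A] gives a
    cover of the preimage with the same total mass. *)
Lemma negligible_wshift t A : P.-negligible A -> P.-negligible (wshift t @^-1` A).
Proof.
move=> /negligible_wprob A0; apply: wprob0_negligible.
apply/eqP; rewrite eq_le measure_ge0 andbT -[in leRHS]A0.
apply/le_ereal_inf_tmp => _ [F [mF AF] <-].
apply: ereal_inf_lbound; exists (fun k => wshift t @^-1` F k).
  split=> [k|w /AF[k _ Fk]]; last by exists k.
  have := @wshift_measurable R d t measurableT _ (mF k).
  by rewrite setTI.
by apply: eq_eseriesr => k _; exact: wiener_shift.
Qed.

(** The sets that agree with an increment event up to a null set form a sigma-algebra containing
    both kinds of generators. This reduces statements on the completed filtration to Borel increment
    events. *)
Lemma Fgen_approx s t A : <<s Fgen P0 s t >> A ->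
  exists B, [/\ <<s incr_events `[s, t]%classic >> B,
    P.-negligible (A `\` B) & P.-negligible (B `\` A)].
Proof.
pose S := <<s @incr_events R d `[s, t]%classic >>.
have SI : sigma_algebra setT S by exact: smallest_sigma_algebra.
move: A; apply: smallest_sub.
  split=> /=.
  - by exists set0; rewrite setDv; split; [case: SI|exact: negligible_set0..].
  - move=> A [B [SB AB BA]]; exists (setT `\` B); split.
    + by case: SI => _ + _; exact.
    + by apply: negligibleS BA => w [[_ /= nA]] /not_andP[//|/contrapT].
    + by apply: negligibleS AB => w [[_ /= nA]] /not_andP[//|/contrapT].
  - move=> F /choice[G FG]; exists (\bigcup_k G k); split.
    + by case: SI => _ _; apply => k; have [] := FG k.
    + have : P.-negligible (\bigcup_k (F k `\` G k)).
        by apply: negligible_bigcup => k; have [] := FG k.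
      apply: negligibleS => w [[k _ Fk] nG]; exists k => //; split=> // Gk.
      by apply: nG; exists k.
    + have : P.-negligible (\bigcup_k (G k `\` F k)).
        by apply: negligible_bigcup => k; have [] := FG k.
      apply: negligibleS => w [[k _ Fk] nG]; exists k => //; split=> // Gk.
      by apply: nG; exists k.
move=> A [[v [u [i [B [sv vu ut mB ->]]]]]|nA].
  exists [set w : wpath R d | B (w u i 0 - w v i 0)]; rewrite setDv.
  split; [|exact: negligible_set0..].
  apply: sub_sigma_algebra; exists v, u, i, B; split=> //=; rewrite in_itv/=.
    by rewrite sv (le_trans vu).
  by rewrite ut (le_trans sv).
exists set0; rewrite setD0 set0D; split=> //; last exact: negligible_set0.
by case: SI.
Qed.

Lemma Fgen_wspace s t : <<s Fgen P0 s t >> `<=` @measurable _ Om_.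
Proof.
apply: smallest_sub; first exact: sigma_algebra_measurable.
move=> A [[v [u [i [B [sv vu ut mB ->]]]]]|/negligible_wspace //].
apply: borel_wspace.
have := measurable_funB (@wborel_eval R d u i) (@wborel_eval R d v i).
by move=> /(_ measurableT B mB); rewrite setTI.
Qed.

Lemma Fgen_indep s r t A B : s <= r -> r <= t ->
  <<s Fgen P0 s r >> A -> <<s Fgen P0 r t >> B -> P (A `&` B) = (P A * P B)%E.
Proof.
move=> sr rt /Fgen_approx[A' [mA' AA' A'A]] /Fgen_approx[B' [mB' BB' B'B]].
rewrite (negligible_eq_wprob AA' A'A) (negligible_eq_wprob BB' B'B).
have -> : P (A `&` B) = P (A' `&` B').
  apply: negligible_eq_wprob.
    apply: negligibleS (negligibleU AA' BB') => w [[Aw Bw]] /not_andP[]; by [left|right].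
  apply: negligibleS (negligibleU A'A B'B) => w [[Aw Bw]] /not_andP[]; by [left|right].
have mA := incr_events_wborel mA'; have mB := incr_events_wborel mB'.
rewrite !wprob_borel//; last exact: measurableI.
apply: (@incr_indep _ _ _ hP0 `[s, r]%classic `[r, t]%classic r) => //=.
- by rewrite in_itv/= sr lexx.
- by rewrite in_itv/= rt lexx.
- by move=> x; rewrite in_itv/= => /andP[].
- by move=> x; rewrite in_itv/= => /andP[].
Qed.

Lemma Fgen_wshift s t r A : <<s Fgen P0 s t >> A ->
  <<s Fgen P0 (r + s) (r + t) >> (wshift r @^-1` A).
Proof.
pose S := <<s Fgen P0 (r + s) (r + t) >>.
have SI : sigma_algebra setT S by exact: smallest_sigma_algebra.
move: A; apply: smallest_sub.
  split=> /=.
  - by rewrite preimage_set0; case: SI.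
  - by move=> A SA; rewrite setTD preimage_setC -setTD; case: SI => _ + _; exact.
  - by move=> F SF; rewrite preimage_bigcup; case: SI => _ _; exact.
move=> A [[v [u [i [B [sv vu ut mB ->]]]]]|nA]; apply: sub_sigma_algebra; last first.
  by right; exact: negligible_wshift.
left; exists (r + v), (r + u), i, B; rewrite !lerD2l; split=> //.
apply/seteqP; split=> w /=; rewrite !mxE; congr (B _); ring.
Qed.

Lemma wprob_wshift s t r A : <<s Fgen P0 s t >> A -> P (wshift r @^-1` A) = P A.
Proof.
move=> /Fgen_approx[B [/incr_events_wborel mB AB BA]].
rewrite (negligible_eq_wprob AB BA).
have AB' := negligible_wshift r AB; have BA' := negligible_wshift r BA.
rewrite (negligible_eq_wprob AB' BA') !wprob_borel//; first exact: wiener_shift.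
have := @wshift_measurable R d r measurableT _ mB.
by rewrite setTI.
Qed.

End completed.

(** * Matrix norms and joint measurability *)

Section matrix_norms.
Context {R : realType}.

Lemma mx_entry_norm_le m n (x : 'M[R]_(m, n)) i j : `|x i j| <= `|x|.
Proof.
rewrite [leRHS]/Num.norm/= mx_normrE.
by apply/bigmax_geP; right; exists (i, j).
Qed.

Lemma mx_norm_leP m n (x : 'M[R]_(m, n)) (c : R) : 0 <= c ->
  (forall i j, `|x i j| <= c) -> `|x| <= c.
Proof.
move=> c0 xc; rewrite [leLHS]/Num.norm/= mx_normrE.
by apply/bigmax_leP; split=> // -[i j] _; exact: xc.
Qed.

(** The entrywise maximum norm is submultiplicative only up to the inner dimension. *)
Lemma mx_norm_mul_le m n p (A : 'M[R]_(m, n)) (B : 'M[R]_(n, p)) :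
  `|A *m B| <= n%:R * `|A| * `|B|.
Proof.
apply: mx_norm_leP => [|i j]; first by rewrite !mulr_ge0.
rewrite mxE; apply: le_trans (ler_norm_sum _ _ _) _.
rewrite -mulrA -[n in n%:R]card_ord mulr_natl -sumr_const.
by apply: ler_sum => k _; rewrite normrM ler_pM// mx_entry_norm_le.
Qed.

Lemma mx_cvgP m n (x : nat -> 'M[R]_(m, n)) (l : 'M[R]_(m, n)) :
  (forall i j, (fun k => x k i j) @ \oo --> l i j) -> x @ \oo --> l.
Proof.
move=> xl; apply/cvgrPdist_le => e e0.
have : \forall k \near \oo, forall p : 'I_m * 'I_n, `|l p.1 p.2 - x k p.1 p.2| <= e.
  apply: filter_forall => -[i j] /=.
  by have /cvgrPdist_le := xl i j; apply.
apply: filterS => k lx; apply: mx_norm_leP => [|i j]; first exact: ltW.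
by rewrite !mxE; exact: (lx (i, j)).
Qed.

End matrix_norms.

Section measurability.
Context {dT : measure_display} {R : realType} {T : measurableType dT}.
Implicit Types D : set T.

Lemma measurable_fun_inv D (f : T -> R) :
  measurable_fun D f -> measurable_fun D (fun w => (f w)^-1).
Proof.
move=> mf.
(* A real power of the nonnegative square [f ^ 2] is measurable; the factor [f] restores the sign,
   and both sides are 0 at the zeros of [f]. *)
have -> : (fun w => (f w)^-1) = (fun w => f w * (((f w) ^+ 2) `^ (-1))).
  apply/funext => w; rewrite powR_inv1 ?sqr_ge0//.
  have [->|f0] := eqVneq (f w) 0; first by rewrite invr0 mul0r.
  by rewrite expr2 invfM mulrA divff// mul1r.
apply: measurable_funM => //.
apply: (@measurableT_comp _ _ _ _ _ _ (fun x : R => x `^ (-1)) _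
  (fun w => f w ^+ 2)); first exact: measurable_powR.
exact: measurable_funX.
Qed.

Lemma measurable_fun_det D n (M : T -> 'M[R]_n) :
  (forall i j, measurable_fun D (fun w => M w i j)) ->
  measurable_fun D (fun w => \det (M w)).
Proof.
move=> mM; apply: measurable_sum => s; apply: measurable_funM => //.
by apply: measurable_prod => i _; exact: mM.
Qed.

Lemma measurable_fun_invmx D n (M : T -> 'M[R]_n) :
  (forall w, M w \in unitmx) ->
  (forall i j, measurable_fun D (fun w => M w i j)) ->
  forall i j, measurable_fun D (fun w => invmx (M w) i j).
Proof.
move=> uM mM i j.
have -> : (fun w => invmx (M w) i j) =
    (fun w => (\det (M w))^-1 * ((-1) ^+ (j + i) * \det (row' j (col' i (M w))))).
  by apply/funext => w; rewrite /invmx uM !mxE.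
apply: measurable_funM; first exact/measurable_fun_inv/measurable_fun_det.
apply: measurable_funM => //; apply: measurable_fun_det => a b.
by under eq_fun do rewrite !mxE; exact: mM.
Qed.

Lemma measurable_fun_mulmx D m n p (M : T -> 'M[R]_(m, n)) (N : T -> 'M[R]_(n, p)) :
  (forall i j, measurable_fun D (fun w => M w i j)) ->
  (forall i j, measurable_fun D (fun w => N w i j)) ->
  forall i j, measurable_fun D (fun w => (M w *m N w) i j).
Proof.
move=> mM mN i j; under eq_fun do rewrite mxE.
by apply: measurable_sum => k; exact: measurable_funM.
Qed.

Lemma measurable_fun_mx_norm D m n (M : T -> 'M[R]_(m, n)) :
  (forall i j, measurable_fun D (fun w => M w i j)) ->
  measurable_fun D (fun w => `|M w|).
Proof.
move=> mM.
have -> : (fun w => `|M w|) = (fun w => \big[Num.max/0]_ij `|M w ij.1 ij.2|).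
  by apply/funext => w; rewrite [LHS]/Num.norm/= mx_normrE.
elim: (index_enum _) => [|ij s IH].
  by under eq_fun do rewrite big_nil; exact: measurable_cst.
under eq_fun do rewrite big_cons.
apply: measurable_maxr => //; exact: measurableT_comp.
Qed.

Lemma measurable_fun_countable_param D (C : countType) (Z : T -> C)
    (F : C -> T -> R) :
  (forall c, measurable (D `&` Z @^-1` [set c])) ->
  (forall c, measurable_fun D (F c)) -> measurable_fun D (fun w => F (Z w) w).
Proof.
move=> mZ mF mD B mB.
have -> : D `&` (fun w => F (Z w) w) @^-1` B =
    \bigcup_c ((D `&` Z @^-1` [set c]) `&` (D `&` F c @^-1` B)).
  apply/seteqP; split=> [w [Dw Bw]|w [c _ [[Dw <-] [_ Bw]]]] //.
  by exists (Z w).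
apply: countable_bigcupT_measurable => [|c]; first exact: countableP.
by apply: measurableI => //; exact: mF.
Qed.

End measurability.

Section grid_floor.
Context {R : realType}.

Definition grid_floor (n : nat) (x : R) : R :=
  (Num.floor (x * n.+1%:R))%:~R / n.+1%:R.

Lemma grid_floor_dist n x : `|x - grid_floor n x| <= n.+1%:R^-1.
Proof.
have n0 : 0 < n.+1%:R :> R by rewrite ltr0n.
rewrite -(ler_pM2r n0) -[X in _ * X <= _](ger0_norm (ltW n0)) -normrM mulrBl /grid_floor.
rewrite !divfK ?gt_eqF// mulVf ?gt_eqF//.
have /andP[l u] := floor_itv (x * n.+1%:R).
by rewrite ger0_norm ?subr_ge0// lerBlDl (le_trans (ltW u))// intrD.
Qed.

Lemma grid_floor_ge0 n x : 0 <= x -> 0 <= grid_floor n x.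
Proof.
move=> x0; rewrite divr_ge0// ler0z floor_ge_int.
by rewrite mulr_ge0.
Qed.

Lemma grid_floor_cvg x : (fun n => grid_floor n x) @ \oo --> x.
Proof.
apply/cvgrPdist_le => e e0; near=> n.
apply: (le_trans (grid_floor_dist n x)).
near: n; have /cvgrPdist_le/(_ e e0) := @cvg_harmonic R.
by apply: filterS => n; rewrite sub0r normrN ger0_norm// invr_ge0.
Unshelve. all: by end_near. Qed.

Lemma measurable_floor_fiber {dT} {T : measurableType dT} (D : set T) (f : T -> R)
    n (z : int) : measurable D -> measurable_fun D f ->
  measurable (D `&` [set w | Num.floor (f w * n.+1%:R) = z]).
Proof.
move=> mD mf.
have -> : [set w | Num.floor (f w * n.+1%:R) = z] =
   (fun w => f w * n.+1%:R) @^-1` `[z%:~R, (z + 1)%:~R[%classic.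
  by apply/seteqP; split=> w /=; rewrite in_itv/= -floor_eq => /eqP.
by apply: measurable_funM.
Qed.

End grid_floor.

(* Discretising the continuous variable turns the function into a countable
   patchwork of measurable ones. *)
Lemma measurable_fun_caratheodory {dT} {R : realType} {T : measurableType dT}
    (f : R -> T -> R) :
  (forall w, continuous (f^~ w)) -> (forall r, measurable_fun setT (f r)) ->
  measurable_fun setT (fun p : measurableTypeR R * T => f p.1 p.2).
Proof.
move=> cf mf.
apply: (@measurable_fun_cvg _ _ _ _
  (fun n (p : measurableTypeR R * T) => f (grid_floor n p.1) p.2)).
  move=> n; pose F (c : int) (p : measurableTypeR R * T) := f (c%:~R / n.+1%:R) p.2.
  apply: (@measurable_fun_countable_param _ _ _ _ int
    (fun p : measurableTypeR R * T => Num.floor ((p.1 : R) * n.+1%:R)) F) => c.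
    exact: (@measurable_floor_fiber R _ (measurableTypeR R * T)%type setT
      (fun p => p.1) n c measurableT measurable_fst).
  exact: (measurableT_comp (mf (c%:~R / n.+1%:R)) (measurable_snd)).
move=> -[r w] _ /=; apply: (cvg_comp (fun n => grid_floor n r) (f^~ w)); last exact: cf.
exact: grid_floor_cvg.
Qed.

(** [g] is continuous relative to the orthant only and arbitrary elsewhere. Rounding the arguments
    down gives countably many values, converges, and never leaves the orthant. *)
Lemma measurable_fun_comp_orthant {dT} {R : realType} {T : measurableType dT}
    d (D : set T) (g : R -> 'cV[R]_d -> R) (r : T -> R) (Y : T -> 'cV[R]_d) :
  {within [set p : R * 'cV[R]_d | orthant p.2],
     continuous (fun p : R * 'cV[R]_d => g p.1 p.2)} ->
  measurable_fun D r -> (forall i, measurable_fun D (fun w => Y w i 0)) ->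
  (forall w, D w -> orthant (Y w)) -> measurable_fun D (fun w => g (r w) (Y w)).
Proof.
move=> /subspace_continuousP cg mr mY oY mD.
apply: (@measurable_fun_cvg _ _ _ D
  (fun n w => g (grid_floor n (r w)) (\col_i grid_floor n (Y w i 0)))) mD.
  move=> n mD.
  pose Z w := (Num.floor (r w * n.+1%:R), \col_(i < d) Num.floor (Y w i 0 * n.+1%:R)).
  pose F (c : int * 'cV[int]_d) (w : T) :=
    g (c.1%:~R / n.+1%:R) (\col_i ((c.2 i 0)%:~R / n.+1%:R)).
  have -> : (fun w => g (grid_floor n (r w)) (\col_i grid_floor n (Y w i 0))) =
      (fun w => F (Z w) w).
    apply/funext => w; rewrite /F/=; congr (g _ _).
    by apply/matrixP => i j; rewrite !mxE.
  apply: measurable_fun_countable_param (mD) => [[z v]|c]; last exact: measurable_cst.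
  have -> : D `&` Z @^-1` [set (z, v)] =
      (D `&` [set w | Num.floor (r w * n.+1%:R) = z]) `&`
      \bigcap_(i in [set: 'I_d])
        (D `&` [set w | Num.floor (Y w i 0 * n.+1%:R) = v i 0]).
    apply/seteqP; split=> [w [Dw [<- <-]]|w [[Dw wz] wv]].
      by split=> // i _; split=> //=; rewrite mxE.
    split=> //; congr (_, _) => //.
    by apply/matrixP => i j; rewrite ord1 mxE; have [] := wv i Logic.I.
  apply: measurableI; first exact: (measurable_floor_fiber _ _ mD mr).
  case: d Y g cg mY oY Z F v => [|d] Y g cg mY oY Z F v.
    rewrite (_ : \bigcap_(i in _) _ = setT)//.
    by apply/seteqP; split=> // w _ [m //].
  apply: fin_bigcap_measurable => [|i _]; first exact: finite_finset.
  exact: (measurable_floor_fiber _ _ mD (mY i)).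
move=> w Dw /=.
have gcvg := cg (r w, Y w) (oY w Dw).
have ncvg : (fun n => (grid_floor n (r w), \col_i grid_floor n (Y w i 0))) @ \oo -->
    (r w, Y w).
  have Yc : (fun n => \col_i grid_floor n (Y w i 0)) @ \oo --> Y w.
    apply: mx_cvgP => i j; rewrite ord1; under eq_fun do rewrite mxE.
    exact: grid_floor_cvg.
  move=> P [[A B] /= [nA nB] AB].
  have FA := @grid_floor_cvg R (r w) A nA; have FB := Yc B nB.
  rewrite /nbhs/= in FA FB *.
  by apply: filterS (filterI FA FB) => n [An Bn]; exact: (AB (_, _)).
apply: (cvg_comp (fun n => (grid_floor n (r w), \col_i grid_floor n (Y w i 0)))
  (fun p : R * 'cV[R]_d => g p.1 p.2) _ gcvg).
move=> P nP; have H : \forall n \near \oo,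
    orthant (\col_i grid_floor n (Y w i 0)) ->
    P (grid_floor n (r w), \col_i grid_floor n (Y w i 0)) := ncvg _ nP.
rewrite /nbhs/=; apply: filterS H => n; apply=> i.
by rewrite /= mxE grid_floor_ge0//; exact: oY.
Qed.

(** * Lebesgue integrals: translations and exponential weights *)

Section lebesgue_integrals.
Context {R : realType}.
Local Notation mu := (@lebesgue_measure R).

Lemma lebesgue_measure_shift (c : R) (A : set R) : measurable A ->
  mu ((fun x => x + c) @^-1` A) = mu A.
Proof.
move=> mA; have mf : measurable_fun setT
    ((fun x => x + c) : measurableTypeR R -> measurableTypeR R).
  exact: measurable_funD.
pose X := mfun_of mf.
rewrite -[LHS]/(pushforward mu X A); apply/esym.
apply: lebesgue_measure_unique => //= _ [[a b]] _ <-.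
rewrite -[RHS]/(mu ((fun x => x + c) @^-1` `]a, b]%classic)).
have -> : (fun x => x + c) @^-1` `]a, b]%classic = `]a - c, b - c]%classic.
  by apply/seteqP; split=> x /=; rewrite !in_itv/= ltrBlDr lerBrDr.
by rewrite !lebesgue_measure_itv/= !lte_fin ltrD2r -!EFinB opprB addrA subrK.
Qed.

Lemma lebesgue_measure_reflect (c : R) (A : set R) : measurable A ->
  mu ((fun x => c - x) @^-1` A) = mu A.
Proof.
move=> mA; have mf : measurable_fun setT
    ((fun x => c - x) : measurableTypeR R -> measurableTypeR R).
  exact: measurable_funB.
pose X := mfun_of mf.
rewrite -[LHS]/(pushforward mu X A); apply/esym.
apply: lebesgue_measure_unique => //= _ [[a b]] _ <-.
rewrite -[RHS]/(mu ((fun x => c - x) @^-1` `]a, b]%classic)).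
have -> : (fun x => c - x) @^-1` `]a, b]%classic = `[c - b, c - a[%classic.
  by apply/seteqP; split=> x /=; rewrite !in_itv/= => /andP[? ?]; apply/andP; split; lra.
rewrite !lebesgue_measure_itv/= !lte_fin ltrD2l ltrN2 -!EFinB.
by have -> : c - a - (c - b) = b - a by ring.
Qed.

Lemma ge0_integral_shift (c : R) (D : set R) (f : R -> \bar R) :
  measurable D -> measurable_fun D f -> (forall x, D x -> (0 <= f x)%E) ->
  (\int[mu]_(x in (fun x => (x + c)%R) @^-1` D) f (x + c)%R = \int[mu]_(x in D) f x)%E.
Proof.
move=> mD mf f0; have mX : measurable_fun setT
    ((fun x => x + c) : measurableTypeR R -> measurableTypeR R).
  exact: measurable_funD.
rewrite -(@ge0_integral_pushforward _ _ _ (measurableTypeR R) _ _ mX mu D f)//.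
  by apply: eq_measure_integral => A mA _; exact: lebesgue_measure_shift.
by move=> x /set_mem; exact: f0.
Qed.

Lemma Rintegral_shift (c : R) (D : set R) (f : R -> R) :
  measurable D -> measurable_fun D f ->
  \int[mu]_(x in (fun x => x + c) @^-1` D) f (x + c) = \int[mu]_(x in D) f x.
Proof.
move=> mD mf; rewrite /Rintegral; congr fine.
rewrite integralE [RHS]integralE.
have mEf : measurable_fun D (EFin \o f) by exact/measurable_EFinP.
congr (_ - _)%E.
  rewrite -[RHS](ge0_integral_shift c mD (measurable_funepos mEf))//.
  by apply: eq_integral => x _; rewrite !funeposE.
rewrite -[RHS](ge0_integral_shift c mD (measurable_funeneg mEf))//.
by apply: eq_integral => x _; rewrite !funenegE.
Qed.

(** After reflection at [t] this is the total mass of the exponential law of rate [b], divided by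
    [b]. *)
Lemma integral_expR_Ny (b t : R) : 0 < b ->
  (\int[mu]_(r in `]-oo, t]) (expR (- (b * (t - r))))%:E = b^-1%:E)%E.
Proof.
move=> b0; have mX : measurable_fun setT
    ((fun x => t - x) : measurableTypeR R -> measurableTypeR R).
  exact: measurable_funB.
pose f x : \bar R := (expR (- (b * x)))%:E.
have mf D : measurable_fun D f.
  apply/measurable_EFinP; apply: measurable_funTS.
  apply: continuous_measurable_fun => x.
  apply: continuous_comp; last exact: continuous_expR.
  by apply: cvgN; apply: cvgM; [exact: cvg_cst|exact: cvg_id].
have -> : `]-oo, t]%classic = (fun x => t - x) @^-1` `[0, +oo[%classic.
  by apply/seteqP; split=> x /=; rewrite !in_itv/= andbT subr_ge0.
rewrite -[LHS]/(\int[mu]_(r in (fun x => (t - x)%R) @^-1` `[0%R, +oo[%classic)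
  (f \o (fun x => (t - x)%R)) r)%E.
rewrite -(@ge0_integral_pushforward _ _ _ (measurableTypeR R) _ _ mX mu)//; last 2 first.
- exact: mf.
- by move=> x _; rewrite lee_fin expR_ge0.
transitivity (\int[mu]_(x in `[0%R, +oo[) f x)%E.
  by apply: eq_measure_integral => A mA _; exact: lebesgue_measure_reflect.
have E : (\int[mu]_(x in `[0%R, +oo[) (b * expR (- b * x))%:E = 1)%E.
  rewrite -(integral_exponential_pdf b0) integral_mkcond.
  by apply: eq_integral => x _; rewrite /exponential_pdf /patch; case: ifP.
have : (b%:E * \int[mu]_(x in `[0%R, +oo[) f x = 1)%E.
  rewrite -ge0_integralZl//; last 3 first.
  - exact: mf.
  - by move=> x _; rewrite lee_fin expR_ge0.
  - by rewrite lee_fin ltW.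
  by rewrite -E; apply: eq_integral => x _; rewrite /f/= EFinM mulNr.
move=> H; rewrite -[RHS]mule1 -H muleA -EFinM mulVf ?gt_eqF//.
by rewrite mul1e.
Qed.

(** No integrability is required: if the integral of the absolute value of [f] is infinite, so is
    the right-hand side. *)
Lemma Rintegral_norm_le d (T : measurableType d) (m : {measure set T -> \bar R})
    (D : set T) (f : T -> R) (g : T -> \bar R) :
  measurable D -> measurable_fun D f -> measurable_fun D g ->
  (forall x, D x -> (`|f x|%:E <= g x)%E) ->
  ((`|\int[m]_(x in D) f x|)%:E <= \int[m]_(x in D) g x)%E.
Proof.
move=> mD mf mg fg.
have mEf : measurable_fun D (EFin \o f) by exact/measurable_EFinP.
apply: (@le_trans _ _ (\int[m]_(x in D) `|f x|%:E)%E); last first.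
  apply: ge0_le_integral => //.
  exact/measurable_EFinP/measurableT_comp.
have [foo|] := ltP (\int[m]_(x in D) `|f x|%:E)%E +oo%E; last first.
  by rewrite leye_eq => /eqP ->; rewrite leey.
have intf : m.-integrable D (EFin \o f) by apply/integrableP.
rewrite (le_trans _ (le_abse_integral m mD mEf))//.
rewrite /Rintegral -{2}(fineK (integrable_fin_num mD intf)) abse_EFin.
by [].
Qed.

Lemma exp_bounded_integrable (D : set R) (f : R -> R) (b c t : R) :
  0 < b -> measurable D -> D `<=` `]-oo, t]%classic -> measurable_fun D f ->
  (forall r, D r -> `|f r| <= c * expR (- (b * (t - r)))) ->
  mu.-integrable D (EFin \o f).
Proof.
move=> b0 mD Dt mf fb.
have mg (E : set R) : measurable_fun E (fun r : R => c * expR (- (b * (t - r)))).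
  apply: measurable_funTS; apply: continuous_measurable_fun => x.
  apply: cvgM; first exact: cvg_cst.
  apply: continuous_comp; last exact: continuous_expR.
  apply: cvgN; apply: cvgM; first exact: cvg_cst.
  by apply: cvgB; [exact: cvg_cst|exact: cvg_id].
have mg1 (E : set R) : measurable_fun E (fun r : R => expR (- (b * (t - r)))).
  apply: measurable_funTS; apply: continuous_measurable_fun => x.
  apply: continuous_comp; last exact: continuous_expR.
  apply: cvgN; apply: cvgM; first exact: cvg_cst.
  by apply: cvgB; [exact: cvg_cst|exact: cvg_id].
apply: (@le_integrable _ _ _ mu D mD _
    (EFin \o (fun r => c * expR (- (b * (t - r)))))).
- exact/measurable_EFinP.
- move=> r Dr /=; rewrite lee_fin (le_trans (fb r Dr))//.
  exact: ler_norm.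
apply: (@integrableS _ _ _ mu `]-oo, t]%classic) => //.
apply/integrableP; split; first by apply/measurable_EFinP; exact: mg.
have -> : (\int[mu]_(x in `]-oo, t]) `|(EFin \o (fun r : R => c * expR (- (b * (t - r)))))%R x|
    = (`|c| * b^-1)%R%:E)%E; last exact: ltry.
rewrite EFinM -(integral_expR_Ny t b0) -ge0_integralZl//; last first.
  by apply/measurable_EFinP; exact: mg1.
by apply: eq_integral => x _; rewrite /= normrM (ger0_norm (expR_ge0 _)).
Qed.

End lebesgue_integrals.

(** * Boundedness and Lipschitz continuity of the nonlinearity *)

Section nonlinearity_bounds.
Context {R : realType} {d : nat}.
Variable h : R -> 'cV[R]_d -> 'cV[R]_d.
Hypothesis hC : Cb1_map h.

Lemma le_hbound t x : orthant x -> lev (h t x) (hbound h).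
Proof.
move=> ox i; rewrite !mxE subr_ge0; have [_ hb _ _] := hC.
have [_ [C hCb]] := hb i.
rewrite (le_trans (ler_norm _))//; apply: ub_le_sup; last by exists (t, x).
by exists C => _ [[s y] oy <-]; exact: hCb.
Qed.

Lemma hlip_ge0 : 0 <= hlip h.
Proof. by rewrite /hlip; apply: bigmax_ge_id. Qed.

Lemma hpartial_le i j t x : orthant x -> `|hpartial h i j t x| <= hlip h.
Proof.
move=> ox; have [_ _ _ hb] := hC.
have [_ [_ [C hCb]]] := hb i j.
apply: le_trans (le_bigmax _ _ i) => /=; apply: le_trans (le_bigmax _ _ j) => /=.
apply: ub_le_sup; last by exists (t, x).
by exists C => _ [[s y] oy <-]; exact: hCb.
Qed.

Lemma orthant_addr (x : 'cV[R]_d) (j : 'I_d) c :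
  orthant x -> 0 <= x j 0 + c -> orthant (x + c *: delta_mx j 0).
Proof.
move=> ox xc i; rewrite !mxE eqxx andbT.
by case: eqVneq => [->|_]; rewrite ?mulr1// mulr0 addr0.
Qed.

Lemma Cb1_lip_coord i j t x c : orthant x -> 0 <= c ->
  `|h t (x + c *: delta_mx j 0) i 0 - h t x i 0| <= hlip h * c.
Proof.
move=> ox c0; have [_ hb _ hd] := hC.
pose g s := h t (x + s *: delta_mx j 0) i 0.
have os s : 0 <= s -> orthant (x + s *: delta_mx j 0).
  by move=> s0; apply: orthant_addr => //; rewrite addr_ge0.
have shift_cvg (z : R) : (fun s : R => x + s *: delta_mx j 0) @ z -->
    x + z *: (delta_mx j 0 : 'cV[R]_d).
  by apply: cvgD; [exact: cvg_cst|apply: cvgZr_tmp; exact: cvg_id].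
have gc : {within `[0, c], continuous g}.
  apply/subspace_continuousP => s; rewrite /= in_itv/= => /andP[s0 sc].
  have [/subspace_continuousP hc _] := hb i.
  apply: (cvg_comp (fun s : R => (t, x + s *: delta_mx j 0))
     (fun p : R * 'cV[R]_d => h p.1 p.2 i 0) _ (hc (t, x + s *: delta_mx j 0) (os _ s0))).
  move=> P [[A B] /= [nA nB] AB].
  have H : \forall z \near s, B (x + z *: delta_mx j 0) := shift_cvg s B nB.
  suff : \forall z \near s, `[0, c]%classic z ->
    orthant (x + z *: delta_mx j 0) -> P (t, x + z *: delta_mx j 0).
    by apply: filterS => z Pz zc; apply: Pz => //; apply: os; move: zc;
      rewrite /= in_itv/= => /andP[].
  apply: filterS H => z Bz; rewrite /= in_itv/= => /andP[z0 _] oz.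
  apply: (AB (t, x + z *: delta_mx j 0)); last exact: os.
  by split=> //=; exact: nbhs_singleton.
have gd s : s \in `]0, c[ -> is_derive s 1 g (hpartial h i j t (x + s *: delta_mx j 0)).
  rewrite in_itv/= => /andP[s0 sc].
  pose z := x + s *: delta_mx j 0.
  have [+ _] := hd i j => /(_ t z (os _ (ltW s0))) hcv.
  have zj : 0 < z j 0 by rewrite !mxE !eqxx mulr1 ltr_wpDl.
  (* At an interior point of the segment the [j]-th coordinate is positive, so small steps of either
     sign stay in the orthant and the limit along [dfilter] is the ordinary two-sided derivative. *)
  have qc : dquot h i j t z @ 0^' --> hpartial h i j t z.
    apply: cvg_trans hcv; apply: cvg_app => S nS.
    have near0 : \forall s \near (0 : R)^', orthant (z + s *: delta_mx j 0).
      have H : \forall r \near (0 : R)^', `|r| < z j 0 by exact: dnbhs0_lt.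
      apply: filterS H => r rz.
      apply: orthant_addr; first exact: (os _ (ltW s0)).
      by move: rz; rewrite ltr_norml => /andP[+ _]; rewrite ltrNl -subr_gt0 opprK addrC => /ltW.
    by apply: filterS2 near0 nS => r orr; apply.
  have E : (fun r => r^-1 *: ((g \o shift s) (r *: 1) - g s)) = dquot h i j t z.
    apply/funext => r; rewrite /dquot /g /z/= [LHS]mulrC [r%:A]mulr1.
    by congr ((h t _ i 0 - _) / _); rewrite -addrA -scalerDl [s + r]addrC.
  have gcv : (fun r => r^-1 *: ((g \o shift s) (r *: 1) - g s)) @ 0^' -->
      hpartial h i j t z by rewrite E.
  by apply: DeriveDef; [exact: cvgP gcv|exact: cvg_lim gcv].
have [e ec ge] := MVT_segment c0 gd gc.
have -> : h t x i 0 = g 0 by rewrite /g scale0r addr0.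
rewrite -/(g c) ge subr0 normrM (ger0_norm c0) ler_wpM2r// hpartial_le//.
by apply: os; move: ec; rewrite in_itv/= => /andP[].
Qed.

Lemma Cb1_lip t x y : orthant x -> orthant y ->
  `|h t x - h t y| <= hlip h * d%:R * `|x - y|.
Proof.
move=> ox oy; apply: mx_norm_leP => [|i j]; first by rewrite !mulr_ge0// hlip_ge0.
rewrite ord1 {j} !mxE.
(* The coordinates of [y] are replaced by those of [x] one at a time; all the intermediate points
   stay in the orthant. *)
pose z k : 'cV[R]_d := \col_j (if (j < k)%N then x j 0 else y j 0).
have oz k : orthant (z k) by move=> j; rewrite mxE; case: ifP.
have z0 : z 0%N = y by apply/matrixP => a b; rewrite mxE ord1.
have zd : z d = x by apply/matrixP => a b; rewrite mxE ord1 ltn_ord.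
have step k : (k < d)%N -> `|h t (z k.+1) i 0 - h t (z k) i 0| <= hlip h * `|x - y|.
  move=> kd; pose j := Ordinal kd.
  have xyj : `|x j 0 - y j 0| <= `|x - y|.
    by have := mx_entry_norm_le (x - y) j 0; rewrite !mxE.
  apply: (@le_trans _ _ (hlip h * `|x j 0 - y j 0|)); last first.
    by rewrite ler_wpM2l// hlip_ge0.
  have zE (a b : R) (u v : 'cV[R]_d) : (forall l, l != j -> u l 0 = v l 0) ->
      u j 0 = a -> v j 0 = b -> u = v + (a - b) *: delta_mx j 0.
    move=> uv ua vb; apply/matrixP => l q; rewrite ord1 !mxE eqxx andbT.
    case: eqVneq => [->|lj]; first by rewrite ua vb mulr1 addrC subrK.
    by rewrite uv// mulr0 addr0.
  have zz l : l != j -> z k.+1 l 0 = z k l 0.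
    move=> lj; rewrite !mxE ltnS leq_eqVlt.
    by have -> : (l == k :> nat) = false 
      by apply: contra_neqF lj => /eqP lk; exact: val_inj.
  have zx : z k.+1 j 0 = x j 0 by rewrite mxE /= ltnSn.
  have zy : z k j 0 = y j 0 by rewrite mxE /= ltnn.
  (* [Cb1_lip_coord] moves upwards only, so the step starts from whichever of the two points has the
     smaller [j]-th coordinate. *)
  have [yx|/ltW xy] := leP (y j 0) (x j 0).
    rewrite (zE _ _ _ _ zz zx zy) [`|x j 0 - _|]ger0_norm ?subr_ge0//.
    by apply: Cb1_lip_coord => //; rewrite subr_ge0.
  rewrite distrC (zE _ _ (z k) (z k.+1) _ zy zx); last by move=> l /zz.
  rewrite [`|x j 0 - _|]distrC [`|y j 0 - _|]ger0_norm ?subr_ge0//.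
  by apply: Cb1_lip_coord => //; rewrite subr_ge0.
have -> : h t x i 0 - h t y i 0 = \sum_(0 <= k < d) (h t (z k.+1) i 0 - h t (z k) i 0).
  by rewrite (telescope_sumr (fun k => h t (z k) i 0))// zd z0.
rewrite (le_trans (ler_norm_sum _ _ _))// big_mkord.
rewrite mulrAC -[d in d%:R]card_ord mulr_natr -sumr_const.
by apply: ler_sum => k _; exact: step.
Qed.

End nonlinearity_bounds.

(** * Variation of constants *)

(** What the deterministic analysis uses of [Phi (t - r) (wshift r w)] for one fixed path.
    Measurability is required in the final time only; invertibility transfers it to the initial
    time. *)
Record stable_kernel {R : realType} {d : nat} (Psi : R -> R -> 'M[R]_d) (lam : R) :
    Prop := StableKernel {
  stable_rate : 0 < lam;
  stable_comp : forall t r s, s <= r -> r <= t -> Psi t s = Psi t r *m Psi r s;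
  stable_unit : forall t s, s <= t -> Psi t s \in unitmx;
  stable_measurable : forall (s : R) i j,
    measurable_fun `[s, +oo[%classic (fun t => Psi t s i j);
  stable_tempered : forall gam : R, 0 < gam -> exists2 C : R, 0 <= C &
    forall t r, r <= t ->
      `|Psi t r| <= C * expR (gam * `|r|) * expR (- (lam * (t - r)))
}.

Section kernel_integrals.
Context {R : realType} {d : nat}.
Local Notation mu := (@lebesgue_measure R).

Lemma vintegral_mulmx (D : set R) (M : 'M[R]_d) (f : R -> 'cV[R]_d) :
  measurable D -> (forall i, mu.-integrable D (EFin \o (fun r => f r i 0))) ->
  vintegral D (fun r => M *m f r) = M *m vintegral D f.
Proof.
move=> mD intf; apply/matrixP => i j; rewrite !mxE.
under eq_Rintegral do rewrite mxE.
under [RHS]eq_bigr do rewrite mxE -RintegralZl//.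
have intM k : mu.-integrable D (EFin \o (fun r => M i k * f r k 0)).
  exact: (@integrableZl _ _ _ mu D mD (M i k) _ (intf k)).
suff H s : mu.-integrable D (EFin \o (fun r => \sum_(k <- s) M i k * f r k 0)) /\
    \int[mu]_(r in D) (\sum_(k <- s) M i k * f r k 0) =
    \sum_(k <- s) \int[mu]_(r in D) (M i k * f r k 0) by have [] := H (index_enum _).
elim: s => [|k s [IH1 IH2]].
  rewrite big_nil; split; last by under eq_Rintegral do rewrite big_nil; rewrite Rintegral_cst// mul0r.
  rewrite (_ : _ \o _ = cst 0%E); first exact: integrable0.
  by apply/funext => r /=; rewrite big_nil.
split.
  rewrite (_ : _ \o _ = (EFin \o (fun r => M i k * f r k 0)) \+
     (EFin \o (fun r => \sum_(k <- s) M i k * f r k 0))); first exact: integrableD.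
  by apply/funext => r /=; rewrite big_cons.
by rewrite big_cons -IH2 -RintegralD//; apply: eq_Rintegral => r _; rewrite big_cons.
Qed.

Lemma vintegralB (D : set R) (f g : R -> 'cV[R]_d) : measurable D ->
  (forall i, mu.-integrable D (EFin \o (fun r => f r i 0))) ->
  (forall i, mu.-integrable D (EFin \o (fun r => g r i 0))) ->
  vintegral D f - vintegral D g = vintegral D (fun r => f r - g r).
Proof.
move=> mD intf intg; apply/matrixP => i j; rewrite !mxE -RintegralB//.
by apply: eq_Rintegral => r _; rewrite !mxE.
Qed.

Lemma vintegral_norm_le (D : set R) (f : R -> 'cV[R]_d) (g : R -> \bar R) :
  measurable D -> (forall i, measurable_fun D (fun r => f r i 0)) ->
  measurable_fun D g -> (forall r, D r -> (`|f r|%:E <= g r)%E) ->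
  (`|vintegral D f|%:E <= \int[mu]_(r in D) g r)%E.
Proof.
move=> mD mf mg fg.
have I0 : (0 <= \int[mu]_(r in D) g r)%E.
  by apply: integral_ge0 => r Dr; apply: le_trans (fg r Dr); rewrite lee_fin.
case Eg : (\int[mu]_(r in D) g r)%E I0 => [c| |] // c0; last by rewrite leey.
rewrite lee_fin in c0; rewrite lee_fin; apply: mx_norm_leP => // i j.
rewrite ord1 mxE -lee_fin -Eg; apply: (@Rintegral_norm_le R _ (measurableTypeR R) mu D _ g mD (mf i) mg) => r Dr.
by apply: le_trans (fg r Dr); rewrite lee_fin mx_entry_norm_le.
Qed.

Variables (Psi : R -> R -> 'M[R]_d) (lam : R).
Hypothesis kPsi : stable_kernel Psi lam.
Let lam0 := stable_rate kPsi.
Let PsiD := stable_comp kPsi.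
Let Psi_unit := stable_unit kPsi.
Let mPsi_left := stable_measurable kPsi.
Let Psi_tempered := stable_tempered kPsi.

Lemma Psi_invE t r s : s <= r -> r <= t -> Psi t r = Psi t s *m invmx (Psi r s).
Proof. by move=> sr rt; rewrite (PsiD sr rt) mulmxK// Psi_unit. Qed.

(** From any origin [s] below [r], the kernel is [Psi t s] times the inverse of [Psi r s], and the
    latter is measurable in its final time [r]. The origins [t - n] exhaust the half-line. *)
Lemma mPsi_right (t : R) i j : measurable_fun `]-oo, t]%classic (fun r => Psi t r i j).
Proof.
have step (s : R) : measurable_fun `[s, t]%classic (fun r => Psi t r i j).
  (* The maximum keeps the matrix invertible for every [r], as [measurable_fun_invmx] demands. *)
  have mM a b : measurable_fun `[s, t]%classic (fun r => Psi (Num.max s r) s a b).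
    have : measurable_fun `[s, t]%classic (fun r => Psi r s a b).
      by apply: (measurable_funS _ _ (@mPsi_left s a b)) => //; apply: subset_itvl.
    apply: eq_measurable_fun => r; rewrite inE/= in_itv/= => /andP[sr _].
    by rewrite max_r.
  have uM r : Psi (Num.max s r) s \in unitmx by apply: Psi_unit; rewrite le_max lexx.
  have := @measurable_fun_mulmx _ _ _ `[s, t]%classic d d d (fun=> Psi t s)
    (fun r => invmx (Psi (Num.max s r) s)) (fun a b => measurable_cst _)
    (measurable_fun_invmx uM mM) i j.
  apply: eq_measurable_fun => r; rewrite inE/= in_itv/= => /andP[sr rt].
  by rewrite max_r// -Psi_invE.
have -> : `]-oo, t]%classic = \bigcup_n `[t - n%:R, t]%classic.
  apply/seteqP; split=> [r|r [n _]] /=; rewrite !in_itv/=; last by case/andP.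
  move=> rt; exists (Num.truncn (t - r)).+1 => //=; rewrite in_itv/= rt andbT.
  by rewrite lerBlDr -lerBlDl ltW// truncnS_gt.
by apply/measurable_fun_bigcup.
Qed.

(** The subexponential factor is moved from the initial to the final time by [|r| <= |t| + (t - r)],
    at the price [gam] in the decay rate; the bound then integrates over [r]. *)
Lemma Psi_exp_bound (gam : R) : 0 < gam -> exists2 C : R, 0 <= C &
  forall t r, r <= t ->
    `|Psi t r| <= C * expR (gam * `|t|) * expR (- ((lam - gam) * (t - r))).
Proof.
move=> g0; have [C C0 PC] := Psi_tempered g0; exists C => // t r rt.
apply: le_trans (PC t r rt) _; rewrite -!mulrA ler_wpM2l// -!expRD ler_expR.
have : `|r| <= `|t| + (t - r).
  by rewrite -[r in leLHS](subKr t) (le_trans (ler_normB _ _))// [`|t - r|]ger0_norm ?subr_ge0.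
by move=> /(ler_wpM2l (ltW g0)) H; nra.
Qed.

Lemma integrable_Psi (D : set R) (t : R) (v : R -> 'cV[R]_d) N : measurable D ->
  D `<=` `]-oo, t]%classic -> (forall i, measurable_fun D (fun r => v r i 0)) ->
  (forall r, D r -> `|v r| <= N) ->
  forall i, mu.-integrable D (EFin \o (fun r => (Psi t r *m v r) i 0)).
Proof.
move=> mD Dt mv vN i.
have l2 : 0 < lam / 2 by rewrite divr_gt0.
have [C C0 PC] := Psi_exp_bound l2.
apply: (@exp_bounded_integrable _ _ _ (lam / 2) (d%:R * (C * expR (lam / 2 * `|t|)) * N) t) => //.
  apply: measurable_fun_mulmx => // a b; last by rewrite ord1.
  exact: (measurable_funS (measurable_itv _) Dt (@mPsi_right t a b)).
move=> r Dr; have rt : r <= t by have := Dt r Dr; rewrite /= in_itv.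
apply: le_trans (mx_entry_norm_le _ _ _) _.
apply: le_trans (mx_norm_mul_le _ _) _.
have := PC t r rt; have -> : lam - lam / 2 = lam / 2 by lra.
move=> Pr; set e := expR (- _) in Pr *; set E := expR _ in Pr *.
rewrite [X in _ <= X](_ : _ = d%:R * (C * E * e) * N); last by ring.
by rewrite ler_pM ?vN// ?mulr_ge0// ler_wpM2l.
Qed.

Lemma vintegral_Psi_le (gam : R) : 0 < gam -> gam < lam -> exists2 C : R, 0 <= C &
  forall (D : set R) (t : R) (v : R -> 'cV[R]_d) (N : R), measurable D ->
  D `<=` `]-oo, t]%classic -> (forall i, measurable_fun D (fun r => v r i 0)) ->
  0 <= N -> (forall r, D r -> `|v r| <= N) ->
  `|vintegral D (fun r => Psi t r *m v r)| <= C * N * expR (gam * `|t|).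
Proof.
move=> g0 gl; have [C C0 PC] := Psi_exp_bound g0.
exists (d%:R * C / (lam - gam)) => [|D t v N mD Dt mv N0 vN].
  by rewrite divr_ge0 ?mulr_ge0// subr_ge0 ltW.
have lg : 0 < lam - gam by rewrite subr_gt0.
pose K := d%:R * C * expR (gam * `|t|) * N.
have K0 : 0 <= K by rewrite !mulr_ge0 ?expR_ge0.
have mexp (E : set R) : measurable_fun E (fun r : R => (expR (- ((lam - gam) * (t - r))))%:E).
  apply/measurable_EFinP; apply: measurable_funTS; apply: continuous_measurable_fun => x.
  apply: continuous_comp; last exact: continuous_expR.
  apply: cvgN; apply: cvgM; first exact: cvg_cst.
  by apply: cvgB; [exact: cvg_cst|exact: cvg_id].
rewrite -lee_fin.
apply: (@le_trans _ _ (\int[mu]_(r in D) (K%:E * (expR (- ((lam - gam) * (t - r))))%:E))%E).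
  apply: vintegral_norm_le => //.
  - move=> i; apply: measurable_fun_mulmx => // a b; last by rewrite ord1.
    exact: (measurable_funS (measurable_itv _) Dt (@mPsi_right t a b)).
  - exact: measurable_funeM.
  - move=> r Dr; have rt : r <= t by have := Dt r Dr; rewrite /= in_itv.
    rewrite -EFinM lee_fin; apply: le_trans (mx_norm_mul_le _ _) _.
    have := PC t r rt; rewrite /K; set e := expR (- _); set E := expR _ => Pr.
    rewrite [X in _ <= X](_ : _ = d%:R * (C * E * e) * N); last by ring.
    by rewrite ler_pM ?vN// ?mulr_ge0// ler_wpM2l.
apply: (@le_trans _ _ (\int[mu]_(r in `]-oo, t]) (K%:E * (expR (- ((lam - gam) * (t - r))))%:E))%E).
  apply: ge0_subset_integral => //; first by apply: measurable_funeM; exact: mexp.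
  by move=> r _; rewrite mule_ge0// lee_fin ?expR_ge0.
rewrite ge0_integralZl//; last exact: mexp.
rewrite integral_expR_Ny// -EFinM lee_fin /K le_eqVlt; apply/orP; left; apply/eqP; ring.
Qed.

(** Splitting the half-line at [s] exhibits the integral as a solution started at [s] from its own
    value there. *)
Lemma vintegral_Psi_split (t s : R) (v : R -> 'cV[R]_d) N : s <= t ->
  (forall i, measurable_fun `]-oo, t]%classic (fun r => v r i 0)) ->
  (forall r, r <= t -> `|v r| <= N) ->
  vintegral `]-oo, t]%classic (fun r => Psi t r *m v r) =
  Psi t s *m vintegral `]-oo, s]%classic (fun r => Psi s r *m v r) +
  vintegral `[s, t]%classic (fun r => Psi t r *m v r).
Proof.
move=> st mv vN.
have sub : `]-oo, s]%classic `<=` `]-oo, t]%classic by apply: subset_itvl; rewrite bnd_simp.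
rewrite -vintegral_mulmx//; last first.
  apply: (@integrable_Psi _ _ _ N) => // [i|r]; first exact: (measurable_funS (measurable_itv _) sub (mv i)).
  by rewrite /= in_itv/= => rs; apply: vN; exact: le_trans rs st.
have intt := @integrable_Psi `]-oo, t]%classic t v N (measurable_itv _) (@subset_refl _ _) mv _.
apply/matrixP => i j; rewrite ord1 !mxE.
apply/eqP; rewrite addrC -subr_eq; apply/eqP.
have inti : mu.-integrable `]-oo, t]%classic (EFin \o (fun r => (Psi t r *m v r) i 0)).
  by apply: intt => r; rewrite /= in_itv/=; exact: vN.
have -> : \int[mu]_(r in `]-oo, s]) (Psi t s *m (Psi s r *m v r)) i 0 =
    \int[mu]_(r in `]-oo, s]) (Psi t r *m v r) i 0.
  apply: eq_Rintegral => r; rewrite inE/= in_itv/= => rs.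
  by rewrite mulmxA -PsiD.
rewrite Rintegral_itvB//.
rewrite Rintegral_itv_obnd_cbnd//.
by apply: integrableS inti => //; apply: subset_itvr.
Qed.

End kernel_integrals.
Record bounded_field {R : realType} {d : nat} (h : R -> 'cV[R]_d -> 'cV[R]_d)
    (N ell : R) : Prop := BoundedField {
  field_orthant : forall t x, orthant x -> orthant (h t x);
  field_bound : forall t x, orthant x -> `|h t x| <= N;
  field_lip : forall t x y, orthant x -> orthant y ->
    `|h t x - h t y| <= ell * `|x - y|;
  field_continuous : forall i, {within [set p : R * 'cV[R]_d | orthant p.2],
     continuous (fun p : R * 'cV[R]_d => h p.1 p.2 i 0)};
  field_bound_ge0 : 0 <= N;
  field_lip_ge0 : 0 <= ell
}.

(** Mild solutions along one path. Being free of probability, the notion covers the flow, its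
    translate by a period, and [Kop Phi v] alike. *)
Definition duhamel {R : realType} {d : nat} (Psi : R -> R -> 'M[R]_d)
    (h : R -> 'cV[R]_d -> 'cV[R]_d) (s : R) (y : R -> 'cV[R]_d) : Prop :=
  [/\ (forall t, s <= t -> orthant (y t)),
      (forall i, measurable_fun `[s, +oo[%classic (fun t => y t i 0)) &
      forall t, s <= t -> y t = Psi t s *m y s
        + vintegral `[s, t]%classic (fun r => Psi t r *m h r (y r))].

(* Picard iterates of the Volterra inequality satisfied by the distance of two
   solutions started at time [s]; [N] bounds the distance of the forcing terms
   and [c] is the Lipschitz factor. *)
Fixpoint volterra {R : realType} (a : R -> R -> \bar R) (c N s : R) (k : nat)
    (t : R) : \bar R :=
  (a t s + \int[lebesgue_measure]_(r in `[s, t])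
     (a t r * (if k is k'.+1 then c%:E * volterra a c N s k' r else N%:E)))%E.

Lemma volterra_ge0 {R : realType} (a : R -> R -> \bar R) (c N s : R) k t :
  (forall t r, 0 <= a t r)%E -> 0 <= c -> 0 <= N -> (0 <= volterra a c N s k t)%E.
Proof.
move=> a0 c0 N0; elim: k t => [|k IH] t /=; apply: adde_ge0 => //;
  apply: integral_ge0 => r _; rewrite mule_ge0//.
by rewrite mule_ge0.
Qed.

Section duhamel.
Context {R : realType} {d : nat}.
Local Notation mu := (@lebesgue_measure R).
Variables (Psi : R -> R -> 'M[R]_d) (lam : R).
Hypothesis kPsi : stable_kernel Psi lam.
Variables (h : R -> 'cV[R]_d -> 'cV[R]_d) (N ell : R).
Hypothesis fh : bounded_field h N ell.
Let N0 := field_bound_ge0 fh.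
Let ell0 := field_lip_ge0 fh.

Lemma duhamel_measurable_field s t y : duhamel Psi h s y ->
  forall i, measurable_fun `[s, t]%classic (fun r => h r (y r) i 0).
Proof.
move=> [oy my _] i.
apply: (measurable_fun_comp_orthant (g := fun r x => h r x i 0) (r := id) (Y := y)) => //.
- exact: field_continuous fh i.
- move=> j; apply: (measurable_funS _ _ (my j)) => //; exact: subset_itvl.
- by move=> r; rewrite /= in_itv/= => /andP[sr _]; exact: oy.
Qed.

Lemma duhamel_integrable s t y : s <= t -> duhamel Psi h s y ->
  forall i, mu.-integrable `[s, t]%classic
    (EFin \o (fun r => (Psi t r *m h r (y r)) i 0)).
Proof.
move=> st dy; apply: (@integrable_Psi _ _ _ _ kPsi _ t _ N) => //.
- by apply: subset_itvr.
- exact: duhamel_measurable_field.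
- move=> r; rewrite /= in_itv/= => /andP[sr _]; apply: field_bound fh _ _ _.
  by have [oy _ _] := dy; exact: oy.
Qed.

Lemma duhamel_dist_le s t y1 y2 (g : R -> \bar R) : s <= t ->
  duhamel Psi h s y1 -> duhamel Psi h s y2 ->
  measurable_fun `[s, t]%classic g ->
  (forall r, s <= r -> r <= t -> (`|h r (y1 r) - h r (y2 r)|%:E <= g r)%E) ->
  (`|y1 t - y2 t|%:E <= (d%:R * `|Psi t s| * `|y1 s - y2 s|)%:E +
     \int[mu]_(r in `[s, t]) ((d%:R * `|Psi t r|)%:E * g r))%E.
Proof.
move=> st d1 d2 mg hg.
have [_ _ E1] := d1; have [_ _ E2] := d2.
have -> : y1 t - y2 t = Psi t s *m (y1 s - y2 s) +
    vintegral `[s, t]%classic (fun r => Psi t r *m (h r (y1 r) - h r (y2 r))).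
  rewrite (E1 t st) (E2 t st) opprD addrACA -mulmxBr; congr (_ + _).
  rewrite vintegralB//; [|exact: duhamel_integrable..].
  by congr (vintegral _ _); apply/funext => r; rewrite mulmxBr.
apply: (@le_trans _ _ (`|Psi t s *m (y1 s - y2 s)|%:E +
  `|vintegral `[s, t]%classic (fun r => Psi t r *m (h r (y1 r) - h r (y2 r)))|%:E)%E).
  by rewrite -EFinD lee_fin ler_normD.
have mP i j : measurable_fun `[s, t]%classic (fun r => Psi t r i j).
  by apply: (measurable_funS _ _ (@mPsi_right _ _ _ _ kPsi t i j)) => //; exact: subset_itvr.
apply: leeD; first by rewrite lee_fin mx_norm_mul_le.
apply: vintegral_norm_le => //.
- move=> i; apply: (measurable_fun_mulmx mP) => a b; rewrite ord1.
  rewrite (_ : (fun r => _) = (fun r => h r (y1 r) a 0 - h r (y2 r) a 0)).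
    by apply: measurable_funB; exact: duhamel_measurable_field.
  by apply/funext => r; rewrite !mxE.
- apply: emeasurable_funM => //; apply/measurable_EFinP; apply: measurable_funM => //.
  exact: measurable_fun_mx_norm.
- move=> r; rewrite /= in_itv/= => /andP[sr rt].
  apply: (@le_trans _ _ ((d%:R * `|Psi t r|)%:E * `|h r (y1 r) - h r (y2 r)|%:E)%E).
    by rewrite -EFinM lee_fin mx_norm_mul_le.
  by apply: lee_wpmul2l; [rewrite lee_fin mulr_ge0|exact: hg].
Qed.

(** The constant depends neither on the starting time nor on the solution. Later it bounds,
    subexponentially in [n], the values reached at time [- n T]. *)
Lemma duhamel_tempered gam : 0 < gam -> gam < lam -> exists2 C : R, 0 <= C &
  forall s t y, s <= t -> duhamel Psi h s y ->
    `|y t| <= d%:R * `|Psi t s| * `|y s| + C * expR (gam * `|t|).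
Proof.
move=> g0 gl; have [C C0 PC] := vintegral_Psi_le kPsi g0 gl.
exists (C * N) => [|s t y st dy]; first exact: mulr_ge0.
have [oy _ ->] // := dy.
apply: (le_trans (ler_normD _ _)); apply: lerD; first exact: mx_norm_mul_le.
apply: PC => //.
- exact: subset_itvr.
- exact: duhamel_measurable_field.
- by move=> r; rewrite /= in_itv/= => /andP[sr _]; apply: field_bound fh _ _ (oy _ sr).
Qed.

(** Gronwall's inequality through an exponentially weighted supremum [S]: it is finite by
    [duhamel_tempered], and for a large weight [b] the integral term is at most half of it and can
    be absorbed. It gives uniqueness for given initial values and continuous dependence on them. *)
Lemma duhamel_gronwall s t : s <= t -> exists2 K : R, 0 <= K &
  forall y1 y2, duhamel Psi h s y1 -> duhamel Psi h s y2 ->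
    `|y1 t - y2 t| <= K * `|y1 s - y2 s|.
Proof.
move=> st; have lam0 := stable_rate kPsi.
have l2 : 0 < lam / 2 by rewrite divr_gt0.
have l2l : lam / 2 < lam by rewrite gtr_pMr// invf_lt1 ?ltr1n.
have [C C0 PC] := Psi_exp_bound kPsi l2.
have [C' C'0 PC'] := duhamel_tempered l2 l2l.
pose E := expR (lam / 2 * (`|s| + `|t|)).
have absst tau : s <= tau -> tau <= t -> expR (lam / 2 * `|tau|) <= E.
  move=> stau taut; rewrite /E ler_expR ler_wpM2l ?(ltW l2)//.
  have := ler_norm t; have := ler_norm (- s); rewrite normrN => sN tN.
  rewrite ler_norml; apply/andP; split.
    have := normr_ge0 t; lra.
  have := normr_ge0 s; lra.
pose al := C * E.
have al0 : 0 <= al by rewrite mulr_ge0// expR_ge0.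
have Pal tau r : s <= r -> r <= tau -> tau <= t -> `|Psi tau r| <= al.
  move=> sr rtau taut; apply: le_trans (PC _ _ rtau) _.
  rewrite -[leRHS]mulr1 ler_pM ?mulr_ge0 ?expR_ge0//.
    by rewrite ler_wpM2l// absst//; exact: le_trans sr rtau.
  by rewrite expR_le1 oppr_le0 mulr_ge0 ?subr_ge0 ?(ltW l2l).
(* Integrating the weight produces [d * al * ell / b], which this choice keeps below 1/2. *)
pose b := d%:R * al * ell *+ 2 + 1.
have dal0 : 0 <= d%:R * al by rewrite mulr_ge0.
have b0 : 0 < b by rewrite ltr_wpDl ?ltr01// mulrn_wge0// mulr_ge0.
exists (expR (b * (t - s)) * (d%:R * al) *+ 2) => [|y1 y2 d1 d2].
  by rewrite mulrn_wge0// mulr_ge0 ?expR_ge0.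
have [or1 m1 _] := d1. have [or2 m2 _] := d2.
pose D tau := `|y1 tau - y2 tau|.
pose A := [set expR (- (b * (tau - s))) * D tau | tau in `[s, t]%classic].
have ubA : has_ubound A.
  exists (d%:R * al * `|y1 s| + C' * E + (d%:R * al * `|y2 s| + C' * E)).
  move=> _ [tau + <-]; rewrite /= in_itv/= => /andP[stau taut].
  apply: (@le_trans _ _ (D tau)).
    apply: ler_piMl; first exact: normr_ge0.
    by rewrite expR_le1 oppr_le0 mulr_ge0 ?subr_ge0 ?(ltW b0).
  apply: (le_trans (ler_normB _ _)).
  have bd y : duhamel Psi h s y -> `|y tau| <= d%:R * al * `|y s| + C' * E.
    move=> dy; apply: le_trans (PC' s tau y stau dy) _.
    by rewrite lerD// ?ler_wpM2l// ?absst// ler_wpM2r// ler_wpM2l// Pal.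
  by apply: lerD; exact: bd.
have inA tau : s <= tau -> tau <= t -> expR (- (b * (tau - s))) * D tau <= sup A.
  move=> stau taut; apply: ub_le_sup => //.
  by exists tau => //=; rewrite in_itv/= stau.
set S := sup A in inA.
have S0 : 0 <= S.
  by apply: le_trans (inA s _ _) => //; rewrite mulr_ge0 ?expR_ge0 ?normr_ge0.
have DS tau : s <= tau -> tau <= t -> D tau <= S * expR (b * (tau - s)).
  move=> stau taut; have := inA _ stau taut.
  by rewrite expRN mulrC ler_pdivrMr ?expR_gt0.
have bound tau : s <= tau -> tau <= t ->
    D tau <= d%:R * al * D s + d%:R * al * ell * S * expR (b * (tau - s)) / b.
  move=> stau taut.
  have mexp (F : set R) : measurable_fun F (fun r : R => expR (- (b * (tau - r)))).
    apply: measurable_funTS; apply: continuous_measurable_fun => x.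
    apply: continuous_comp; last exact: continuous_expR.
    apply: cvgN; apply: cvgM; first exact: cvg_cst.
    by apply: cvgB; [exact: cvg_cst|exact: cvg_id].
  have Erew r : expR (b * (r - s)) = expR (b * (tau - s)) * expR (- (b * (tau - r))).
    by rewrite -expRD; congr expR; ring.
  pose g r : \bar R := (ell * S * expR (b * (r - s)))%:E.
  have mg (F : set R) : measurable_fun F g.
    rewrite (_ : g = EFin \o (fun r => ell * S * expR (b * (tau - s)) * expR (- (b * (tau - r))))).
      by apply/measurable_EFinP; apply: measurable_funM => //; exact: mexp.
    by apply/funext => r; rewrite /g Erew/= !mulrA.
  have := @duhamel_dist_le s tau y1 y2 g stau d1 d2 (mg _).
  have H : forall r, s <= r -> r <= tau -> (`|h r (y1 r) - h r (y2 r)|%:E <= g r)%E.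
    move=> r sr rtau; rewrite lee_fin.
    apply: le_trans (field_lip fh _ (or1 _ sr) (or2 _ sr)) _.
    by rewrite -mulrA ler_wpM2l// DS//; exact: le_trans rtau taut.
  move=> /(_ H) Dle; rewrite -lee_fin; apply: le_trans Dle _.
  rewrite EFinD; apply: leeD; first by rewrite lee_fin ler_wpM2r// ler_wpM2l// Pal.
  pose K := d%:R * al * ell * S * expR (b * (tau - s)).
  have K0 : 0 <= K by rewrite !mulr_ge0// expR_ge0.
  apply: (@le_trans _ _ (\int[mu]_(r in `]-oo, tau]) (K%:E * (expR (- (b * (tau - r))))%:E))%E).
    apply: (@le_trans _ _ (\int[mu]_(r in `[s, tau]) (K%:E * (expR (- (b * (tau - r))))%:E))%E).
      apply: ge0_le_integral => //.
      - by move=> r _; rewrite mule_ge0// lee_fin ?mulr_ge0// ?expR_ge0.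
      - apply: emeasurable_funM; last exact: mg.
        apply/measurable_EFinP; apply: measurable_funM => //.
        apply: measurable_fun_mx_norm => i j.
        by apply: (measurable_funS _ _ (@mPsi_right _ _ _ _ kPsi tau i j)) => //; exact: subset_itvr.
      - by apply: measurable_funeM; apply/measurable_EFinP; exact: mexp.
      - move=> r; rewrite /= in_itv/= => /andP[sr rtau]; rewrite -!EFinM lee_fin Erew.
        rewrite /K [X in X <= _](_ : _ = d%:R * `|Psi tau r| *
           (ell * S * expR (b * (tau - s)) * expR (- (b * (tau - r))))); last by ring.
        rewrite [X in _ <= X](_ : _ = d%:R * al *
           (ell * S * expR (b * (tau - s)) * expR (- (b * (tau - r))))); last by ring.
        by rewrite ler_wpM2r ?mulr_ge0 ?expR_ge0// ler_wpM2l// Pal.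
    apply: ge0_subset_integral => //.
    - by apply: measurable_funeM; apply/measurable_EFinP; exact: mexp.
    - by move=> r _; rewrite mule_ge0// lee_fin ?expR_ge0.
    - exact: subset_itvr.
  rewrite ge0_integralZl//; last by apply/measurable_EFinP; exact: mexp.
  by rewrite integral_expR_Ny// -EFinM lee_fin.
have SD : S <= (d%:R * al * D s) *+ 2.
  suff : S <= d%:R * al * D s + S / 2 by move=> H; rewrite mulr2n; lra.
  apply: ge_sup; first by exists (expR (- (b * (s - s))) * D s); exists s => //=; rewrite in_itv/= lexx.
  move=> _ [tau + <-]; rewrite /= in_itv/= => /andP[stau taut].
  rewrite expRN mulrC ler_pdivrMr ?expR_gt0//.
  apply: le_trans (bound _ stau taut) _; rewrite [X in _ <= X]mulrDl; apply: lerD.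
    apply: ler_peMr; first by rewrite mulr_ge0 ?normr_ge0.
    by rewrite -expR0 ler_expR mulr_ge0 ?subr_ge0 ?(ltW b0).
  rewrite ler_pdivrMr// [X in _ <= X](_ : _ = (b / 2) * (S * expR (b * (tau - s)))); last by ring.
  rewrite -mulrA ler_wpM2r ?mulr_ge0 ?expR_ge0//.
  by rewrite /b mulr2n; lra.
apply: le_trans (DS t st (lexx _)) _.
rewrite [X in _ <= X](_ : _ = (d%:R * al * D s) *+ 2 * expR (b * (t - s))); last by rewrite /D; ring.
by rewrite ler_wpM2r// expR_ge0.
Qed.

End duhamel.

(** * Picard bound for two solutions, potentials, and limits of solutions *)

Section duhamel_limits.
Context {R : realType} {d : nat}.
Local Notation mu := (@lebesgue_measure R).
Variables (Psi : R -> R -> 'M[R]_d) (lam : R).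
Hypothesis kPsi : stable_kernel Psi lam.
Variables (h : R -> 'cV[R]_d -> 'cV[R]_d) (N ell : R).
Hypothesis fh : bounded_field h N ell.
Let N0 := field_bound_ge0 fh.
Let ell0 := field_lip_ge0 fh.
Let a t r : \bar R := (`|Psi t r|)%:E.

Lemma mx_norm_Psi_measurable (s t : R) : measurable_fun `[s, t]%classic (fun r => `|Psi t r|).
Proof.
apply: measurable_fun_mx_norm => i j.
apply: (measurable_funS _ _ (@mPsi_right _ _ _ _ kPsi t i j)) => //.
exact: subset_itvr.
Qed.

Lemma volterra_step s t y1 y2 M (H : R -> \bar R) : s <= t ->
  duhamel Psi h s y1 -> duhamel Psi h s y2 ->
  1 <= M -> `|y1 s - y2 s| <= M -> (forall r, 0 <= H r)%E ->
  measurable_fun `[s, +oo[%classic H ->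
  (forall r, s <= r -> (`|h r (y1 r) - h r (y2 r)|%:E <= M%:E * H r)%E) ->
  (`|y1 t - y2 t|%:E <= (d%:R * M)%:E *
     (a t s + \int[mu]_(r in `[s, t]) (a t r * H r)))%E.
Proof.
move=> st d1 d2 M1 sM H0 mH hH.
have M0 : 0 <= M by apply: le_trans M1.
have mH' : measurable_fun `[s, t]%classic H.
  by apply: (measurable_funS _ _ mH) => //; exact: subset_itvl.
have mMH : measurable_fun `[s, t]%classic (fun r => M%:E * H r)%E.
  exact: measurable_funeM.
apply: le_trans (duhamel_dist_le kPsi fh st d1 d2 mMH (fun r sr _ => hH r sr)) _.
have aH0 r : (0 <= a t r * H r)%E by rewrite mule_ge0// lee_fin.
rewrite ge0_muleDr//; last 2 first.
- by rewrite lee_fin.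
- by apply: integral_ge0 => r _.
apply: leeD.
  rewrite -EFinM lee_fin -!mulrA ler_wpM2l// [M * _]mulrC.
  by rewrite ler_wpM2l.
rewrite le_eqVlt; apply/orP; left; apply/eqP.
rewrite -ge0_integralZl//; last 2 first.
- apply: emeasurable_funM => //; apply/measurable_EFinP.
  exact: mx_norm_Psi_measurable.
- by rewrite lee_fin mulr_ge0.
apply: eq_integral => r _; rewrite /a !EFinM !muleA; congr (_ * _)%E.
by rewrite -!EFinM; congr EFin; ring.
Qed.

(** The initial distance is factored out. The bound [N *+ 2] on the forcing terms does not scale
    with it, hence the maximum with 1. In [ell * d], the [d] is the prefactor of the preceding
    estimate, reinserted by the Lipschitz bound. *)
Lemma volterra_dist s y1 y2 : duhamel Psi h s y1 -> duhamel Psi h s y2 ->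
  (forall k, measurable_fun `[s, +oo[%classic
     (volterra a (ell * d%:R) (N *+ 2) s k)) ->
  forall k t, s <= t -> (`|y1 t - y2 t|%:E <=
    (d%:R * Num.max 1 `|y1 s - y2 s|)%:E * volterra a (ell * d%:R) (N *+ 2) s k t)%E.
Proof.
move=> d1 d2 mV; have [oy1 _ _] := d1; have [oy2 _ _] := d2.
set M := Num.max _ _.
have M1 : 1 <= M by rewrite le_max lexx.
have sM : `|y1 s - y2 s| <= M by rewrite le_max lexx orbT.
have M0 : 0 <= M by apply: le_trans M1.
have c0 : 0 <= ell * d%:R by rewrite mulr_ge0.
have N20 : 0 <= N *+ 2 by rewrite mulrn_wge0.
have a0 t r : (0 <= a t r)%E by rewrite lee_fin.
elim=> [|k IH] t st.
  apply: (volterra_step st d1 d2 M1 sM) => //.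
    move=> r sr; rewrite -EFinM lee_fin.
    apply: (@le_trans _ _ (N *+ 2)); last by rewrite ler_peMl.
    by rewrite (le_trans (ler_normB _ _))// mulr2n lerD// (field_bound fh)//; [exact: oy1|exact: oy2].
apply: (volterra_step st d1 d2 M1 sM) => //.
- by move=> r; rewrite mule_ge0// volterra_ge0.
- exact: measurable_funeM.
move=> r sr; apply: (@le_trans _ _ (ell%:E * `|y1 r - y2 r|%:E)%E).
  by rewrite -EFinM lee_fin (field_lip fh)//; [exact: oy1|exact: oy2].
apply: (le_trans (lee_wpmul2l _ (IH r sr))); first by rewrite lee_fin.
rewrite !muleA le_eqVlt; apply/orP; left; apply/eqP; congr (_ * _)%E.
by rewrite -!EFinM; congr EFin; ring.
Qed.

Definition potential (v : R -> 'cV[R]_d) (t : R) : 'cV[R]_d :=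
  vintegral `]-oo, t]%classic (fun r => Psi t r *m v r).

Hypothesis Psi_ge0 : forall t s i j, s <= t -> 0 <= Psi t s i j.

Lemma potential_orthant v t : (forall r, orthant (v r)) -> orthant (potential v t).
Proof.
move=> ov i; rewrite mxE; apply: Rintegral_ge0 => r; rewrite /= in_itv/= => rt.
by rewrite mxE; apply: sumr_ge0 => j _; rewrite mulr_ge0// ?Psi_ge0// ov.
Qed.

Lemma potential_tempered gam : 0 < gam -> gam < lam -> exists2 C : R, 0 <= C &
  forall (v : R -> 'cV[R]_d) M t, 0 <= M ->
    (forall i, measurable_fun setT (fun r => v r i 0)) ->
    (forall r, `|v r| <= M) -> `|potential v t| <= C * M * expR (gam * `|t|).
Proof.
move=> g0 gl; have [C C0 PC] := vintegral_Psi_le kPsi g0 gl.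
exists C => // v M t M0 mv vM; apply: PC => //.
by move=> i; apply: measurable_funTS; exact: mv.
Qed.

(** The fixed point equation is asked for almost every time only, which is all that Fubini yields on
    a single path; this suffices because it is used under the integral. *)
Lemma potential_duhamel (v : R -> 'cV[R]_d) s :
  (forall i, measurable_fun setT (fun r => v r i 0)) ->
  (forall r, orthant (v r)) -> (forall r, `|v r| <= N) ->
  (forall i, measurable_fun setT (fun r => potential v r i 0)) ->
  {ae mu, forall r, h r (potential v r) = v r} -> duhamel Psi h s (potential v).
Proof.
move=> mv ov vN mp hv; split.
- by move=> t _; exact: potential_orthant.
- by move=> i; apply: measurable_funTS; exact: mp.
move=> t st; rewrite [LHS](@vintegral_Psi_split _ _ _ _ kPsi t s v N st)//; last first.
  by move=> i; apply: measurable_funTS; exact: mv.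
congr (_ + _); apply/matrixP => i j; rewrite !mxE /Rintegral; congr fine.
have mPsi k l : measurable_fun `[s, t]%classic (fun r => Psi t r k l).
  apply: (measurable_funS _ _ (@mPsi_right _ _ _ _ kPsi t k l)) => //.
  exact: subset_itvr.
apply: ae_eq_integral => //.
- apply/measurable_EFinP; apply: (measurable_fun_mulmx mPsi) => k l; rewrite ord1.
  by apply: measurable_funTS; exact: mv.
- apply/measurable_EFinP; apply: (measurable_fun_mulmx mPsi) => k l; rewrite ord1.
  apply: (measurable_fun_comp_orthant (g := fun r x => h r x k 0) (r := id)) => //.
  + exact: field_continuous fh k.
  + by move=> m; apply: measurable_funTS; exact: mp.
  + by move=> r _; exact: potential_orthant.
- have [M [mM M0 HM]] := hv; exists M; split=> // r nr; apply: HM => hr.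
  by apply: nr => _; rewrite hr.
Qed.

Lemma cvg_mx_entry m n (x : nat -> 'M[R]_(m, n)) (l : 'M[R]_(m, n)) i j :
  x @ \oo --> l -> (fun k => x k i j) @ \oo --> l i j.
Proof.
move=> xl; apply: (cvg_comp x (fun M : 'M[R]_(m, n) => M i j) xl).
exact: coord_continuous.
Qed.

(** Starting from 0 removes the initial term; the integral term converges by dominated convergence,
    the exponential bound on the kernel being integrable up to [-oo]. *)
Lemma duhamel_limit (s : nat -> R) (y : nat -> R -> 'cV[R]_d) (X : R -> 'cV[R]_d) :
  (forall n, duhamel Psi h (s n) (y n)) -> (forall n, y n (s n) = 0) ->
  (forall t, \forall n \near \oo, s n <= t) ->
  (forall t, (fun n => y n t) @ \oo --> X t) ->
  (forall t, orthant (X t)) /\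
  forall t, X t = potential (fun r => h r (X r)) t.
Proof.
move=> dy y0 sn yX.
have oX t : orthant (X t).
  move=> i; apply: (cvgr_to_ge (cvg_mx_entry (i := i) (j := 0) (yX t))).
  by apply: filterS (sn t) => n nt; have [oy _ _] := dy n; exact: oy.
split=> // t.
have hX r : (fun n => h r (y n r)) @ \oo --> h r (X r).
  apply/cvgrPdist_le => e e0.
  have e1 : 0 < e / (ell + 1) by rewrite divr_gt0// ltr_wpDl.
  have /cvgrPdist_le/(_ _ e1) yXe := yX r.
  apply: filterS2 (sn r) yXe => n nr yXe.
  have [oy _ _] := dy n.
  apply: le_trans (field_lip fh r (oX r) (oy r nr)) _.
  apply: (@le_trans _ _ ((ell + 1) * `|X r - y n r|)).
    by rewrite ler_wpM2r// lerDl.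
  by rewrite mulrC -ler_pdivlMr// ltr_wpDl.
have mhX k : measurable_fun setT (fun r => h r (X r) k 0).
  apply: (@measurable_fun_cvg _ _ _ _
    (fun n r => ((fun r => h r (y n r) k 0) \_ `[s n, +oo[%classic) r)).
    move=> n; apply/measurable_restrict => //; rewrite setTI.
    have [oy my _] := dy n.
    apply: (measurable_fun_comp_orthant (g := fun r x => h r x k 0) (r := id)) => //.
      exact: field_continuous fh k.
    by move=> r; rewrite /= in_itv/= andbT; exact: oy.
  move=> r _; have := cvg_mx_entry (i := k) (j := 0) (hX r).
  apply: cvg_trans; apply: near_eq_cvg; apply: filterS (sn r) => n nr.
  by rewrite patchE mem_set//= in_itv/= nr.
have l2 : 0 < lam / 2 by rewrite divr_gt0// (stable_rate kPsi).
have l2l : lam - lam / 2 = lam / 2 by lra.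
have [C C0 PC] := Psi_exp_bound kPsi l2; rewrite l2l in PC.
pose B := C * expR (lam / 2 * `|t|).
apply/matrixP => i j; rewrite ord1 mxE.
(* Extension by 0 before [s n] puts all integrals on the same half-line. *)
pose f n r := ((fun r => (Psi t r *m h r (y n r)) i 0) \_ `[s n, t]%classic) r.
pose F r := (Psi t r *m h r (X r)) i 0.
pose g r := d%:R * N * B * expR (- (lam / 2 * (t - r))).
have mg (D : set R) : measurable_fun D g.
  apply: measurable_funTS; apply: continuous_measurable_fun => x.
  apply: cvgM; first exact: cvg_cst.
  apply: continuous_comp; last exact: continuous_expR.
  apply: cvgN; apply: cvgM; first exact: cvg_cst.
  by apply: cvgB; [exact: cvg_cst|exact: cvg_id].
have ig : mu.-integrable `]-oo, t]%classic (EFin \o g).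
  apply: (@exp_bounded_integrable _ _ _ (lam / 2) (d%:R * N * B) t) => //.
  by move=> r _; rewrite ger0_norm// !mulr_ge0 ?expR_ge0.
have fg n r : r <= t -> `|f n r| <= g r.
  move=> rt; rewrite /f patchE; case: ifPn => [|_]; last first.
    by rewrite normr0 !mulr_ge0 ?expR_ge0.
  rewrite inE/= in_itv/= => /andP[sr _]; have [oy _ _] := dy n.
  apply: le_trans (mx_entry_norm_le _ _ _) _; apply: le_trans (mx_norm_mul_le _ _) _.
  rewrite /g [X in _ <= X](_ : _ = d%:R * (B * expR (- (lam / 2 * (t - r)))) * N); last by ring.
  by rewrite ler_pM ?mulr_ge0// ?(field_bound fh _ (oy r sr))// ler_wpM2l// PC.
have mf n : measurable_fun `]-oo, t]%classic (EFin \o f n).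
  apply/measurable_EFinP; apply/measurable_restrict => //.
  rewrite (_ : _ `&` _ = `[s n, t]%classic); last first.
    by apply: setIidr; exact: subset_itvr.
  apply: measurable_fun_mulmx => [k l|k l].
    apply: (measurable_funS _ _ (@mPsi_right _ _ _ _ kPsi t k l)) => //.
    exact: subset_itvr.
  by rewrite ord1; exact: (duhamel_measurable_field fh (dy n)).
have mF : measurable_fun `]-oo, t]%classic (EFin \o F).
  apply/measurable_EFinP; apply: measurable_fun_mulmx => k l.
    exact: (@mPsi_right _ _ _ _ kPsi t k l).
  by rewrite ord1; apply: measurable_funTS; exact: mhX.
have fF r : `]-oo, t]%classic r -> (fun n => f n r) @ \oo --> F r.
  rewrite /= in_itv/= => rt.
  have : (fun n => (Psi t r *m h r (y n r)) i 0) @ \oo --> F r.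
    rewrite /F mxE; under eq_fun do rewrite mxE.
    apply: cvg_big => [|k _]; first exact: add_continuous.
    by apply: cvgM; [exact: cvg_cst|exact: cvg_mx_entry (hX r)].
  apply: cvg_trans; apply: near_eq_cvg; apply: filterS (sn r) => n nr.
  by rewrite /f patchE mem_set//= in_itv/= nr.
have aefF : {ae mu, forall r, `]-oo, t]%classic r ->
    (fun n => (EFin \o f n) r) @ \oo --> (EFin \o F) r}.
  by apply: aeW => r rt; apply: cvg_EFin; [exact: nearW|exact: fF].
have aefg : {ae mu, forall r n, `]-oo, t]%classic r ->
    (`|(EFin \o f n) r| <= (EFin \o g) r)%E}.
  by apply: aeW => r n; rewrite /= in_itv/= lee_fin; exact: fg.
have [iF _ cvgI] := @dominated_convergence _ _ _ mu _ (measurable_itv `]-oo, t])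
  (fun n => EFin \o f n) (EFin \o F) (EFin \o g) mf mF aefF ig aefg.
have cvgR : (fun n => \int[mu]_(r in `]-oo, t]) f n r) @ \oo -->
    \int[mu]_(r in `]-oo, t]) F r.
  by apply: fine_cvg; rewrite fineK// integrable_fin_num.
have yXi := cvg_mx_entry (i := i) (j := 0) (yX t).
suff yF : (fun n => y n t i 0) @ \oo --> \int[mu]_(r in `]-oo, t]) F r.
  by rewrite -(cvg_lim (@Rhausdorff R) yXi) -(cvg_lim (@Rhausdorff R) yF).
apply: cvg_trans cvgR; apply: near_eq_cvg; apply: filterS (sn t) => n nt.
have [_ _ ->] // := dy n; rewrite y0 mulmx0 add0r mxE.
rewrite Rintegral_mkcond [RHS]Rintegral_mkcond; apply: eq_Rintegral => r _.
have sub : r \in `[s n, t]%classic -> r \in `]-oo, t]%classic.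
  by move/set_mem; rewrite /= in_itv/= => /andP[_ rt]; apply/mem_set; rewrite /= in_itv.
rewrite /f /patch; case: (boolP (r \in `]-oo, t]%classic)) => // rt.
by case: ifPn => // /sub; rewrite (negbTE rt).
Qed.

End duhamel_limits.
Lemma cvg_geometric_increments {R : realType} (x : nat -> R) (K z : R) :
  0 <= z -> z < 1 -> (forall n, `|x n.+1 - x n| <= K * z ^+ n) -> cvg (x @ \oo).
Proof.
move=> z0 z1 xK.
have : cvgn [normed series (fun n => x n.+1 - x n)].
  apply: (@series_le_cvg _ _ (geometric K z)) => //.
  - by move=> n /=.
  - by move=> n; apply: le_trans (normr_ge0 _) (xK n).
  - by apply: is_cvg_geometric_series; rewrite ger0_norm.
move=> /normed_cvg sc.
have -> : x = (fun n => x 0%N + series (fun n => x n.+1 - x n) n).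
  apply/funext => n; rewrite /series/= telescope_sumr// addrC subrK.
  by [].
by apply: is_cvgD => //; exact: is_cvg_cst.
Qed.

(** * Convergence of pull-back trajectories along one path *)

Section pullback.
Context {R : realType} {d : nat}.
Variables (Psi : R -> R -> 'M[R]_d) (lam : R).
Hypothesis kPsi : stable_kernel Psi lam.
Variables (h : R -> 'cV[R]_d -> 'cV[R]_d) (N ell : R).
Hypothesis fh : bounded_field h N ell.
Let a t r : \bar R := (`|Psi t r|)%:E.
Hypothesis mV : forall (s : R) k, measurable_fun `[s, +oo[%classic
  (volterra a (ell * d%:R) (N *+ 2) s k).
Variable f : R -> R -> 'cV[R]_d -> 'cV[R]_d.
Hypothesis f_duhamel : forall s x, orthant x -> duhamel Psi h s (fun t => f t s x).
Hypothesis f_id : forall s x, orthant x -> f s s x = x.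
Hypothesis f_flow : forall t r s x, s <= r -> r <= t -> orthant x ->
  f t s x = f t r (f r s x).
Variables (T gam : R).
Hypothesis T0 : 0 < T.
Hypothesis gam0 : 0 < gam.
Hypothesis gam_lam : gam / 2 < lam.
Hypothesis volterra_small : forall m : nat, exists2 C : R, 0 <= C & forall n, (m <= n)%N ->
  (volterra a (ell * d%:R) (N *+ 2) (- (n%:R * T)) n (- (m%:R * T)) <=
    (C * expR (- (gam * (n%:R * T))))%:E)%E.

Lemma orthant0 : orthant (0 : 'cV[R]_d).
Proof. by move=> i; rewrite mxE. Qed.

Let orthant_f t s x : s <= t -> orthant x -> orthant (f t s x).
Proof. by move=> st ox; have [oy _ _] := f_duhamel s ox; exact: oy. Qed.

Let le_time m n : (m <= n)%N -> - (n%:R * T) <= - (m%:R * T).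
Proof. by move=> mn; rewrite lerN2 ler_pM2r// ler_nat. Qed.

Let time_below (t : R) : exists m : nat, - (m%:R * T) <= t.
Proof.
exists (Num.truncn (`|t| / T)).+1; rewrite lerNl.
apply: (@le_trans _ _ `|t|); first by rewrite -normrN ler_norm.
by rewrite -ler_pdivrMr// ltW// truncnS_gt.
Qed.

Let g2 : 0 < gam / 2. Proof. by rewrite divr_gt0. Qed.

(** Half of the rate [gam] pays for initial distances growing like [expR (gam / 2 * (n * T))]; the
    other half is the geometric decay. The iterate used has order [n]. *)
Let close_at m C : 0 <= C -> exists2 K : R, 0 <= K & forall n y1 y2, (m <= n)%N ->
  duhamel Psi h (- (n%:R * T)) y1 -> duhamel Psi h (- (n%:R * T)) y2 ->
  `|y1 (- (n%:R * T)) - y2 (- (n%:R * T))| <= C * expR (gam / 2 * (n%:R * T)) ->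
  `|y1 (- (m%:R * T)) - y2 (- (m%:R * T))| <= K * expR (- (gam / 2 * T)) ^+ n.
Proof.
move=> C0; have [B B0 PB] := volterra_small m.
exists (d%:R * (1 + C) * B) => [|n y1 y2 mn d1 d2 yC].
  by rewrite !mulr_ge0// addr_ge0.
have := volterra_dist kPsi fh d1 d2 (@mV _) n (le_time mn).
set M := Num.max _ _ => Vle.
have nT0 : 0 <= n%:R * T by rewrite mulr_ge0// ltW.
have ME : M <= (1 + C) * expR (gam / 2 * (n%:R * T)).
  have e1 : 1 <= expR (gam / 2 * (n%:R * T)).
    by rewrite -[leLHS]expR0 ler_expR mulr_ge0// ltW.
  rewrite ge_max mulrDl mul1r; apply/andP; split.
    by rewrite (le_trans e1)// lerDl mulr_ge0// expR_ge0.
  by rewrite (le_trans yC)// lerDr expR_ge0.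
have M0 : 0 <= M by rewrite le_max ler01.
rewrite -lee_fin; apply: (le_trans Vle).
apply: (@le_trans _ _ ((d%:R * M)%:E * (B * expR (- (gam * (n%:R * T))))%:E)%E).
  by apply: lee_wpmul2l; [rewrite lee_fin mulr_ge0|exact: PB].
rewrite -EFinM lee_fin -expRM_natl.
have -> : expR (n%:R * - (gam / 2 * T)) =
    expR (gam / 2 * (n%:R * T)) * expR (- (gam * (n%:R * T))).
  by rewrite -expRD; congr expR; field.
rewrite [X in _ <= X](_ : _ = d%:R * ((1 + C) * expR (gam / 2 * (n%:R * T))) *
  (B * expR (- (gam * (n%:R * T))))); last by ring.
by rewrite ler_wpM2r ?mulr_ge0 ?expR_ge0// ler_wpM2l.
Qed.

Let z := expR (- (gam / 2 * T)).
Let z0 : 0 <= z. Proof. exact: expR_ge0. Qed.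
Let z1 : z < 1. Proof. by rewrite expR_lt1 oppr_lt0 mulr_gt0. Qed.

Let cvg_from m (x y : nat -> 'cV[R]_d) (l : 'cV[R]_d) K :
  (forall n, (m <= n)%N -> `|x n - y n| <= K * z ^+ n) ->
  x @ \oo --> l -> y @ \oo --> l.
Proof.
move=> xy xl.
have d0 : (fun n => x n - y n) @ \oo --> (0 : 'cV[R]_d).
  apply: norm_cvg0.
  have zc : (fun n => K * z ^+ n) @ \oo --> (0 : R).
    by apply: cvg_geometric; rewrite ger0_norm.
  apply: squeeze_cvgr (cvg_cst _) zc.
  by exists m => // n /= mn; rewrite normr_ge0 xy.
have -> : y = (fun n => x n - (x n - y n)).
  by apply/funext => n; rewrite opprB addrC subrK.
by rewrite -[l]subr0; apply: cvgB.
Qed.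

(** By the flow property, starting one period earlier amounts to starting at [- (m + n) T] from
    [y n] instead of 0. Since [y n] is tempered, [close_at] makes the increments of the sequence
    geometric; it also compares an arbitrary start [x] with 0. *)
Let limit_at m : exists l : 'cV[R]_d, forall x, orthant x ->
  (fun n => f (- (m%:R * T)) (- (n%:R * T)) x) @ \oo --> l.
Proof.
have [C C0 PC] := duhamel_tempered kPsi fh g2 gam_lam.
pose C' := C * expR (gam / 2 * T).
have [K K0 PK] := @close_at m C C0.
pose y n : 'cV[R]_d := f (- ((m + n)%:R * T)) (- ((m + n).+1%:R * T)) 0.
have yb n : `|y n| <= C * expR (gam / 2 * ((m + n)%:R * T)).
  have st := le_time (leqnSn (m + n)).
  have := PC _ _ _ st (f_duhamel (- ((m + n).+1%:R * T)) orthant0).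
  rewrite f_id ?normr0 ?mulr0 ?add0r; last exact: orthant0.
  by rewrite normrN ger0_norm// mulr_ge0// ltW.
have inc n : `|f (- (m%:R * T)) (- ((m + n.+1)%:R * T)) 0 -
    f (- (m%:R * T)) (- ((m + n)%:R * T)) 0| <= K * z ^+ (m + n).
  rewrite addnS (f_flow (le_time (leqnSn (m + n))) (le_time (leq_addr n m)) orthant0).
  apply: (PK _ (fun t => f t (- ((m + n)%:R * T)) (y n))
    (fun t => f t (- ((m + n)%:R * T)) 0) (leq_addr n m)).
  - by apply: f_duhamel; apply: orthant_f => //; [exact: le_time|exact: orthant0].
  - by apply: f_duhamel; exact: orthant0.
  - rewrite !f_id; first by rewrite subr0; exact: yb.
    + exact: orthant0.
    + by apply: orthant_f; [exact: le_time|exact: orthant0].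
have cv i : cvg ((fun n => f (- (m%:R * T)) (- ((m + n)%:R * T)) 0 i 0) @ \oo).
  apply: (@cvg_geometric_increments _ _ (K * z ^+ m) z) => // n.
  rewrite -mulrA -exprD; apply: le_trans (inc n).
  have := mx_entry_norm_le (f (- (m%:R * T)) (- ((m + n.+1)%:R * T)) 0 -
    f (- (m%:R * T)) (- ((m + n)%:R * T)) 0) i 0.
  by rewrite !mxE.
pose l : 'cV[R]_d := \col_i lim ((fun n => f (- (m%:R * T)) (- ((m + n)%:R * T)) 0 i 0) @ \oo).
have l0 : (fun n => f (- (m%:R * T)) (- (n%:R * T)) 0) @ \oo --> l.
  rewrite -(cvg_shiftn m); apply: mx_cvgP => i j; rewrite ord1 mxE.
  have := cv i; apply: cvg_trans; apply: near_eq_cvg; apply: nearW => n /=.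
  by rewrite addnC.
exists l => x ox; have [K' K'0 PK'] := @close_at m `|x| (normr_ge0 x).
apply: (@cvg_from m _ _ _ K' _ l0) => n mn.
apply: (PK' n (fun t => f t (- (n%:R * T)) 0) (fun t => f t (- (n%:R * T)) x) mn).
- by apply: f_duhamel; exact: orthant0.
- exact: f_duhamel.
- rewrite !f_id//; last exact: orthant0.
  rewrite sub0r normrN; apply: ler_peMr => //.
  by rewrite -[leLHS]expR0 ler_expR mulr_ge0 ?(ltW g2)// mulr_ge0// ltW.
Qed.

(** The limit at a time [- m T] before [t] is carried to [t] by the flow, which is continuous in its
    initial value by Gronwall. *)
Lemma pullback_limit : exists X : R -> 'cV[R]_d, forall t x, orthant x ->
  (fun n => f t (- (n%:R * T)) x) @ \oo --> X t.
Proof.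
suff /choice[X XP] : forall t, exists l : 'cV[R]_d, forall x, orthant x ->
    (fun n => f t (- (n%:R * T)) x) @ \oo --> l by exists X.
move=> t; have [m mt] := time_below t; have [l lP] := limit_at m.
have ol : orthant l.
  move=> i; apply: (cvgr_to_ge (cvg_mx_entry (i := i) (j := 0) (lP _ orthant0))).
  by exists m => // n /= mn; apply: orthant_f; [exact: le_time|exact: orthant0].
exists (f t (- (m%:R * T)) l) => x ox.
have [K K0 PK] := duhamel_gronwall kPsi fh mt.
apply/cvgrPdist_le => e e0.
have e1 : 0 < e / (K + 1) by rewrite divr_gt0// ltr_wpDl.
have near_m : \forall n \near \oo, (m <= n)%N by exists m.
have /cvgrPdist_le/(_ _ e1) := lP x ox; apply: filterS2 near_m => n mn nl.
 rewrite (f_flow (le_time mn) mt ox).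
have of_ : orthant (f (- (m%:R * T)) (- (n%:R * T)) x).
  by apply: orthant_f => //; exact: le_time.
apply: le_trans (PK _ _ (f_duhamel _ ol) (f_duhamel _ of_)) _.
rewrite !f_id//; apply: (@le_trans _ _ ((K + 1) * (e / (K + 1)))).
  by rewrite ler_pM// lerDl.
by rewrite mulrC divfK// gt_eqF// ltr_wpDl.
Qed.

(** A solution on the whole line has a value at each [- n T]; when these values are tempered,
    [close_at] compares the solution with the trajectory from 0, and letting [n] grow identifies it
    with [X]. *)
Lemma pullback_limit_unique (X y : R -> 'cV[R]_d) C :
  (forall t, (fun n => f t (- (n%:R * T)) 0) @ \oo --> X t) ->
  (forall s, duhamel Psi h s y) -> 0 <= C ->
  (forall t, `|y t| <= C * expR (gam / 2 * `|t|)) -> forall t, X t = y t.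
Proof.
move=> fX dy C0 yC t.
have oy t' : orthant (y t') by have [oy _ _] := dy t'; exact: oy.
have flow_y s t' : s <= t' -> f t' s (y s) = y t'.
  move=> st; have [K K0 PK] := duhamel_gronwall kPsi fh st.
  have := PK _ _ (f_duhamel s (oy s)) (dy s).
  rewrite f_id// subrr normr0 mulr0 normr_le0 subr_eq0 => /eqP.
  by [].
have at_m m : X (- (m%:R * T)) = y (- (m%:R * T)).
  have [K K0 PK] := @close_at m C C0.
  have yl : (fun n => y (- (m%:R * T))) @ \oo --> X (- (m%:R * T)).
    apply: (@cvg_from m _ _ _ K _ (fX _)) => n mn; apply: (PK n (fun t => f t (- (n%:R * T)) 0) y mn _ (dy _)).
      by apply: f_duhamel; exact: orthant0.
    rewrite f_id; last exact: orthant0.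
    rewrite sub0r normrN (le_trans (yC _))// normrN ger0_norm// mulr_ge0// ltW//.
  have yc : (fun n : nat => y (- (m%:R * T))) @ \oo --> y (- (m%:R * T)) by exact: cvg_cst.
  by rewrite -(cvg_lim (@norm_hausdorff _ _) yl) (cvg_lim (@norm_hausdorff _ _) yc).
have [m mt] := time_below t.
have [K K0 PK] := duhamel_gronwall kPsi fh mt.
have yl : (fun n => f t (- (n%:R * T)) 0) @ \oo --> y t.
  apply/cvgrPdist_le => e e0.
  have e1 : 0 < e / (K + 1) by rewrite divr_gt0// ltr_wpDl.
  have := fX (- (m%:R * T)); rewrite at_m => /cvgrPdist_le/(_ _ e1).
  have near_m : \forall n \near \oo, (m <= n)%N by exists m.
  apply: filterS2 near_m => n mn nl; rewrite (f_flow (le_time mn) mt orthant0).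
  have of_ : orthant (f (- (m%:R * T)) (- (n%:R * T)) 0).
    by apply: orthant_f => //; [exact: le_time|exact: orthant0].
  apply: le_trans (PK _ _ (dy _) (f_duhamel _ of_)) _.
  rewrite !f_id//; apply: (@le_trans _ _ ((K + 1) * (e / (K + 1)))).
    by rewrite ler_pM// lerDl.
  by rewrite mulrC divfK// gt_eqF// ltr_wpDl.
by rewrite -(cvg_lim (@norm_hausdorff _ _) (fX t)) -(cvg_lim (@norm_hausdorff _ _) yl).
Qed.

End pullback.

(** The sum over [n] has finite integral, so it is finite almost everywhere, and it dominates each
    term. *)
Lemma ae_bounded_geometric_mean {disp : measure_display} {T : measurableType disp}
    {R : realType} (mu : {measure set T -> \bar R}) (g : nat -> T -> \bar R) (K z : R) :
  (forall n, measurable_fun setT (g n)) -> (forall n x, 0 <= g n x)%E ->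
  0 <= K -> 0 <= z -> z < 1 ->
  (forall n, (\int[mu]_x g n x <= (K * z ^+ n)%:E)%E) ->
  {ae mu, forall x, exists2 C : R, 0 <= C & forall n, (g n x <= C%:E)%E}.
Proof.
move=> mg g0 K0 z0 z1 Eg.
have z10 : 0 < 1 - z by rewrite subr_gt0.
pose S x := (\sum_(0 <= n <oo) g n x)%E.
have S0 x : (0 <= S x)%E by apply: nneseries_ge0 => n _ _; exact: g0.
have mS : measurable_fun setT S by apply: ge0_emeasurable_sum => n *; [exact: g0|exact: mg].
have IS : (\int[mu]_x S x <= (K / (1 - z))%:E)%E.
  rewrite integral_nneseries//; apply: lime_le.
    by apply: is_cvg_nneseries => n _ _; exact: integral_ge0.
  apply: nearW => n; apply: (@le_trans _ _ (\sum_(0 <= i < n) (K * z ^+ i)%:E)%E).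
    by apply: lee_sum => i _; exact: Eg.
  rewrite sumEFin lee_fin -mulr_sumr ler_wpM2l// -[leRHS]mul1r ler_pdivlMr//.
  rewrite big_mkord -[_ * _]opprK -mulrN opprB mulrC -subrX1 opprB.
  by rewrite lerBlDr lerDl exprn_ge0.
have intS : mu.-integrable setT S.
  apply/integrableP; split=> //; under eq_integral do rewrite gee0_abs//.
  exact: le_lt_trans IS (ltry _).
have := integrable_ae measurableT intS; apply: filterS => x /(_ I) fS.
exists (fine (S x)); first exact: fine_ge0.
move=> n; rewrite fineK//; apply: le_trans (nneseries_lim_ge n.+1 _); last by move=> *; exact: g0.
by rewrite big_nat_recr//=; apply: leeDr; apply: sume_ge0 => i _.
Qed.

(** * Mean decay of the random Volterra iterates *)

Section wiener_kernel.
Context {R : realType} {d : nat}.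
Local Notation mu := (@lebesgue_measure R).
Variable P0 : probability (wborel R d) R.
Hypothesis hP0 : wiener_measure P0.
Variable Om : set (wpath R d).
Hypothesis hOm : universal_set P0 Om.
Variables (A : 'M[R]_d) (sigma : 'I_d -> 'M[R]_d).
Variable Phi : R -> wpath R d -> 'M[R]_d.
Hypothesis hPhi : fundamental_matrix P0 Om A sigma Phi.
Hypothesis hcocycle : linear_cocycle Om Phi.
Local Notation P := (wprob P0).

Lemma Om_wshift t w : Om w <-> Om (wshift t w).
Proof.
split; first by case: hOm => _; apply.
move=> Ow; rewrite -[w]wshift_id -(addrN t) -wshiftD.
by case: hOm => _; apply.
Qed.

Lemma mem_Om_wshift t w : (wshift t w \in Om) = (w \in Om).
Proof.
apply/idP/idP => /set_mem H; apply/mem_set; first exact: (Om_wshift t w).2.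
exact: (Om_wshift t w).1.
Qed.

Lemma Om_Fst s t : <<s Fgen P0 s t >> Om.
Proof.
rewrite -[Om]setCK.
apply: (@measurableC _ (g_sigma_algebraType (Fgen P0 s t))).
by apply: sub_sigma_algebra; right; case: hOm.
Qed.

Lemma Om_wspace : @measurable _ (wspace P0) Om.
Proof. exact: (Fgen_wspace (@Om_Fst 0 0)). Qed.

Lemma Fgen_mono s t s' t' : s <= s' -> t' <= t ->
  <<s Fgen P0 s' t' >> `<=` <<s Fgen P0 s t >>.
Proof.
move=> ss tt; apply: smallest_sub; first exact: smallest_sigma_algebra.
move=> B [[v [u [i [C [sv vu ut mC ->]]]]]|nB]; apply: sub_sigma_algebra; last by right.
left; exists v, u, i, C; split=> //; first exact: le_trans sv.
exact: le_trans ut tt.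
Qed.

Lemma Fst_measurable_mono s t s' t' (X : wpath R d -> R) : s <= s' -> t' <= t ->
  Fst_measurable P0 s' t' X -> Fst_measurable P0 s t X.
Proof. by move=> ss tt mX _ B mB; apply: (Fgen_mono ss tt); exact: mX. Qed.

Lemma Fst_measurable_wspace s t (X : wpath R d -> R) :
  Fst_measurable P0 s t X -> F_measurable P0 X.
Proof.
move=> mX _ B mB; exact: (Fgen_wspace (mX measurableT B mB)).
Qed.

Lemma Fst_measurable_wshift s t r (X : wpath R d -> R) :
  Fst_measurable P0 s t X ->
  Fst_measurable P0 (r + s) (r + t) (fun w => X (wshift r w)).
Proof.
move=> mX _ B mB; rewrite setTI.
have := mX measurableT B mB; rewrite setTI => mXB.
exact: (@Fgen_wshift _ _ _ hP0 s t r _ mXB).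
Qed.

(* The fundamental matrix from time [r] to time [t]; it is redefined outside
   the universal set so that its algebraic properties hold for all paths. *)
Definition transition (w : wpath R d) (t r : R) : 'M[R]_d :=
  if w \in Om then Phi (t - r) (wshift r w) else 1%:M.

Lemma transition_Om w t r : Om w -> transition w t r = Phi (t - r) (wshift r w).
Proof. by move=> Ow; rewrite /transition mem_set. Qed.

Lemma transition_wshift w s t r :
  transition (wshift s w) t r = transition w (s + t) (s + r).
Proof.
rewrite /transition mem_Om_wshift wshiftD; case: ifP => // _.
by congr (Phi _ _); ring.
Qed.

Lemma transition_comp w t r s : s <= r -> r <= t ->
  transition w t s = transition w t r *m transition w r s.
Proof.
move=> sr rt; rewrite /transition; case: ifPn => [/set_mem Ow|_]; last by rewrite mulmx1.
have -> : wshift r w = wshift (r - s) (wshift s w) by rewrite wshiftD addrC subrK.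
rewrite -hcocycle ?subr_ge0//; last by case: hOm => _; apply.
by congr (Phi _ _); ring.
Qed.

Lemma transition_unit w t s : s <= t -> transition w t s \in unitmx.
Proof.
move=> st; rewrite /transition; case: ifPn => [/set_mem Ow|_]; last exact: unitmx1.
have [_ _ u] := hPhi; apply: u; first by rewrite subr_ge0.
by case: hOm => _; apply.
Qed.

(** Constant extension to the left of [s] gives continuity on the whole line, the form that
    [measurable_fun_caratheodory] takes. *)
Lemma within_continuous_max (V : topologicalType) (s : R) (f : R -> V) :
  {within `[s, +oo[%classic, continuous f} -> continuous (fun t : R => f (Num.max s t)).
Proof.
move=> /subspace_continuousP cf t.
have m0 : s <= Num.max s t by rewrite le_max lexx.
have mt : `[s, +oo[%classic (Num.max s t) by rewrite /= in_itv/= m0.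
apply: (cvg_comp (fun t : R => Num.max s t) f _ (cf _ mt)) => B nB.
have mc : (fun t : R => Num.max s t) @ t --> Num.max s t.
  by apply: (@continuous_max R R (fun=> s) id); [exact: cvg_cst|exact: cvg_id].
have H : \forall x \near t, `[s, +oo[%classic (Num.max s x) -> B (Num.max s x) := mc _ nB.
rewrite /nbhs/=; apply: filterS H => x; apply.
by rewrite /= in_itv/= le_max lexx.
Qed.

Lemma transition_continuous w s i j :
  continuous (fun t : R => transition w (Num.max s t) s i j).
Proof.
rewrite /transition; case: (boolP (w \in Om)) => [/set_mem Ow|_] t; last exact: cvg_cst.
have Osw : Om (wshift s w) by case: hOm => _; apply.
have [/(_ j)[_ cP _] _ _] := hPhi.
have cc : continuous (fun u : R => Phi (Num.max 0 u) (wshift s w) i j).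
  have -> : (fun u => Phi (Num.max 0 u) (wshift s w) i j) =
      (fun u => (col j (Phi (Num.max 0 u) (wshift s w))) i 0).
    by apply/funext => u; rewrite mxE.
  move=> u; have cu := within_continuous_max (cP _ Osw) (x := u).
  exact: (cvg_comp _ _ cu (@coord_continuous R d 1 i 0 (col j (Phi (Num.max 0 u) (wshift s w))))).
have E : (fun x => Phi (Num.max s x - s) (wshift s w) i j) =
    (fun x => Phi (Num.max 0 x) (wshift s w) i j) \o (fun x => x - s).
  apply/funext => x /=; congr (Phi _ _ i j).
  by rewrite -[0 in RHS](subrr s) -addr_maxl.
rewrite E; apply: continuous_comp; last exact: cc.
by apply: cvgB; [exact: cvg_id|exact: cvg_cst].
Qed.

Lemma transition_adapted s t i j : s <= t ->
  Fst_measurable P0 s t (fun w => transition w t s i j).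
Proof.
move=> st.
have [/(_ j)[aP _ _] _ _] := hPhi.
have ts0 : 0 <= t - s by rewrite subr_ge0.
have mPhi : Fst_measurable P0 0 (t - s) (fun w => Phi (t - s) w i j).
  by have := aP _ i ts0; under eq_fun do rewrite mxE.
have := @Fst_measurable_wshift 0 (t - s) s _ mPhi; rewrite addr0 addrC subrK => m1.
have mOm : @measurable _ (g_sigma_algebraType (Fgen P0 s t)) Om by exact: Om_Fst.
rewrite /Fst_measurable -(setUv Om); apply/measurable_funU => //.
  exact: measurableC.
split.
  have : @measurable_fun _ _ (g_sigma_algebraType (Fgen P0 s t)) R Om
    (fun w => Phi (t - s) (wshift s w) i j) by apply: measurable_funTS; exact: m1.
  by apply: eq_measurable_fun => w Ow; rewrite /transition Ow.
have := @measurable_cst _ _ (g_sigma_algebraType (Fgen P0 s t)) _ (~` Om) ((1%:M : 'M[R]_d) i j).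
by apply: eq_measurable_fun => w; rewrite in_setC /transition => /negbTE ->.
Qed.

(** * Joint measurability of the kernel and of the Picard iterates *)

Section joint.
Context {dT : measure_display} {T : measurableType dT}.
Variables (proj : T -> wpath R d) (s : R) (clamp : R -> R).
Hypothesis clamp_cont : continuous clamp.
Hypothesis clamp_ge : forall t, s <= clamp t.
Hypothesis clamp_id : forall t r, s <= r -> r <= clamp t -> clamp r = r.
Hypothesis mproj : forall t i j,
  measurable_fun setT (fun x => transition (proj x) (clamp t) s i j).

(** [clamp] confines time to where the kernel is measurable: [Num.max s] serves on the completed
    space, truncation to the interval from [s] to [t] on the sigma-algebra of its increments. *)
Lemma transition_joint i j : measurable_fun setT
  (fun p : measurableTypeR R * T => transition (proj p.2) (clamp p.1) s i j).
Proof.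
apply: (@measurable_fun_caratheodory _ _ _ (fun t x => transition (proj x) (clamp t) s i j)).
  move=> x t; rewrite (_ : (fun y => _) =
    (fun u => transition (proj x) (Num.max s u) s i j) \o clamp); last first.
    by apply/funext => u /=; rewrite max_r.
  by apply: continuous_comp; [exact: clamp_cont|exact: transition_continuous].
by move=> t; exact: mproj.
Qed.

(** Both factors start at the common origin [s], because joint measurability is available in the
    final time only. *)
Definition transition_between (q : measurableTypeR R * T * measurableTypeR R) : 'M[R]_d :=
  transition (proj q.1.2) (clamp q.1.1) s
    *m invmx (transition (proj q.1.2) (clamp q.2) s).

Lemma transition_betweenE q : s <= q.2 -> q.2 <= clamp q.1.1 ->
  transition_between q = transition (proj q.1.2) (clamp q.1.1) q.2.
Proof.
move=> sr rt; rewrite /transition_between (clamp_id sr rt).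
by rewrite (transition_comp _ sr rt) mulmxK// transition_unit.
Qed.

Lemma transition_between_measurable i j :
  measurable_fun setT (fun q => transition_between q i j).
Proof.
apply: measurable_fun_mulmx => k l.
  apply: (measurableT_comp (transition_joint k l)).
  exact: measurable_fst.
have mq : measurable_fun setT
    (fun q : measurableTypeR R * T * measurableTypeR R => (q.2, q.1.2)).
  apply: measurable_fun_pair; first exact: measurable_snd.
  exact: (measurableT_comp measurable_snd measurable_fst).
apply: (@measurable_fun_invmx _ _ _ _ _
  (fun q : measurableTypeR R * T * measurableTypeR R =>
     transition (proj q.1.2) (clamp q.2) s)).
  by move=> q; exact: transition_unit.
by move=> k' l'; exact: (measurableT_comp (transition_joint k' l') mq).
Qed.

Let a (w : wpath R d) (t r : R) : \bar R := (`|transition w t r|)%:E.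

(** The moving upper limit of integration is put into the integrand, so that Tonelli applies on a
    fixed product space. *)
Definition volterra_integrand (H : R -> wpath R d -> \bar R)
    (q : measurableTypeR R * T * measurableTypeR R) : \bar R :=
  if (s <= q.2) && (q.2 <= clamp q.1.1)
  then ((`|transition_between q|)%:E * H (clamp q.2) (proj q.1.2))%E else 0%E.

Lemma measurable_volterra_integrand H :
  measurable_fun setT (fun p : measurableTypeR R * T => H (clamp p.1) (proj p.2)) ->
  measurable_fun setT (volterra_integrand H).
Proof.
move=> mH; apply: measurable_fun_ifT.
- have m2 : measurable_fun setT
      ((fun q => q.2) : measurableTypeR R * T * measurableTypeR R -> R).
    exact: measurable_snd.
  apply: measurable_and; first exact: (measurable_fun_ler (measurable_cst s)).
  apply: (measurable_fun_ler m2).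
  apply: (@measurableT_comp _ _ _ _ _ _ clamp _
    (fun q : measurableTypeR R * T * measurableTypeR R => q.1.1)).
    exact: continuous_measurable_fun.
  exact: (measurableT_comp measurable_fst measurable_fst).
- apply: emeasurable_funM.
    apply/measurable_EFinP; apply: measurable_fun_mx_norm => i j.
    exact: transition_between_measurable.
  have mq : measurable_fun setT
      (fun q : measurableTypeR R * T * measurableTypeR R => (q.2, q.1.2)).
    apply: measurable_fun_pair; first exact: measurable_snd.
    exact: (measurableT_comp measurable_snd measurable_fst).
  exact: (measurableT_comp mH mq).
- exact: measurable_cst.
Qed.

Lemma volterra_integrandE (H : R -> wpath R d -> \bar R) t x :
  (\int[mu]_(r in `[s, clamp t]) (a (proj x) (clamp t) r * H r (proj x)) =
   \int[mu]_r volterra_integrand H ((t, x), r))%E.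
Proof.
rewrite integral_mkcond; apply: eq_integral => r _.
rewrite patchE /volterra_integrand/=.
have -> : (r \in `[s, clamp t]%classic) = (s <= r <= clamp t).
  by apply/idP/idP => [/set_mem|H']; [|apply/mem_set]; rewrite /= in_itv.
case: ifPn => // /andP[sr rt].
by rewrite transition_betweenE// (clamp_id sr rt).
Qed.

Lemma measurable_volterra (c N : R) k : 0 <= c -> 0 <= N ->
  measurable_fun setT (fun p : measurableTypeR R * T =>
    volterra (a (proj p.2)) c N s k (clamp p.1)).
Proof.
move=> c0 N0.
have a0 w t r : (0 <= a w t r)%E by rewrite lee_fin.
have step (H : R -> wpath R d -> \bar R) : (forall r w, 0 <= H r w)%E ->
    measurable_fun setT (fun p : measurableTypeR R * T => H (clamp p.1) (proj p.2)) ->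
    measurable_fun setT (fun p : measurableTypeR R * T =>
      (a (proj p.2) (clamp p.1) s +
       \int[mu]_(r in `[s, clamp p.1]) (a (proj p.2) (clamp p.1) r * H r (proj p.2)))%E).
  move=> H0 mH; apply: emeasurable_funD.
    apply/measurable_EFinP; apply: measurable_fun_mx_norm => i j.
    exact: transition_joint.
  rewrite (_ : (fun p => _) = fubini_F mu (volterra_integrand H)); last first.
    by apply/funext => -[t x]; rewrite volterra_integrandE.
  apply: measurable_fun_fubini_tonelli_F; first exact: measurable_volterra_integrand.
  by move=> q; rewrite /volterra_integrand; case: ifP => // _; rewrite mule_ge0.
elim: k => [|k IH].
  apply: (step (fun _ _ => N%:E)); last exact: measurable_cst.
  by move=> r w; rewrite lee_fin.
apply: (step (fun r w => c%:E * volterra (a w) c N s k r)%E).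
  by move=> r w; rewrite mule_ge0// volterra_ge0.
exact: measurable_funeM.
Qed.

End joint.

Let a (w : wpath R d) (t r : R) : \bar R := (`|transition w t r|)%:E.

Let a0 w t r : (0 <= a w t r)%E. Proof. by rewrite lee_fin. Qed.

Lemma transition_norm_adapted r t : r <= t ->
  @measurable_fun _ _ (g_sigma_algebraType (Fgen P0 r t)) (\bar R) setT
    (fun w => a w t r).
Proof.
move=> rt; apply/measurable_EFinP; apply: measurable_fun_mx_norm => i j.
exact: transition_adapted.
Qed.

Lemma measurable_wspace_of_Fst s t (X : wpath R d -> \bar R) :
  @measurable_fun _ _ (g_sigma_algebraType (Fgen P0 s t)) (\bar R) setT X ->
  @measurable_fun _ _ (wspace P0) (\bar R) setT X.
Proof. by move=> mX _ B mB; exact: (Fgen_wspace (mX measurableT B mB)). Qed.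

(** Truncating all times to the interval from [s] to [t] leaves only kernels that depend on its
    increments; this is what makes the iterate independent of later transitions. *)
Lemma volterra_adapted c N s t k : 0 <= c -> 0 <= N -> s <= t ->
  @measurable_fun _ _ (g_sigma_algebraType (Fgen P0 s t)) (\bar R) setT
    (fun w => volterra (a w) c N s k t).
Proof.
move=> c0 N0 st; pose clamp x := Num.max s (Num.min x t).
have clamp_ge x : s <= clamp x by rewrite le_max lexx.
have clamp_le x : clamp x <= t by rewrite ge_max st ge_min lexx orbT.
have clampt : clamp t = t by rewrite /clamp minxx max_r.
pose T := g_sigma_algebraType (Fgen P0 s t).
have mV : measurable_fun setT (fun p : measurableTypeR R * T =>
    volterra (a p.2) c N s k (clamp p.1)).
  apply: (@measurable_volterra _ T id s clamp) => //.
  - move=> x; apply: (@continuous_max R R (fun=> s) (fun x => Num.min x t)).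
      exact: cvg_cst.
    by apply: (@continuous_min R R id (fun=> t)); [exact: cvg_id|exact: cvg_cst].
  - move=> x r sr rx; rewrite /clamp min_l ?max_r//.
    exact: le_trans (clamp_le x).
  - move=> x i j.
    exact: (Fst_measurable_mono (lexx s) (clamp_le x) (transition_adapted i j (clamp_ge x))).
have mt : measurable_fun setT (fun w : T => ((t : measurableTypeR R), w)).
  by apply: measurable_fun_pair => //; exact: measurable_cst.
have := measurableT_comp mV mt.
by apply: eq_measurable_fun => w _ /=; rewrite clampt.
Qed.

Lemma max_clamp_cont (s : R) : continuous (fun x : R => Num.max s x).
Proof.
by move=> x; apply: (@continuous_max R R (fun=> s) id); [exact: cvg_cst|exact: cvg_id].
Qed.

Lemma max_clamp_ge (s x : R) : s <= Num.max s x.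
Proof. by rewrite le_max lexx. Qed.

Lemma max_clamp_id (s t r : R) : s <= r -> r <= Num.max s t -> Num.max s r = r.
Proof. by move=> sr _; rewrite max_r. Qed.

Lemma transition_wspace s t i j : @measurable_fun _ _ (wspace P0) R setT
  (fun w => transition w (Num.max s t) s i j).
Proof.
exact: (Fst_measurable_wspace (transition_adapted i j (max_clamp_ge s t))).
Qed.

Lemma volterra_jointly_measurable c N s k : 0 <= c -> 0 <= N ->
  measurable_fun setT (fun p : measurableTypeR R * wspace P0 =>
    volterra (a p.2) c N s k (Num.max s p.1)).
Proof.
move=> c0 N0.
apply: (@measurable_volterra _ (wspace P0) id s (Num.max s)).
- exact: max_clamp_cont.
- exact: max_clamp_ge.
- exact: max_clamp_id.
- exact: transition_wspace.
- exact: c0.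
- exact: N0.
Qed.

Lemma volterra_section c N (s : R) k w : 0 <= c -> 0 <= N ->
  measurable_fun `[s, +oo[%classic (volterra (a w) c N s k).
Proof.
move=> c0 N0.
have mw : measurable_fun setT (fun t : measurableTypeR R => (t, w : wspace P0)).
  by apply: measurable_fun_pair => //; exact: measurable_cst.
have := measurableT_comp (@volterra_jointly_measurable c N s k c0 N0) mw.
move=> /(measurable_funTS (D := `[s, +oo[%classic)).
apply: eq_measurable_fun => t; rewrite inE/= in_itv/= andbT => st.
by rewrite max_r.
Qed.

(** * Mean estimates from the conditions on [Rp] *)

Variables (lam : R) (Rp : R -> wpath R d -> R).
Hypothesis hL : cond_L P0 Om Phi lam Rp.
Hypothesis hR : cond_R P0 Rp.

Let Rbar := fine (sup_mean P0 Rp).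

Let OmC0 : P (~` Om) = 0%E.
Proof. by apply: negligible_wprob; case: hOm. Qed.

Let mRp t : 0 <= t -> @measurable_fun _ _ (wspace P0) R setT (Rp t).
Proof. by move=> t0; have [_ mR _ _ _] := hL; exact: mR. Qed.

(** [Rp] is positive on [Om] only; passing to the absolute value makes the integrals of nonnegative
    functions available. *)
Let integral_norm_Rp t : 0 <= t ->
  (\int[P]_w (Rp t w)%:E = \int[P]_w `|Rp t w|%:E)%E.
Proof.
move=> t0; have [_ _ Rpos _ _] := hL; apply: ae_eq_integral.
- exact: measurableT.
- by apply/measurable_EFinP; exact: mRp.
- by apply/measurable_EFinP; apply: measurableT_comp; [exact: normr_measurable|exact: mRp].
- exists (~` Om); split; [by apply: measurableC; exact: Om_wspace|exact: OmC0|].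
  by move=> w; apply: contra_not => Ow _ /=; rewrite gtr0_norm// Rpos.
Qed.

Let integral_Rp_ge0 t : 0 <= t -> (0 <= \int[P]_w (Rp t w)%:E)%E.
Proof.
by move=> t0; rewrite integral_norm_Rp//; apply: integral_ge0 => w _; rewrite lee_fin.
Qed.

Lemma sup_mean_ge t : 0 <= t -> (\int[P]_w (Rp t w)%:E <= Rbar%:E)%E.
Proof.
move=> t0; have [_ oo] := hR.
have le u : 0 <= u -> (\int[P]_w (Rp u w)%:E <= sup_mean P0 Rp)%E.
  move=> u0; apply: ereal_sup_ubound; exists u; first by rewrite /= in_itv/= u0.
  by rewrite unlock.
rewrite /Rbar fineK; first exact: le.
by rewrite ge0_fin_numE// (le_trans (integral_Rp_ge0 t0) (le _ t0)).
Qed.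

Lemma Rbar_ge0 : 0 <= Rbar.
Proof.
by rewrite -lee_fin; apply: le_trans (sup_mean_ge (lexx 0)); exact: integral_Rp_ge0.
Qed.

(** By stationarity the norm has the law of the transition from 0 to [t - r], to which (L) applies
    directly. *)
Lemma transition_mean r t : r <= t ->
  (\int[P]_w a w t r <= (Rbar * expR (- (lam * (t - r))))%:E)%E.
Proof.
move=> rt; have tr0 : 0 <= t - r by rewrite subr_ge0.
have [_ mR Rpos _ PhiR] := hL.
have mtr := transition_norm_adapted rt.
have m0 := transition_norm_adapted tr0.
have -> : (\int[P]_w a w t r = \int[P]_w a w (t - r) 0)%E.
  apply: ge0_integral_eq_law.
  - exact: measurable_wspace_of_Fst mtr.
  - exact: measurable_wspace_of_Fst m0.
  - by [].
  - by [].
  move=> B mB; have := m0 measurableT B mB; rewrite setTI => mAB.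
  apply: etrans (@wprob_wshift _ _ _ hP0 0 (t - r) r _ mAB); congr (P _).
  by apply/seteqP; split=> w /=; rewrite /a transition_wshift addr0 addrC subrK.
have mabs : @measurable_fun _ _ (wspace P0) (\bar R) setT (fun w => `|Rp (t - r) w|%:E).
  by apply/measurable_EFinP; apply: measurableT_comp; [exact: normr_measurable|exact: mRp].
apply: (@le_trans _ _ (\int[P]_w ((expR (- (lam * (t - r))))%:E * `|Rp (t - r) w|%:E))%E).
  apply: ae_ge0_le_integral.
  - exact: measurableT.
  - by move=> w _.
  - exact: measurable_wspace_of_Fst m0.
  - by move=> w _; rewrite mule_ge0// lee_fin expR_ge0.
  - exact: measurable_funeM.
  - exists (~` Om); split; [by apply: measurableC; exact: Om_wspace|exact: OmC0|].
    move=> w; apply: contra_not => Ow _ /=.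
    rewrite /a transition_Om// subr0 wshift_id -EFinM lee_fin mulrC.
    by rewrite gtr0_norm ?Rpos// PhiR.
rewrite ge0_integralZl.
- rewrite -integral_norm_Rp// muleC EFinM.
  by apply: lee_wpmul2r; [rewrite lee_fin expR_ge0|exact: sup_mean_ge].
- exact: measurableT.
- exact: mabs.
- by move=> w _; rewrite lee_fin.
- by rewrite lee_fin expR_ge0.
Qed.

(* The transition from [r] to [t] depends on the increments on [r, t] only and
   is therefore independent of the past [H]. *)
Lemma transition_mean_mul s r t (H : wpath R d -> \bar R) : s <= r -> r <= t ->
  @measurable_fun _ _ (g_sigma_algebraType (Fgen P0 s r)) (\bar R) setT H ->
  (forall w, 0 <= H w)%E ->
  (\int[P]_w (a w t r * H w) <=
    (Rbar * expR (- (lam * (t - r))))%:E * \int[P]_w H w)%E.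
Proof.
move=> sr rt mH H0; have mtr := transition_norm_adapted rt.
rewrite ge0_integral_indep.
- by apply: lee_wpmul2r; [exact: integral_ge0|exact: transition_mean].
- exact: measurable_wspace_of_Fst mtr.
- exact: measurable_wspace_of_Fst mH.
- by [].
- exact: H0.
- move=> B C mB mC; rewrite setIC [RHS]muleC.
  have := mtr measurableT B mB; have := mH measurableT C mC; rewrite !setTI => mHC mB'.
  exact: (@Fgen_indep _ _ _ hP0 s r t).
Qed.
Variables (c N : R).
Hypothesis c0 : 0 <= c.
Hypothesis N0 : 0 <= N.

Let expR_rate_measurable (b t : R) (D : set R) :
  measurable_fun D (fun r : R => expR (- (b * (t - r)))).
Proof.
apply: measurable_funTS; apply: continuous_measurable_fun => x.
apply: continuous_comp; last exact: continuous_expR.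
apply: cvgN; apply: cvgM; first exact: cvg_cst.
by apply: cvgB; [exact: cvg_cst|exact: cvg_id].
Qed.

(** The rate [lam] is split: [nu] makes the time integral converge, at the cost of a factor
    [1 / nu], and [mm] survives as decay in [t - s]. Tonelli brings the mean inside, where
    independence bounds the product. *)
Lemma volterra_mean_step (H : R -> wpath R d -> \bar R) (nu mm c1 c2 s t : R) :
  s <= t -> 0 < nu -> 0 <= mm -> mm + nu = lam -> 0 <= c1 -> 0 <= c2 ->
  (forall r w, 0 <= H r w)%E ->
  (forall r, s <= r -> @measurable_fun _ _ (g_sigma_algebraType (Fgen P0 s r))
     (\bar R) setT (H r)) ->
  measurable_fun setT (fun p : measurableTypeR R * wspace P0 =>
     H (Num.max s p.1) p.2) ->
  (forall r, s <= r ->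
     (\int[P]_w H r w <= (c1 * expR (- (mm * (r - s))) + c2)%:E)%E) ->
  (\int[P]_w (a w t s + \int[mu]_(r in `[s, t]) (a w t r * H r w)) <=
   (Rbar * expR (- (mm * (t - s))) +
    Rbar / nu * (c1 * expR (- (mm * (t - s))) + c2))%:E)%E.
Proof.
move=> st nu0 mm0 mmnu c10 c20 H0 mH mHj EH.
have Rb0 := Rbar_ge0.
pose F (q : wspace P0 * measurableTypeR R) : \bar R :=
  @volterra_integrand _ (wspace P0) id s (Num.max s) H ((t, q.1), q.2).
have F0 q : (0 <= F q)%E.
  by rewrite /F /volterra_integrand; case: ifP => // _; rewrite mule_ge0.
have mF : measurable_fun setT F.
  have mI := @measurable_volterra_integrand _ (wspace P0) id s (Num.max s)
    (@max_clamp_cont s) (@max_clamp_ge s) (@transition_wspace s) H mHj.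
  have mq : measurable_fun setT (fun q : wspace P0 * measurableTypeR R =>
      (((t : measurableTypeR R), q.1), q.2)).
    apply: measurable_fun_pair; last exact: measurable_snd.
    by apply: measurable_fun_pair; [exact: measurable_cst|exact: measurable_fst].
  exact: (measurableT_comp mI mq).
have IE w : (\int[mu]_(r in `[s, t]) (a w t r * H r w) = \int[mu]_r F (w, r))%E.
  have := @volterra_integrandE _ (wspace P0) id s (Num.max s) (@max_clamp_id s) H t w.
  by rewrite max_r.
have mats : @measurable_fun _ _ (wspace P0) (\bar R) setT (fun w => a w t s).
  exact: measurable_wspace_of_Fst (transition_norm_adapted st).
have mIF : @measurable_fun _ _ (wspace P0) (\bar R) setT (fubini_F mu F).
  exact: (measurable_fun_fubini_tonelli_F F mF F0).
rewrite (@eq_integral _ (wspace P0) R P setT (fun w => a w t s + fubini_F mu F w)%E); last first.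
  by move=> w _; rewrite IE.
rewrite ge0_integralD.
- rewrite [X in (_ <= X)%E]EFinD; apply: leeD.
    apply: (le_trans (transition_mean st)).
    rewrite lee_fin ler_wpM2l// ler_expR lerN2 -mmnu ler_wpM2r ?subr_ge0//.
    by rewrite lerDl ltW.
  rewrite fubini_tonelli//.
  pose K := Rbar * (c1 * expR (- (mm * (t - s))) + c2).
  have K0 : 0 <= K by rewrite mulr_ge0// addr_ge0// mulr_ge0// expR_ge0.
  have mE (D : set R) : measurable_fun D (fun r : R => (expR (- (nu * (t - r))))%:E).
    by apply/measurable_EFinP; exact: expR_rate_measurable.
  have -> : (Rbar / nu * (c1 * expR (- (mm * (t - s))) + c2))%:E =
      (\int[mu]_(r in `]-oo, t]) (K%:E * (expR (- (nu * (t - r))))%:E))%E.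
    rewrite ge0_integralZl.
    + rewrite integral_expR_Ny// -EFinM; congr EFin; rewrite /K; ring.
    + exact: measurable_itv.
    + exact: mE.
    + by move=> r _; rewrite lee_fin expR_ge0.
    + by rewrite lee_fin.
  rewrite [X in (_ <= X)%E]integral_mkcond; apply: ge0_le_integral.
  + exact: measurableT.
  + by move=> r _; apply: integral_ge0 => w _; exact: F0.
  + exact: (measurable_fun_fubini_tonelli_G F mF F0).
  + apply/(measurable_restrictT _ _).1; first exact: measurable_itv.
    by apply: measurable_funeM; exact: mE.
  + have FE r w : F (w, r) = if (s <= r) && (r <= t) then (a w t r * H r w)%E else 0%E.
      rewrite /F /volterra_integrand/= [Num.max s t]max_r//.
      case: ifP => // /andP[sr rt]; rewrite [Num.max s r]max_r//.
      have := @transition_betweenE _ (wspace P0) id s (Num.max s) (@max_clamp_id s)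
        ((t, w), r) sr.
      by rewrite /= [Num.max s t]max_r// => ->.
    move=> r _; rewrite patchE /fubini_G.
    have -> : (r \in `]-oo, t]%classic) = (r <= t).
      by apply/idP/idP => [/set_mem|H']; [|apply/mem_set]; rewrite /= in_itv.
    case: (boolP ((s <= r) && (r <= t))) => [/andP[sr rt]|nst]; last first.
      rewrite (@eq_integral _ (wspace P0) R P setT (fun=> 0%E)); last first.
        by move=> w _; rewrite FE (negbTE nst).
      rewrite integral0; case: ifP => // _.
      by rewrite mule_ge0// lee_fin ?expR_ge0.
    rewrite rt (@eq_integral _ (wspace P0) R P setT (fun w => a w t r * H r w)%E); last first.
      by move=> w _; rewrite FE sr rt.
    apply: le_trans (transition_mean_mul sr rt (mH r sr) (H0 r)) _.
    apply: le_trans (lee_wpmul2l _ (EH r sr)) _.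
      by rewrite lee_fin mulr_ge0// expR_ge0.
    rewrite -!EFinM lee_fin /K -!mulrA ler_wpM2l//.
    have -> : expR (- (lam * (t - r))) = expR (- (mm * (t - r))) * expR (- (nu * (t - r))).
      by rewrite -expRD -mmnu; congr expR; ring.
    rewrite [X in X <= _](_ : _ = (expR (- (mm * (t - r))) *
      (c1 * expR (- (mm * (r - s))) + c2)) * expR (- (nu * (t - r)))); last by ring.
    rewrite ler_wpM2r ?expR_ge0// mulrDr; apply: lerD.
      rewrite mulrCA -expRD le_eqVlt; apply/orP; left; apply/eqP.
      by congr (_ * expR _); ring.
    by apply: ler_piMl => //; rewrite expR_le1 oppr_le0 mulr_ge0// subr_ge0.
- exact: measurableT.
- by move=> w _; exact: a0.
- exact: mats.
- by move=> w _; apply: integral_ge0.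
- exact: mIF.
Qed.

Lemma volterra_mean (nu mm kap : R) s k t : s <= t -> 0 < nu -> 0 <= mm ->
  mm + nu = lam -> kap = Rbar * c / nu -> kap < 1 ->
  (\int[P]_w volterra (a w) c N s k t <=
   (Rbar / (1 - kap) * expR (- (mm * (t - s))) + Rbar * N / nu * kap ^+ k)%:E)%E.
Proof.
move=> + nu0 mm0 mmnu kapE kap1.
have Rb0 := Rbar_ge0.
have kap0 : 0 <= kap by rewrite kapE divr_ge0 ?mulr_ge0// ltW.
have k1 : 0 < 1 - kap by rewrite subr_gt0.
(* One iteration sends the coefficient [C] of the decaying term to [Rbar + kap * C]; its fixed point
   bounds all iterates at once. *)
have CE : Rbar + kap * (Rbar / (1 - kap)) = Rbar / (1 - kap).
  by field; rewrite gt_eqF.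
have C0 : 0 <= Rbar / (1 - kap) by rewrite divr_ge0// ltW.
have D0 j : 0 <= Rbar * N / nu * kap ^+ j.
  by rewrite mulr_ge0// ?exprn_ge0// divr_ge0 ?mulr_ge0// ltW.
elim: k t => [|k IH] t st.
  apply: le_trans (@volterra_mean_step (fun _ _ => N%:E) nu mm 0 N s t _ _ _ _ _ _ _ _ _ _) _ => //.
  - move=> r sr; rewrite mul0r add0r integral_cst; last exact: measurableT.
    by rewrite [X in (_ * X)%E]probability_setT mule1.
  - rewrite lee_fin mul0r add0r expr0 mulr1; apply: lerD; last first.
      by rewrite le_eqVlt; apply/orP; left; apply/eqP; ring.
    rewrite ler_wpM2r ?expR_ge0// -[leRHS]CE lerDl mulr_ge0//.
apply: le_trans (@volterra_mean_step (fun r w => c%:E * volterra (a w) c N s k r)%E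
  nu mm (c * (Rbar / (1 - kap))) (c * (Rbar * N / nu * kap ^+ k)) s t _ _ _ _ _ _ _ _ _ _) _ => //.
- exact: mulr_ge0.
- exact: mulr_ge0.
- by move=> r w; rewrite mule_ge0// volterra_ge0.
- by move=> r sr; apply: measurable_funeM; exact: volterra_adapted.
- by apply: measurable_funeM; exact: volterra_jointly_measurable.
- move=> r sr; rewrite ge0_integralZl.
  + rewrite -mulrA -mulrDr EFinM; apply: lee_wpmul2l; first by rewrite lee_fin.
    exact: IH.
  + exact: measurableT.
  + exact: measurable_wspace_of_Fst (volterra_adapted k c0 N0 sr).
  + by move=> w _; apply: volterra_ge0.
  + by rewrite lee_fin.
- rewrite lee_fin -[in leRHS]CE exprS kapE le_eqVlt; apply/orP; left; apply/eqP; ring.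
Qed.

(* In the mean the iterates decay like [expR (- (2 * gam * n * T))]; half of
   the rate is given up to make the decay almost sure. *)
Lemma volterra_ae_decay T : 0 < T -> Rbar * c < lam ->
  exists gam : R, [/\ 0 < gam, gam / 2 < lam &
    {ae P, forall w, forall m : nat, exists2 C : R, 0 <= C & forall n : nat, (m <= n)%N ->
      (volterra (a w) c N (- (n%:R * T)) n (- (m%:R * T)) <=
       (C * expR (- (gam * (n%:R * T))))%:E)%E}].
Proof.
move=> T0 ql; have Rb0 := Rbar_ge0.
have q0 : 0 <= Rbar * c by rewrite mulr_ge0.
have lam0 : 0 < lam by exact: le_lt_trans ql.
(* By small gain the midpoint [nu] of [Rbar * c] and [lam] exceeds [Rbar * c], so [kap < 1], and
   leaves a positive rate [mm]. *)
pose mm := (lam - Rbar * c) / 2; pose nu := (lam + Rbar * c) / 2.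
have mm0 : 0 < mm by rewrite /mm; lra.
have nu0 : 0 < nu by rewrite /nu; lra.
have mmnu : mm + nu = lam by rewrite /mm /nu; lra.
pose kap := Rbar * c / nu.
have kap0 : 0 <= kap by rewrite divr_ge0// ltW.
have kap1 : kap < 1 by rewrite ltr_pdivrMr// mul1r /nu; lra.
(* For the [n]-th iterate started at [- n T], the two terms of [volterra_mean] decay like the [n]-th
   powers of these two numbers. *)
pose eta := Num.max (expR (- (mm * T))) kap.
have eta0 : 0 < eta by rewrite lt_max expR_gt0.
have eta1 : eta < 1 by rewrite gt_max kap1 andbT expR_lt1 oppr_lt0 mulr_gt0.
pose gam := - ln eta / (2 * T).
have T2 : 0 < 2 * T by rewrite mulr_gt0.
have gamE : 2 * gam * T = - ln eta by rewrite /gam; field; rewrite gt_eqF.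
have etaE k : eta ^+ k = expR (- (2 * gam * (k%:R * T))).
  rewrite mulrCA gamE -mulNr mulNr mulrN opprK.
  by rewrite -[in LHS](lnK (x := eta))// -expRM_natl.
have gam0 : 0 < gam by rewrite divr_gt0// oppr_gt0 ln_lt0// eta0.
exists gam; split=> //.
  have : - ln eta <= mm * T.
    rewrite lerNl -[- (mm * T)]expRK ler_ln ?posrE ?expR_gt0//.
    by rewrite le_max lexx.
  by rewrite -gamE ler_pM2r// => H; rewrite /mm in H; lra.
pose z := expR (- (gam * T)).
have z1 : z < 1 by rewrite expR_lt1 oppr_lt0 mulr_gt0.
have k1 : 0 < 1 - kap by rewrite subr_gt0.
apply/ae_foralln => m.
(* For [n < m] the start would come after the final time, so these terms are set to 0. *)
pose g n w := if (m <= n)%N then ((expR (gam * (n%:R * T)))%:E *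
  volterra (a w) c N (- (n%:R * T)) n (- (m%:R * T)))%E else 0%E.
(* The elapsed time is [(n - m) * T], whence the factor [expR (mm * (m * T))]. *)
pose K := Rbar / (1 - kap) * expR (mm * (m%:R * T)) + Rbar * N / nu.
have K1 : 0 <= Rbar / (1 - kap) by rewrite divr_ge0// ltW.
have K2 : 0 <= Rbar * N / nu by apply: divr_ge0; [exact: mulr_ge0|exact: ltW].
have K0 : 0 <= K by apply: addr_ge0 => //; apply: mulr_ge0 => //; exact: expR_ge0.
have nm n : (m <= n)%N -> - (n%:R * T) <= - (m%:R * T).
  by move=> mn; rewrite lerN2 ler_wpM2r ?(ltW T0)// ler_nat.
have mV n : (m <= n)%N -> @measurable_fun _ _ (wspace P0) (\bar R) setT
    (fun w => volterra (a w) c N (- (n%:R * T)) n (- (m%:R * T))).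
  by move=> mn; exact: measurable_wspace_of_Fst (volterra_adapted n c0 N0 (nm n mn)).
have V0 n k w t : (0 <= volterra (a w) c N n k t)%E by exact: volterra_ge0.
have := @ae_bounded_geometric_mean _ (wspace P0) R P g K z.
case.
- move=> n; rewrite /g; case: (boolP (m <= n)%N) => mn; last exact: measurable_cst.
  by apply: measurable_funeM; exact: mV.
- by move=> n w; rewrite /g; case: ifP => // _; rewrite mule_ge0// lee_fin expR_ge0.
- exact: K0.
- exact: expR_ge0.
- exact: z1.
- move=> n; rewrite /g; case: (boolP (m <= n)%N) => mn; last first.
    by rewrite integral0 lee_fin mulr_ge0// exprn_ge0// expR_ge0.
  rewrite ge0_integralZl.
  + apply: le_trans (lee_wpmul2l _ (volterra_mean n (nm n mn) nu0 (ltW mm0) mmnu erefl kap1)) _.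
      by rewrite lee_fin expR_ge0.
    rewrite -EFinM lee_fin.
    apply: (@le_trans _ _ (expR (gam * (n%:R * T)) * (K * eta ^+ n))).
      rewrite ler_wpM2l ?expR_ge0// /K mulrDl; apply: lerD.
        rewrite -[leRHS]mulrA ler_wpM2l//.
        rewrite [leLHS](_ : _ = expR (mm * (m%:R * T)) * expR (- (mm * T)) ^+ n).
          rewrite ler_wpM2l ?expR_ge0//.
          by rewrite lerXn2r ?nnegrE ?expR_ge0 ?(ltW eta0)// le_max lexx.
        rewrite -expRM_natl -expRD; congr expR; ring.
      by rewrite ler_wpM2l// lerXn2r ?nnegrE ?(ltW eta0)// le_max lexx orbT.
    rewrite mulrCA etaE ler_wpM2l// -expRD -expRM_natl le_eqVlt.
    by apply/orP; left; apply/eqP; congr expR; ring.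
  + exact: measurableT.
  + exact: mV.
  + by move=> w _; exact: V0.
  + by rewrite lee_fin expR_ge0.
move=> B [mB B0 sB]; exists B; split => // w /= nC; apply: sB => /= -[C C0 gC].
apply: nC; exists C => // n mn.
have := gC n; rewrite /g mn => H.
have -> : volterra (a w) c N (- (n%:R * T)) n (- (m%:R * T)) =
    ((expR (- (gam * (n%:R * T))))%:E * ((expR (gam * (n%:R * T)))%:E *
     volterra (a w) c N (- (n%:R * T)) n (- (m%:R * T))))%E.
  by rewrite muleA -EFinM -expRD addNr expR0 mul1e.
by rewrite [C * _]mulrC EFinM; apply: lee_wpmul2l => //; rewrite lee_fin expR_ge0.
Qed.
End wiener_kernel.

(** * The random periodic solution *)

Section periodic_flow.
Context {R : realType} {d : nat}.
Local Notation mu := (@lebesgue_measure R).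
Variable P0 : probability (wborel R d) R.
Hypothesis hP0 : wiener_measure P0.
Variable Om : set (wpath R d).
Hypothesis hOm : universal_set P0 Om.
Variables (A : 'M[R]_d) (sigma : 'I_d -> 'M[R]_d) (T : R).
Hypothesis hT : 0 < T.
Variable h : R -> 'cV[R]_d -> 'cV[R]_d.
Hypothesis hC : Cb1_map h.
Hypothesis hper : forall t x, orthant x -> h (t + T) x = h t x.
Variable Phi : R -> wpath R d -> 'M[R]_d.
Hypothesis hPhi : fundamental_matrix P0 Om A sigma Phi.
Hypothesis hcocycle : linear_cocycle Om Phi.
Variable phi : R -> R -> wpath R d -> 'cV[R]_d -> 'cV[R]_d.
Hypothesis hphi : generated_flow P0 Om A sigma h Phi phi.
Variables (lam : R) (Rp : R -> wpath R d -> R).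
Hypothesis hL : cond_L P0 Om Phi lam Rp.
Local Notation P := (wprob P0).
Local Notation Psi := (transition Om Phi).
Let N := `|hbound h|.
Let ell := hlip h * d%:R.

Let N0 : 0 <= N. Proof. exact: normr_ge0. Qed.

Let orth0 := @orthant0 R d.

Lemma hbound_orthant : orthant (hbound h).
Proof.
move=> i; have [/(_ 0 0 orth0)[/(_ i) h0 _] _ _ _] := hC.
by apply: le_trans h0 _; have := le_hbound hC 0 orth0 i; rewrite !mxE subr_ge0.
Qed.

Lemma le_hbound_norm (y : 'cV[R]_d) : orthant y -> lev y (hbound h) -> `|y| <= N.
Proof.
move=> oy yb; apply: mx_norm_leP => // i j; rewrite ord1 ger0_norm//.
apply: (@le_trans _ _ (hbound h i 0)); first by have := yb i; rewrite !mxE subr_ge0.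
by apply: le_trans (ler_norm _) _; exact: mx_entry_norm_le.
Qed.

Lemma Cb1_bounded_field : bounded_field h N ell.
Proof.
have [ho hb _ _] := hC; split.
- by move=> t x ox; have [] := ho t x ox.
- move=> t x ox; apply: le_hbound_norm; last exact: le_hbound.
  by have [] := ho t x ox.
- by move=> t x y ox oy; exact: Cb1_lip.
- by move=> i; have [] := hb i.
- by [].
- by rewrite mulr_ge0// hlip_ge0.
Qed.

Let fh := Cb1_bounded_field.

(** The double supremum of (L), finite for each [gam], is the constant of temperedness. *)
Lemma transition_stable w : Om w -> stable_kernel (Psi w) lam.
Proof.
have [lam0 _ Rpos Rsup PhiR] := hL.
have OmS t w' : Om w' -> Om (wshift t w') by case: hOm => _; exact.
move=> Ow; split.
- exact: lam0.
- by move=> t r s sr rt; exact: (transition_comp hOm hcocycle).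
- by move=> t s st; exact: (transition_unit hOm hPhi).
- move=> s i j.
  have /continuous_measurable_fun := @transition_continuous _ _ _ _ hOm _ _ _ hPhi w s i j.
  move=> /(measurable_funTS (D := `[s, +oo[%classic)).
  by apply: eq_measurable_fun => t; rewrite inE/= in_itv/= andbT => st; rewrite max_r.
move=> gam g0; have := Rsup gam w g0 Ow; set M := ereal_sup _ => Moo.
have le_sup t s : 0 <= s -> ((expR (- (gam * `|t|)) * Rp s (wshift t w))%:E <= M)%E.
  move=> s0; apply: (@le_trans _ _ ((expR (- (gam * `|t|)))%:E *
      ereal_sup [set (Rp s (wshift t w))%:E | s in `[0%R, +oo[])%E); last first.
    by apply: ereal_sup_ubound; exists t.
  rewrite EFinM; apply: lee_wpmul2l; first by rewrite lee_fin expR_ge0.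
  by apply: ereal_sup_ubound; exists s => //; rewrite /= in_itv/= s0.
have M0 : (0 <= M)%E.
  apply: le_trans (le_sup 0 0 (lexx 0)); rewrite lee_fin mulr_ge0 ?expR_ge0//.
  by apply/ltW/Rpos => //; exact: OmS.
have fM : M \is a fin_num by rewrite ge0_fin_numE.
exists (fine M) => [|t r rt]; first exact: fine_ge0.
have tr0 : 0 <= t - r by rewrite subr_ge0.
rewrite transition_Om//; apply: le_trans (PhiR _ _ tr0 (OmS r _ Ow)) _.
rewrite ler_wpM2r ?expR_ge0//.
have := le_sup r _ tr0; rewrite -(fineK fM) lee_fin expRN mulrC.
by rewrite ler_pdivrMr ?expR_gt0.
Qed.

Lemma flow_within_continuous s x w : Om w -> orthant x ->
  {within `[s, +oo[%classic, continuous (fun t => phi t s w x)}.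
Proof. by move=> Ow ox; have [_ /(_ s x ox)[_ + _] _ _ _] := hphi; exact. Qed.

Lemma flow_max_continuous s x w i : Om w -> orthant x ->
  continuous (fun t : R => phi (Num.max s t) s w x i 0).
Proof.
move=> Ow ox t.
have ct := within_continuous_max (@flow_within_continuous s x w Ow ox) (x := t).
exact: (cvg_comp _ _ ct (@coord_continuous R d 1 i 0 (phi (Num.max s t) s w x))).
Qed.

Lemma flow_duhamel s x w : Om w -> orthant x -> duhamel (Psi w) h s (fun t => phi t s w x).
Proof.
have [po _ pid _ pE] := hphi; move=> Ow ox; split.
- by move=> t st; exact: po.
- move=> i; have /continuous_measurable_fun := @flow_max_continuous s x w i Ow ox.
  move=> /(measurable_funTS (D := `[s, +oo[%classic)).
  by apply: eq_measurable_fun => t; rewrite inE/= in_itv/= andbT => st; rewrite max_r.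
- move=> t st; rewrite pE// pid// transition_Om//; congr (_ + vintegral _ _).
  by apply/funext => r; rewrite transition_Om.
Qed.

(* The flow started at [c e_j] stays nonnegative and differs from [c] times the
   [j]-th column of the kernel by a term bounded uniformly in [c]. *)
Lemma transition_ge0 w t s i j : Om w -> s <= t -> 0 <= Psi w t s i j.
Proof.
move=> Ow st; have kPsi := transition_stable Ow; have lam0 := stable_rate kPsi.
have l2 : 0 < lam / 2 by rewrite divr_gt0.
have l2l : lam / 2 < lam by lra.
have [C C0 PC] := vintegral_Psi_le kPsi l2 l2l.
pose B := C * N * expR (lam / 2 * `|t|).
have B0 : 0 <= B by rewrite !mulr_ge0// expR_ge0.
have main c : 0 <= c -> 0 <= c * Psi w t s i j + B.
  move=> c0; pose x : 'cV[R]_d := c *: delta_mx j 0.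
  have ox : orthant x by move=> k; rewrite !mxE mulr_ge0.
  have dx := flow_duhamel s Ow ox; have [oy my E] := dx.
  have [_ _ pid _ _] := hphi.
  apply: le_trans (oy t st i) _; rewrite (E t st) pid// mxE; apply: lerD.
    by rewrite -scalemxAr mxE -colE mxE.
  apply: le_trans (ler_norm _) _; apply: le_trans (mx_entry_norm_le _ _ _) _.
  apply: PC => //.
  - exact: subset_itvr.
  - exact: duhamel_measurable_field fh _ _ _ dx.
  - by move=> r; rewrite /= in_itv/= => /andP[sr _]; apply: field_bound fh _ _ (oy _ sr).
rewrite leNgt; apply/negP => neg.
have n0 : 0 < - Psi w t s i j by rewrite oppr_gt0.
have := main ((B + 1) / - Psi w t s i j) (divr_ge0 (addr_ge0 B0 ler01) (ltW n0)).
rewrite (_ : _ * Psi w t s i j = - (B + 1)); first by lra.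
by field; rewrite lt_eqF.
Qed.

(** Since [h] is periodic, both sides satisfy the same variation of constants formula along
    [wshift T w] and agree at time [s]; Gronwall makes them equal. *)
Lemma flow_wshift t s w x : Om w -> s <= t -> orthant x ->
  phi (t + T) (s + T) w x = phi t s (wshift T w) x.
Proof.
move=> Ow st ox; have OTw : Om (wshift T w) by case: hOm => _; exact.
have kPsi := transition_stable OTw; have [_ _ pid _ _] := hphi.
suff d1 : duhamel (Psi (wshift T w)) h s (fun t => phi (t + T) (s + T) w x).
  have [K K0 PK] := duhamel_gronwall kPsi fh st.
  have := PK _ _ d1 (flow_duhamel s OTw ox).
  by rewrite !pid// subrr normr0 mulr0 normr_le0 subr_eq0 => /eqP.
have dw := flow_duhamel (s + T) Ow ox; have [oy my E] := dw; split.
- by move=> r sr; apply: oy; rewrite lerD2r.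
- move=> i; apply: (measurable_comp _ _ (my i)) => //.
  + by move=> _ [r + <-]; rewrite /= !in_itv/= !andbT lerD2r.
  + by apply: measurable_funTS; apply: measurable_funD.
move=> t' st'; rewrite (E (t' + T)) ?lerD2r//; congr (_ + _).
  by rewrite (transition_wshift hOm) addrC [s + T]addrC.
apply/matrixP => i j; rewrite !mxE -(@Rintegral_shift _ T).
- have -> : (+%R^~ T @^-1` `[s + T, t' + T]) = `[s, t']%classic.
    by apply/seteqP; split => r; rewrite /= !in_itv/= !lerD2r.
  apply: eq_Rintegral => r; rewrite inE/= in_itv/= => /andP[sr rt].
  rewrite hper; last by apply: oy; rewrite lerD2r.
  by rewrite (transition_wshift hOm) addrC [T + r]addrC.
- exact: measurable_itv.
- have st2 : s + T <= t' + T by rewrite lerD2r.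
  have /measurable_int := duhamel_integrable (transition_stable Ow) fh st2 dw i.
  by move=> /measurable_EFinP.
Qed.

Let ae_wprob : Filter (almost_everywhere P).
Proof. exact: (@ae_filter_ringOfSetsType _ (wspace P0) R P). Qed.
#[local] Existing Instance ae_wprob.

Hypothesis hR : cond_R P0 Rp.
Hypothesis hH1 : cond_H1 P0 h lam Rp.

Lemma small_gain : fine (sup_mean P0 Rp) * (ell * d%:R) < lam.
Proof.
have [lam0 _ _ _ _] := hL; have [_ oo] := hR.
(* In this degenerate case the gain is 0 and the claim reduces to [0 < lam]. *)
have [E0|E0] := eqVneq (hlip h * d%:R ^+ 2) 0.
  by rewrite /ell -mulrA -expr2 E0 mulr0.
have E1 : 0 < hlip h * d%:R ^+ 2.
  by rewrite lt_neqAle eq_sym E0 mulr_ge0 ?hlip_ge0// exprn_ge0.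
have := hH1; rewrite /cond_H1 inver (negbTE E0).
have Rb0 := Rbar_ge0 hOm hL hR.
case Es : (sup_mean P0 Rp) Rb0 => [r| |] //=.
  by move=> _; rewrite -EFinM lte_fin ltr_pdivlMr// /ell -mulrA -expr2.
by rewrite mul0r.
Qed.

Lemma flow_pullback : exists2 gam : R, 0 < gam /\ gam / 2 < lam &
  {ae P, forall w, Om w ->
    (exists X : R -> 'cV[R]_d, forall t x, orthant x ->
      (fun n => phi t (- (n%:R * T)) w x) @ \oo --> X t) /\
    (forall (X y : R -> 'cV[R]_d) (C : R),
      (forall t, (fun n => phi t (- (n%:R * T)) w 0) @ \oo --> X t) ->
      (forall s, duhamel (Psi w) h s y) -> 0 <= C ->
      (forall t, `|y t| <= C * expR (gam / 2 * `|t|)) -> forall t, X t = y t)}.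
Proof.
have c0 : 0 <= ell * d%:R by rewrite !mulr_ge0// hlip_ge0.
have N20 : 0 <= N *+ 2 by rewrite mulrn_wge0.
have [gam [g0 gl H]] :=
  volterra_ae_decay hP0 hOm hPhi hcocycle hL hR c0 N20 hT small_gain.
exists gam => //; apply: filterS H => w Vw Ow.
have kPsi := transition_stable Ow; have [_ _ pid pflow _] := hphi.
have mV (s : R) k := @volterra_section _ _ _ hP0 _ hOm _ _ _ hPhi hcocycle _ _ s k w c0 N20.
split.
- apply: (pullback_limit (f := fun t s => phi t s w) kPsi fh mV _ _ _ hT g0 gl Vw) => [s x ox|s x ox|t r s x sr rt ox].
  + exact: flow_duhamel.
  + exact: pid.
  + exact: pflow.
- move=> X y C fX dy C0 yC.
  apply: (@pullback_limit_unique _ _ _ _ kPsi _ _ _ fh mV (fun t s => phi t s w) _ _ _ _ _ hT g0 Vw X y C fX dy C0 yC).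
  + by move=> s x ox; exact: flow_duhamel.
  + by move=> s x ox; exact: pid.
  + by move=> t r s x sr rt ox; exact: pflow.
Qed.

(** * The pull-back limit and the fixed point built from it *)

Definition pullback (t : R) (w : wpath R d) : 'cV[R]_d :=
  lim ((fun n : nat => phi t (- (n%:R * T)) w 0) @ \oo).

(** Convergence itself, rather than an estimate implying it, defines this set of full measure.
    Within [Om] the set is then exactly invariant under [wshift T], as [Mspace] needs periodicity
    for every path of [Om]. *)
Definition pullback_set : set (wpath R d) :=
  [set w | Om w /\ forall t, cvg ((fun n : nat => phi t (- (n%:R * T)) w 0) @ \oo)].

Lemma pullback_cvg t w : pullback_set w ->
  (fun n => phi t (- (n%:R * T)) w 0) @ \oo --> pullback t w.
Proof. by move=> [_]; exact. Qed.

Lemma pullback_set_ae : {ae P, forall w, pullback_set w}.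
Proof.
have [gam _ H] := flow_pullback.
have OmP : {ae P, forall w, Om w} by case: hOm.
apply: filterS2 H OmP => w H Ow; split=> // t; have [[X XP] _] := H Ow.
by apply/cvg_ex; exists (X t); exact: XP.
Qed.

Lemma near_start (t : R) : \forall n \near \oo, - (n%:R * T) <= t.
Proof.
exists (Num.truncn (`|t| / T)).+1 => // n /= tn; rewrite lerNl.
apply: (@le_trans _ _ `|t|); first by rewrite -normrN ler_norm.
rewrite -ler_pdivrMr//; apply: (@le_trans _ _ (Num.truncn (`|t| / T)).+1%:R).
  by rewrite ltW// truncnS_gt.
by rewrite ler_nat.
Qed.

(** Shifting the path by a period turns the start [- (n + 1) T] into [- n T], so the two sequences
    differ by a shift of the index. *)
Lemma pullback_wshift_cvg t w (l : 'cV[R]_d) : Om w ->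
  (fun n => phi t (- (n%:R * T)) (wshift T w) 0) @ \oo --> l <->
  (fun n => phi (t + T) (- (n%:R * T)) w 0) @ \oo --> l.
Proof.
move=> Ow; have E : \forall n \near \oo,
    phi t (- (n.+1%:R * T)) (wshift T w) 0 = phi (t + T) (- (n%:R * T)) w 0.
  have := near_start (t + T); apply: filterS => n nt.
  rewrite -flow_wshift//; last by rewrite -natr1 mulrDl mul1r; lra.
  by congr (phi _ _ _ _); rewrite -natr1; ring.
split=> H.
  have : (fun n => phi t (- (n.+1%:R * T)) (wshift T w) 0) @ \oo --> l.
    by rewrite (cvg_shiftS (fun n => phi t (- (n%:R * T)) (wshift T w) 0)).
  by apply: cvg_trans; apply: near_eq_cvg; apply: filterS E => n /= ->.
rewrite -cvg_shiftS; apply: cvg_trans H; apply: near_eq_cvg.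
by apply: filterS E => n /= ->.
Qed.

Lemma pullback_set_wshift w : Om w -> pullback_set (wshift T w) <-> pullback_set w.
Proof.
move=> Ow; have OTw : Om (wshift T w) by case: hOm => _; exact.
split=> -[_ H].
  split=> [|t]; first exact: Ow.
  apply/cvg_ex; have /cvg_ex[l lP] := H (t - T); exists l.
  by have := (pullback_wshift_cvg (t - T) l Ow).1 lP; rewrite subrK.
split=> [|t]; first exact: OTw.
apply/cvg_ex; have /cvg_ex[l lP] := H (t + T); exists l.
exact/pullback_wshift_cvg.
Qed.

Lemma pullback_wshift t w : pullback_set w -> pullback t (wshift T w) = pullback (t + T) w.
Proof.
move=> Gw; have [Ow _] := Gw; apply: (cvg_lim (@norm_hausdorff _ _)).
by apply/pullback_wshift_cvg => //; exact: pullback_cvg.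
Qed.

Lemma pullback_fixed w : pullback_set w -> (forall t, orthant (pullback t w)) /\
  forall t, pullback t w = potential (Psi w) (fun r => h r (pullback r w)) t.
Proof.
move=> Gw; have [Ow _] := Gw; have [_ _ pid _ _] := hphi.
apply: (duhamel_limit (transition_stable Ow) fh (s := fun n => - (n%:R * T))
  (y := fun n t => phi t (- (n%:R * T)) w 0)).
- by move=> n; exact: flow_duhamel.
- by move=> n; exact: pid.
- exact: near_start.
- by move=> t; exact: pullback_cvg.
Qed.

(** The flow property of the approximants passes to the limit by Gronwall's continuity in the
    initial value. *)
Lemma pullback_flow t s w : pullback_set w -> s <= t ->
  phi t s w (pullback s w) = pullback t w.
Proof.
move=> Gw st; have [Ow _] := Gw; have [oX _] := pullback_fixed Gw.
have [po _ pid pflow _] := hphi.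
have [K K0 PK] := duhamel_gronwall (transition_stable Ow) fh st.
suff H : (fun n => phi t (- (n%:R * T)) w 0) @ \oo --> phi t s w (pullback s w).
  by rewrite /pullback -[LHS](cvg_lim (@norm_hausdorff _ _) H).
apply/cvgrPdist_le => e e0.
have K1 : 0 < K + 1 by rewrite ltr_wpDl.
have e1 : 0 < e / (K + 1) by rewrite divr_gt0.
have /cvgrPdist_le/(_ _ e1) := @pullback_cvg s w Gw.
apply: filterS2 (near_start s) => n ns nl; rewrite (pflow _ _ _ _ _ ns st Ow orth0).
have os := po _ _ _ _ ns Ow orth0.
apply: le_trans (PK _ _ (flow_duhamel s Ow (oX s)) (flow_duhamel s Ow os)) _.
rewrite !pid//; apply: (@le_trans _ _ ((K + 1) * (e / (K + 1)))).
  by rewrite ler_pM// lerDl.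
by rewrite mulrC divfK// gt_eqF.
Qed.

(** The default 0 lies in the box of [Mspace] and makes [Kop] vanish, so the fixed point and its
    potential remain admissible off the convergence set. *)
Definition periodic_input (t : R) (w : wpath R d) : 'cV[R]_d :=
  if w \in pullback_set then h t (pullback t w) else 0.

Lemma KopE v w t : Om w -> Kop Phi v t w = potential (Psi w) (fun r => v r w) t.
Proof.
move=> Ow; congr (vintegral _ _); apply/funext => r.
by rewrite transition_Om.
Qed.

Lemma Kop_periodic_input t w : Om w -> Kop Phi periodic_input t w =
  if w \in pullback_set then pullback t w else 0.
Proof.
move=> Ow; rewrite KopE// /periodic_input; case: ifPn => [/set_mem Gw|_].
  by have [_ <-] := pullback_fixed Gw.
apply/matrixP => i j; rewrite !mxE; under eq_Rintegral do rewrite mulmx0 mxE.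
by rewrite /Rintegral integral0.
Qed.

(** The approximants of [pullback], frozen at their initial value 0 before the start and set to 0
    off [Om]: continuous at all times on every path, as needed for joint measurability. *)
Definition null_flow (n : nat) (t : R) (w : wpath R d) : 'cV[R]_d :=
  if w \in Om then phi (Num.max (- (n%:R * T)) t) (- (n%:R * T)) w 0 else 0.

Lemma null_flow_adapted n t i :
  Fst_measurable P0 (- (n%:R * T)) (Num.max (- (n%:R * T)) t)
    (fun w => null_flow n t w i 0).
Proof.
set s := - (n%:R * T); set t' := Num.max s t.
have st : s <= t' by rewrite le_max lexx.
have [_ /(_ s 0 orth0)[aP _ _] _ _ _] := hphi.
have mOm : @measurable _ (g_sigma_algebraType (Fgen P0 s t')) Om by exact: Om_Fst.
rewrite /Fst_measurable -(setUv Om); apply/measurable_funU => //.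
  exact: measurableC.
split.
  have : @measurable_fun _ _ (g_sigma_algebraType (Fgen P0 s t')) R Om
    (fun w => phi t' s w 0 i 0) by apply: measurable_funTS; exact: aP.
  by apply: eq_measurable_fun => w Ow; rewrite /null_flow Ow.
have := @measurable_cst _ _ (g_sigma_algebraType (Fgen P0 s t')) _ (~` Om) (0 : R).
by apply: eq_measurable_fun => w; rewrite in_setC /null_flow => /negbTE ->; rewrite mxE.
Qed.

Lemma null_flow_continuous n w i : continuous (fun t : R => null_flow n t w i 0).
Proof.
rewrite /null_flow; case: (boolP (w \in Om)) => [/set_mem Ow|_] t; last exact: cvg_cst.
exact: flow_max_continuous.
Qed.

Section joint_measurability.
Context {dT : measure_display} {TT : measurableType dT}.
Variables (proj : TT -> wpath R d) (clamp : R -> R) (D : set R).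
Hypothesis clamp_cont : continuous clamp.
Hypothesis clamp_id : forall t, D t -> clamp t = t.
Hypothesis mnull : forall n t i,
  measurable_fun setT (fun x => null_flow n (clamp t) (proj x) i 0).
Hypothesis mD : measurable D.
Hypothesis mG : measurable (proj @^-1` pullback_set).

(** The space [TT] is abstract because it is used both with the past sigma-algebra and times
    truncated at [t], for progressive measurability, and with the completed space and all times. *)
Lemma pullback_joint i :
  measurable_fun (D `*` (proj @^-1` pullback_set))
    (fun p : measurableTypeR R * TT => pullback p.1 (proj p.2) i 0).
Proof.
apply: (@measurable_fun_cvg _ _ _ _
  (fun n (p : measurableTypeR R * TT) => null_flow n (clamp p.1) (proj p.2) i 0)).
  move=> n; apply: measurable_funTS.
  apply: (@measurable_fun_caratheodory _ _ _ (fun r x => null_flow n (clamp r) (proj x) i 0)).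
    move=> x t; apply: (@continuous_comp _ _ _ clamp (fun u => null_flow n u (proj x) i 0)).
      exact: clamp_cont.
    exact: null_flow_continuous.
  by move=> t; exact: mnull.
move=> [t x] [/= Dt Gx]; have [Ox _] := Gx.
have := cvg_mx_entry (i := i) (j := 0) (@pullback_cvg t _ Gx).
apply: cvg_trans; apply: near_eq_cvg; have := near_start t; apply: filterS => n nt /=.
by rewrite /null_flow mem_set// clamp_id// max_r.
Qed.

Lemma periodic_input_joint i (E : set TT) : measurable E ->
  measurable_fun (D `*` E)
    (fun p : measurableTypeR R * TT => periodic_input p.1 (proj p.2) i 0).
Proof.
move=> mE; pose G := proj @^-1` pullback_set.
have mDG : measurable (D `*` (E `&` G)) by apply: measurableX => //; exact: measurableI.
have mDC : measurable (D `*` (E `\` G)) by apply: measurableX => //; exact: measurableD.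
rewrite (_ : D `*` E = (D `*` (E `&` G)) `|` (D `*` (E `\` G))); last first.
  apply/seteqP; split => [[t x] [/= Dt Ex]|[t x] [[/= Dt []]|[/= Dt []]]] //.
  by have [Gx|nGx] := pselect (G x); [left|right].
apply/measurable_funU => //; split.
  have : measurable_fun (D `*` (E `&` G)) (fun p : measurableTypeR R * TT =>
      h p.1 (pullback p.1 (proj p.2)) i 0).
    apply: (measurable_fun_comp_orthant (g := fun r x => h r x i 0)
      (r := fun p : measurableTypeR R * TT => p.1)).
    - exact: field_continuous fh i.
    - by apply: measurable_funTS; exact: measurable_fst.
    - move=> j; have := pullback_joint j; apply: measurable_funS.
        exact: measurableX.
      by move=> [t x] [/= Dt []].
    - by move=> [t x] [/= _ [_ Gx]]; have [] := pullback_fixed Gx.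
  apply: eq_measurable_fun => -[t x] /set_mem[/= _ [_ Gx]].
  by rewrite /periodic_input mem_set.
have := @measurable_cst _ _ (measurableTypeR R * TT)%type _ (D `*` (E `\` G)) (0 : R).
apply: eq_measurable_fun => -[t x] /set_mem[/= _ [_ nG]].
by rewrite /periodic_input memNset// mxE.
Qed.

End joint_measurability.

Lemma pullback_setC_negligible : P.-negligible (~` pullback_set).
Proof. exact: pullback_set_ae. Qed.

Lemma Fpast_of_Fst s t B : s <= t -> <<s Fgen P0 s t >> B -> <<s Fpast_gen P0 t >> B.
Proof. by move=> st mB; apply: sub_sigma_algebra; exists s. Qed.

Lemma Fpast_negligible t B : P.-negligible (~` B) -> <<s Fpast_gen P0 t >> B.
Proof.
move=> nB; apply: (Fpast_of_Fst (lexx t)).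
rewrite -[B]setCK; apply: (@measurableC _ (g_sigma_algebraType (Fgen P0 t t))).
by apply: sub_sigma_algebra; right.
Qed.

Lemma Fpast_wspace t : <<s Fpast_gen P0 t >> `<=` @measurable _ (wspace P0).
Proof.
apply: smallest_sub; first exact: sigma_algebra_measurable.
by move=> B [s _]; exact: Fgen_wspace.
Qed.

Lemma null_flow_past n t r i :
  @measurable_fun _ _ (g_sigma_algebraType (Fpast_gen P0 t)) R setT
    (fun w => null_flow n (Num.min r t) w i 0).
Proof.
(* If the start comes after [t], the truncated time never passes it and the approximant is still 0;
   otherwise only increments before [t] enter. *)
have [nt|tn] := leP (- (n%:R * T)) t; last first.
  have E0 w : null_flow n (Num.min r t) w i 0 = 0.
    rewrite /null_flow; case: ifPn => [/set_mem Ow|_]; last by rewrite mxE.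
    rewrite max_l; last by rewrite ge_min (ltW tn) orbT.
    by have [_ _ -> // _ _] := hphi; rewrite mxE.
  by under eq_fun do rewrite E0; exact: measurable_cst.
move=> _ B mB; apply: (Fpast_of_Fst nt).
have le : Num.max (- (n%:R * T)) (Num.min r t) <= t by rewrite ge_max nt ge_min lexx orbT.
exact: (Fgen_mono (lexx _) le (@null_flow_adapted n (Num.min r t) i measurableT B mB)).
Qed.

Lemma periodic_input_Mspace : Mspace P0 Om h T periodic_input.
Proof.
split.
- move=> t w Ow; rewrite /periodic_input; case: ifPn => [/set_mem Gw|_].
    have [oX _] := pullback_fixed Gw; split; last exact: le_hbound.
    exact: (field_orthant fh).
  by split=> //; rewrite /lev subr0; exact: hbound_orthant.
- move=> t i; have mOm : <<s Fpast_gen P0 t >> Om by apply: Fpast_negligible; case: hOm.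
  apply: (@periodic_input_joint _ (g_sigma_algebraType (Fpast_gen P0 t)) id
    (fun r => Num.min r t) [set r | r <= t]).
  + by move=> x; apply: (@continuous_min R R id (fun=> t)); [exact: cvg_id|exact: cvg_cst].
  + by move=> r rt; rewrite min_l.
  + by move=> n r j; exact: null_flow_past.
  + by rewrite -set_itvNyc; exact: measurable_itv.
  + exact: Fpast_negligible pullback_setC_negligible.
  + exact: mOm.
- move=> t w Ow; rewrite /periodic_input.
  have -> : (wshift T w \in pullback_set) = (w \in pullback_set).
    by apply/idP/idP => /set_mem H; apply/mem_set; exact/pullback_set_wshift.
  case: ifPn => // /set_mem Gw; have [oX _] := pullback_fixed Gw.
  by rewrite pullback_wshift// hper.
Qed.

Lemma periodic_input_fixed : fixed_point P0 (gain h Phi) periodic_input.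
Proof.
move=> t; apply: filterS pullback_set_ae => w Gw; have [Ow _] := Gw.
by rewrite /gain Kop_periodic_input// /periodic_input mem_set.
Qed.

Lemma Kop_pullback_cvg t : {ae P, forall w, forall x, orthant x ->
  (fun n : nat => phi t (- (n%:R * T)) w x) @ \oo --> Kop Phi periodic_input t w}.
Proof.
have [gam _ H] := flow_pullback.
apply: filterS2 H pullback_set_ae => w H Gw x ox; have [Ow _] := Gw.
have [[X XP] _] := H Ow; rewrite Kop_periodic_input// mem_set//.
rewrite (_ : pullback t w = X t); first exact: XP.
by apply: (cvg_lim (@norm_hausdorff _ _)); exact: XP.
Qed.

Lemma Kop_random_periodic :
  random_periodic_solution P0 Om T phi (Kop Phi periodic_input).
Proof.
have mOm := Om_wspace hOm.
have mG : @measurable _ (wspace P0) pullback_set.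
  apply: (@Fpast_wspace 0 pullback_set).
  exact: (Fpast_negligible pullback_setC_negligible).
split.
- move=> i; have mG' : measurable ((setT : set (measurableTypeR R)) `*` (pullback_set : set (wspace P0))).
    by apply: measurableX.
  have mC : measurable ((setT : set (measurableTypeR R)) `*` (Om `\` pullback_set : set (wspace P0))).
    by apply: measurableX => //; exact: measurableD.
  rewrite (_ : setT `*` Om = (setT `*` pullback_set) `|` (setT `*` (Om `\` pullback_set)));
    last first.
    apply/seteqP; split => [[t w] [/= _ Ow]|[t w] [[/= _ [Ow _]]|[/= _ []]]] //.
    by have [Gw|nGw] := pselect (pullback_set w); [left|right].
  apply/measurable_funU => //; split.
    have := @pullback_joint _ (wspace P0) id id setT (fun x => cvg_id) (fun _ _ => erefl)
      (fun n t j => Fst_measurable_wspace (@null_flow_adapted n t j)) i.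
    apply: eq_measurable_fun => -[t w] /set_mem[/= _ Gw]; have [Ow _] := Gw.
    by rewrite Kop_periodic_input// mem_set.
  have := @measurable_cst _ _ (measurableTypeR R * wspace P0)%type _
    (setT `*` (Om `\` pullback_set)) (0 : R).
  apply: eq_measurable_fun => -[t w] /set_mem[/= _ [Ow nG]].
  by rewrite Kop_periodic_input// memNset// mxE.
- move=> t w Ow; rewrite Kop_periodic_input//; case: ifPn => // /set_mem Gw.
  by have [] := pullback_fixed Gw.
- apply: filterS pullback_set_ae => w Gw; have [Ow _] := Gw; split=> [t s st|r].
    by rewrite !Kop_periodic_input// mem_set// pullback_flow.
  have OTw : Om (wshift T w) by case: hOm => _; exact.
  have GTw := (pullback_set_wshift Ow).2 Gw.
  rewrite (Kop_periodic_input _ Ow) (Kop_periodic_input _ OTw).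
  by rewrite (mem_set Gw) (mem_set GTw) pullback_wshift.
Qed.

(** * Uniqueness of the fixed point *)

Section uniqueness.
Variable v : R -> wpath R d -> 'cV[R]_d.
Hypothesis hv : Mspace P0 Om h T v.

Let OmRP : @measurable _ (measurableTypeR R * wspace P0)%type (setT `*` Om).
Proof. by apply: measurableX => //; exact: Om_wspace hOm. Qed.

Lemma progressive_joint i : @measurable_fun _ _ (measurableTypeR R * wspace P0)%type R (setT `*` Om)
  (fun p : measurableTypeR R * wspace P0 => v p.1 p.2 i 0).
Proof.
have [_ pv _] := hv.
have E : (setT `*` Om : set (R * wpath R d)) =
    \bigcup_(k in [set: nat]) ([set r : R | r <= k%:R] `*` Om).
  apply/seteqP; split=> [[r w] [/= _ Ow]|[r w] [k _ [/= _ Ow]]]; last by split.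
  exists (Num.truncn `|r|).+1 => //; split=> //=.
  by rewrite (le_trans (ler_norm r))// ltW// truncnS_gt.
have mD (k : nat) : @measurable _ (measurableTypeR R) [set r : R | r <= k%:R].
  by rewrite -set_itvNyc; exact: measurable_itv.
rewrite E; apply/measurable_fun_bigcup => k.
  by apply: measurableX; [exact: mD|exact: Om_wspace hOm].
have mid : @measurable_fun _ _ (measurableTypeR R * wspace P0)%type
    (measurableTypeR R * g_sigma_algebraType (Fpast_gen P0 k%:R))%type ([set r : R | r <= k%:R] `*` Om)
    (fun p : measurableTypeR R * wspace P0 =>
       (p.1, p.2 : g_sigma_algebraType (Fpast_gen P0 k%:R))).
  apply: measurable_funTS; apply: measurable_fun_pair; first exact: measurable_fst.
  have mI : @measurable_fun _ _ (wspace P0) (g_sigma_algebraType (Fpast_gen P0 k%:R)) setT id.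
    by move=> _ B mB; rewrite setTI; exact: (@Fpast_wspace k%:R B mB).
  exact: (measurableT_comp mI measurable_snd).
apply: (measurable_comp _ _ (pv k%:R i) mid).
- apply: measurableX; first exact: mD.
  by apply: Fpast_negligible; case: hOm.
- by move=> _ [p Dp <-].
Qed.

Let v0 (w : wpath R d) (r : R) : 'cV[R]_d := if w \in Om then v r w else 0.

Let v0_orthant w r : orthant (v0 w r).
Proof.
rewrite /v0; case: ifPn => [/set_mem Ow|_]; last exact: orth0.
by have [vb _ _] := hv; have [] := vb r w Ow.
Qed.

Let v0_joint i : measurable_fun setT
  (fun p : measurableTypeR R * wspace P0 => v0 p.2 p.1 i 0).
Proof.
have /(measurable_restrictT _ OmRP).1 := progressive_joint i.
apply: eq_measurable_fun => -[r w] _; rewrite patchE /v0/=.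
have -> : ((r, w) \in setT `*` Om) = (w \in Om).
  by apply/idP/idP => /set_mem H; apply/mem_set => //; case: H.
by case: ifP => // _; rewrite mxE.
Qed.

Let kernel_integrand i (q : measurableTypeR R * wspace P0 * measurableTypeR R) : R :=
  if q.2 <= q.1.1 then (Psi q.1.2 q.1.1 q.2 *m v0 q.1.2 q.2) i 0 else 0.

Let kernel_integrand_ge0 i q : 0 <= kernel_integrand i q.
Proof.
rewrite /kernel_integrand; case: ifPn => // rt.
have [Ow|nOw] := boolP (q.1.2 \in Om); last first.
  by rewrite /v0 (negbTE nOw) mulmx0 mxE.
rewrite mxE sumr_ge0// => j _; rewrite mulr_ge0//; last exact: v0_orthant.
by apply: transition_ge0 => //; exact: set_mem.
Qed.

(** The kernel is jointly measurable from a fixed origin only. The origins [- n] are used with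
    truncation below [- n]; at each point the sequence is eventually constant. *)
Let kernel_integrand_measurable i : measurable_fun setT (kernel_integrand i).
Proof.
pose g (n : nat) (q : measurableTypeR R * wspace P0 * measurableTypeR R) : R :=
  if (- n%:R <= q.2) && (q.2 <= q.1.1) then
    (@transition_between _ _ Om Phi _ (wspace P0) id (- n%:R) (Num.max (- n%:R)) q
       *m v0 q.1.2 q.2) i 0 else 0.
have m2 : measurable_fun setT
    ((fun q => q.2) : measurableTypeR R * wspace P0 * measurableTypeR R -> R).
  exact: measurable_snd.
apply: (@measurable_fun_cvg _ _ _ _ g).
  move=> n; apply: measurable_fun_ifT.
  - apply: measurable_and; first exact: (measurable_fun_ler (measurable_cst _)).
    apply: (measurable_fun_ler m2).
    exact: (measurableT_comp measurable_fst measurable_fst).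
  - apply: measurable_fun_mulmx => k l.
      apply: (@transition_between_measurable _ _ _ _ hOm _ _ _ hPhi _ (wspace P0) id).
      + exact: max_clamp_cont.
      + by move=> t; rewrite le_max lexx.
      + by move=> t a b; exact: (@transition_wspace _ _ _ hP0 _ hOm _ _ _ hPhi (- n%:R) t a b).
    have mq : measurable_fun setT
        (fun q : measurableTypeR R * wspace P0 * measurableTypeR R => (q.2, q.1.2)).
      apply: measurable_fun_pair; first exact: measurable_snd.
      exact: (measurableT_comp measurable_snd measurable_fst).
    by rewrite ord1; exact: (measurableT_comp (v0_joint k) mq).
  - exact: measurable_cst.
move=> [[t w] r] _; rewrite /kernel_integrand /g/=.
apply: cvg_near_cst; exists (Num.truncn `|r|).+1 => // n /= rn.
have nr : - n%:R <= r.
  rewrite lerNl (le_trans (ler_norm _))// normrN (le_trans (ltW (truncnS_gt _)))//.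
  by rewrite ler_nat.
rewrite nr/=; case: ifPn => // rt.
by rewrite (@transition_betweenE _ _ _ _ hOm _ _ _ hPhi hcocycle _ (wspace P0) id)//= ?max_r//
  ?(le_trans nr) //; move=> t' r' a b; rewrite max_r.
Qed.

Lemma Kop_joint i : @measurable_fun _ _ (measurableTypeR R * wspace P0)%type R (setT `*` Om)
  (fun p : measurableTypeR R * wspace P0 => Kop Phi v p.1 p.2 i 0).
Proof.
have mI := @measurable_fun_fubini_tonelli_F _ _ (measurableTypeR R * wspace P0)%type
  (measurableTypeR R) R mu (EFin \o kernel_integrand i)
  ((measurable_EFinP _ _).2 (kernel_integrand_measurable i))
  (fun q => kernel_integrand_ge0 i q).
have : @measurable_fun _ _ (measurableTypeR R * wspace P0)%type R (setT `*` Om) (fine \o fubini_F mu (EFin \o kernel_integrand i)).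
  apply: measurable_funTS; apply: measurableT_comp mI; exact: (fine_measurable measurableT).
apply: eq_measurable_fun => -[t w] /set_mem[/= _ Ow].
rewrite KopE// mxE /Rintegral/=; congr fine; rewrite /fubini_F [RHS]integral_mkcond.
apply: eq_integral => r _; rewrite patchE /kernel_integrand/=.
have -> : (r \in `]-oo, t]%classic) = (r <= t).
  by apply/idP/idP => [/set_mem|H']; [|apply/mem_set]; rewrite /= in_itv.
by case: ifP => // _; rewrite /v0 mem_set.
Qed.

Hypothesis fv : fixed_point P0 (gain h Phi) v.

Let v_orthant r w : Om w -> orthant (v r w).
Proof. by move=> Ow; have [vb _ _] := hv; have [] := vb r w Ow. Qed.

Let v_bound r w : Om w -> `|v r w| <= N.
Proof.
by move=> Ow; have [vb _ _] := hv; have [ov lv] := vb r w Ow; exact: le_hbound_norm.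
Qed.

Let Kop_orthant r w : Om w -> orthant (Kop Phi v r w).
Proof.
move=> Ow; rewrite KopE//; apply: potential_orthant => [t s i j st|s].
  exact: transition_ge0.
exact: v_orthant.
Qed.

(** The null set in [fixed_point] depends on the time. The defect of the equation has zero integral
    over paths at each time, so by Tonelli its time integral vanishes on almost every path. *)
Lemma fixed_point_ae_time :
  {ae P, forall w, {ae mu, forall r, Om w -> h r (Kop Phi v r w) = v r w}}.
Proof.
pose F : measurableTypeR R * wspace P0 -> \bar R :=
  (fun p => (`|h p.1 (Kop Phi v p.1 p.2) - v p.1 p.2|)%:E) \_ (setT `*` Om).
have F0 p : (0 <= F p)%E by rewrite /F patchE; case: ifP.
have FE r w : Om w -> F (r, w) = (`|h r (Kop Phi v r w) - v r w|)%:E.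
  by move=> Ow; rewrite /F patchE mem_set.
have mF : @measurable_fun _ _ (measurableTypeR R * wspace P0)%type (\bar R) setT F.
  suff mf : @measurable_fun _ _ (measurableTypeR R * wspace P0)%type R (setT `*` Om)
      (fun p => `|h p.1 (Kop Phi v p.1 p.2) - v p.1 p.2|).
    exact: ((measurable_restrictT _ OmRP).1 ((measurable_EFinP _ _).2 mf)).
  apply: measurable_fun_mx_norm => i j; rewrite ord1.
  under eq_fun do rewrite mxE [X in _ + X]mxE.
  apply: measurable_funB; last exact: progressive_joint.
  apply: (measurable_fun_comp_orthant (g := fun r x => h r x i 0)
    (r := fun p : measurableTypeR R * wspace P0 => p.1)).
  - exact: field_continuous fh i.
  - by apply: measurable_funTS; exact: measurable_fst.
  - exact: Kop_joint.
  - by move=> [r w] [/= _ Ow]; exact: Kop_orthant.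
have mG := measurable_fun_fubini_tonelli_G (m1 := mu) F mF F0.
have G0 w : (0 <= fubini_G mu F w)%E by apply: integral_ge0 => r _.
have I0 : (\int[P]_w `|fubini_G mu F w| = 0)%E.
  rewrite (eq_integral (fubini_G mu F)); last by move=> w _; rewrite gee0_abs.
  apply: etrans (esym (fubini_tonelli (m1 := mu) (m2 := P) F mF F0)) _.
  rewrite (eq_integral (fun=> 0%E)) ?integral0// => r _.
  rewrite (eq_integral (fun w => `|F (r, w)|%E)); last by move=> w _; rewrite gee0_abs.
  apply: (ae_eq_integral_abs P measurableT (measurable_fun_pair2 r mF)).2.
  have OmP : {ae P, forall w, Om w} by case: hOm.
  by apply: filterS2 (fv r) OmP => w E Ow _; rewrite FE// -E subrr normr0.
have /(_ I0) := (ae_eq_integral_abs P measurableT mG).1.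
apply: filterS => w /(_ Logic.I) Iw.
have mFw := measurable_fun_pair1 w mF.
have Iw' : (\int[mu]_r `|F (r, w)| = 0)%E.
  by rewrite -[RHS]Iw; apply: eq_integral => r _; rewrite gee0_abs.
have /(_ Iw') := (ae_eq_integral_abs mu measurableT mFw).1.
apply: filterS => r /(_ Logic.I) + Ow; rewrite FE// => -[/eqP].
by rewrite normr_eq0 subr_eq0 => /eqP.
Qed.

Lemma Kop_fixed_pullback : {ae P, forall w, forall t, Kop Phi v t w = pullback t w}.
Proof.
have [gam [g0 gl] H] := flow_pullback.
apply: filterS2 (filterI H pullback_set_ae) fixed_point_ae_time => w [Hw Gw] Fw t.
have [Ow _] := Gw; have [_ uniq] := Hw Ow; have kPsi := transition_stable Ow.
have g2 : 0 < gam / 2 by rewrite divr_gt0.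
have [C C0 PC] := potential_tempered kPsi g2 gl.
have mw : measurable_fun setT (fun r : measurableTypeR R => (r, w : wspace P0)).
  exact: pair2_measurable.
have sec (f : R -> wpath R d -> R) :
    @measurable_fun _ _ (measurableTypeR R * wspace P0)%type R (setT `*` Om)
      (fun p => f p.1 p.2) -> measurable_fun setT (f^~ w).
  move=> mf; apply: (measurable_comp OmRP _ mf mw).
  by move=> _ [r _ <-].
have mv i : measurable_fun setT (fun r => v r w i 0).
  exact: (sec (fun r w => v r w i 0) (progressive_joint i)).
have PE : potential (Psi w) (v^~ w) = (Kop Phi v)^~ w.
  by apply/funext => r; rewrite KopE.
have mp i : measurable_fun setT (fun r => potential (Psi w) (v^~ w) r i 0).
  by rewrite PE; exact: (sec (fun r w => Kop Phi v r w i 0) (Kop_joint i)).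
symmetry; apply: (uniq (pullback^~ w) (fun t => Kop Phi v t w) (C * N)).
- by move=> s; exact: pullback_cvg.
- move=> s; rewrite -PE; apply: (potential_duhamel kPsi fh) => //.
  + by move=> t' s' i j st; exact: transition_ge0.
  + by move=> r; exact: v_orthant.
  + by move=> r; exact: v_bound.
  + have [M [mM M0 HM]] := Fw; exists M; split=> // r nr; apply: HM => hr.
    by apply: nr => /=; rewrite PE; exact: hr.
- exact: mulr_ge0.
- by move=> s; rewrite KopE//; apply: PC => // r; exact: v_bound.
Qed.

Lemma Mspace_section f t i : Mspace P0 Om h T f ->
  @measurable_fun _ _ (wspace P0) R setT (fun w => f t w i 0).
Proof.
move=> [_ pf _]; have mOm := Om_wspace hOm.
have mOmC := measurableC mOm.
rewrite -(setUv Om); apply: (measurable_funU _ mOm mOmC).2; split; last first.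
  (* Off [Om] nothing is known of [f], but every subset of a null set is measurable in the
     completion. *)
  move=> _ B mB; apply: negligible_wspace.
  by apply: (negligibleS _ hOm.1); exact: subIsetl.
have mt : @measurable_fun _ _ (g_sigma_algebraType (Fpast_gen P0 t))
    (measurableTypeR R * g_sigma_algebraType (Fpast_gen P0 t))%type Om (fun w => (t, w)).
  by apply: measurable_funTS; exact: pair1_measurable.
have mOmF : <<s Fpast_gen P0 t >> Om by apply: Fpast_negligible; case: hOm.
have mf : @measurable_fun _ _ (g_sigma_algebraType (Fpast_gen P0 t)) R Om
    (fun w => f t w i 0).
  apply: (measurable_comp _ _ (pf t i) mt).
  - apply: measurableX; last exact: mOmF.
    by rewrite -set_itvNyc; exact: measurable_itv.
  - by move=> _ [w Ow <-]; split=> /=.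
by move=> _ B mB; apply: (@Fpast_wspace t); exact: mf.
Qed.

Lemma fixed_point_unique : Mdist P0 periodic_input v = 0%E.
Proof.
suff E t : ('E_P[(fun w => `|periodic_input t w - v t w|)%R] = 0)%E.
  rewrite /Mdist (_ : [set _ | t in [set: R]] = [set 0%E]) ?ereal_sup1//.
  by apply/seteqP; split => [_ [t _ <-]|_ ->]; [exact: E|exists 0 => //; exact: E].
rewrite unlock.
have mD : @measurable_fun _ _ (wspace P0) (\bar R) setT
    (fun w => (`|periodic_input t w - v t w|)%:E).
  apply/measurable_EFinP; apply: measurable_fun_mx_norm => i j; rewrite ord1.
  under eq_fun do rewrite mxE [X in _ + X]mxE.
  apply: measurable_funB; apply: Mspace_section; last exact: hv.
  exact: periodic_input_Mspace.
have -> : (\int[P]_w (`|periodic_input t w - v t w|)%:E =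
    \int[P]_w `|(`|periodic_input t w - v t w|)%:E|)%E.
  by apply: eq_integral => w _; rewrite gee0_abs.
apply: (ae_eq_integral_abs P measurableT mD).2.
(* At a fixed time, almost surely [v] is [h] of [Kop Phi v], hence [h] of the pull-back limit, which
   is [periodic_input]. *)
apply: filterS2 (filterI Kop_fixed_pullback pullback_set_ae) (fv t) => w [Kw Gw] vw _.
by rewrite -vw /gain Kw /periodic_input mem_set// subrr normr0.
Qed.

End uniqueness.
End periodic_flow.

Theorem theorem4p3 (R : realType) (d : nat)
    (P0 : probability (wborel R d) R) (hP0 : wiener_measure P0)
    (Om : set (wpath R d)) (hOm : universal_set P0 Om)
    (A : 'M[R]_d) (sigma : 'I_d -> 'M[R]_d)
    (hsigma : forall k, is_diag_mx (sigma k))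
    (T : R) (hT : 0 < T)
    (h : R -> 'cV[R]_d -> 'cV[R]_d)
    (hper : forall t x, orthant x -> h (t + T) x = h t x)
    (Phi : R -> wpath R d -> 'M[R]_d)
    (hPhi : fundamental_matrix P0 Om A sigma Phi)
    (hcocycle : linear_cocycle Om Phi)
    (phi : R -> R -> wpath R d -> 'cV[R]_d -> 'cV[R]_d)
    (hphi : generated_flow P0 Om A sigma h Phi phi)
    (lam : R) (Rp : R -> wpath R d -> R)
    (hA : cond_A A) (hL : cond_L P0 Om Phi lam Rp) (hH : cond_H h)
    (hR : cond_R P0 Rp) (hH1 : cond_H1 P0 h lam Rp) :
  exists u : R -> wpath R d -> 'cV[R]_d,
    [/\ Mspace P0 Om h T u,
        fixed_point P0 (gain h Phi) u,
        (forall v, Mspace P0 Om h T v -> fixed_point P0 (gain h Phi) v ->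
           Mdist P0 u v = 0%E),
        (forall t, {ae wprob P0, forall w, forall x, orthant x ->
           (fun n : nat => phi t (- (n%:R * T)) w x) @ \oo --> Kop Phi u t w}) &
        random_periodic_solution P0 Om T phi (Kop Phi u)].
Proof.
have [hC _] := hH.
exists (periodic_input Om T h phi); split.
- exact: (periodic_input_Mspace hP0 hOm hT hC hper hPhi hcocycle hphi hL hR hH1).
- exact: (periodic_input_fixed hP0 hOm hT hC hPhi hcocycle hphi hL hR hH1).
- move=> v hv fv.
  exact: (fixed_point_unique hP0 hOm hT hC hper hPhi hcocycle hphi hL hR hH1 hv fv).
- exact: (Kop_pullback_cvg hP0 hOm hT hC hPhi hcocycle hphi hL hR hH1).
- exact: (Kop_random_periodic hP0 hOm hT hC hper hPhi hcocycle hphi hL hR hH1).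
Qed.
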